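(* There is an algorithm which, given an outerplanar graph $G$ on $n$ vertices and a positive integer $t$, runs in $O(n)$ time and either outputs a tree $t$-spanner of $G$ or correctly reports that $G$ has no tree $t$-spanner.
   Context: All graphs are simple, finite, connected, undirected and unweighted. A graph is outerplanar if it can be embedded in the plane so that all vertices lie on the boundary of the exterior (unbounded) region. For vertices $u,v$ of a graph $H$, $d_H(u,v)$ denotes the number of edges of a shortest $u$–$v$ path in $H$. A tree $t$-spanner of $G$ is a spanning tree $T$ of $G$ such that $d_T(u,v)\le t\cdot d_G(u,v)$ for all vertices $u,v$. *)

(* Defs.v *)
From HB Require Import structures.
From mathcomp Require Import all_boot all_order all_algebra.
From mathcomp Require Import all_classical all_reals.
From mathcomp Require Import topology normedtype.

Set Implicit Arguments.
Unset Strict Implicit.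
Unset Printing Implicit Defensive.

Import Order.TTheory GRing.Theory Num.Theory.
Import numFieldNormedType.Exports.

Local Open Scope classical_set_scope.

Record graph (n : nat) := Graph {
  adj :> rel 'I_n;
  adj_sym : symmetric adj;
  adj_irr : irreflexive adj }.

Definition graph_connected (n : nat) (H : graph n) : Prop :=
  0 < n /\ forall u v, connect H u v.

Definition has_path (n : nat) (H : graph n) (u v : 'I_n) (k : nat) : bool :=
  [exists p : k.-tuple 'I_n, [&& path H u p, last u p == v & uniq (u :: p)]].

(* The least length of a u-v path; paths have fewer than n edges, and the value
   is n when there is none. *)
Definition dist (n : nat) (H : graph n) (u v : 'I_n) : nat :=
  find (has_path H u v) (iota 0 n).

Definition acyclic (n : nat) (H : graph n) : Prop :=
  forall c : seq 'I_n, 2 < size c -> uniq c -> ~~ cycle H c.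

Definition spanning_tree (n : nat) (G T : graph n) : Prop :=
  [/\ subrel T G, graph_connected T & acyclic T].

Definition tree_spanner (n : nat) (t : nat) (G T : graph n) : Prop :=
  spanning_tree G T /\ forall u v, dist T u v <= t * dist G u v.

Section Outerplanar.
Variables (R : realType) (n : nat) (G : graph n).

Local Notation plane := (R * R)%type.

(* The edge {u, v} is represented by the pair (u, v) with u < v. *)
Definition edge_pair (e : 'I_n * 'I_n) : Prop := e.1 < e.2 /\ G e.1 e.2.

Definition plane_embedding
    (pos : 'I_n -> plane) (arc : 'I_n * 'I_n -> R -> plane) : Prop :=
  [/\ injective pos,
      forall e, edge_pair e ->
        [/\ {within `[0%R, 1%R], continuous (arc e)},
            {in `[0%R, 1%R] &, injective (arc e)},
            arc e 0%R = pos e.1 & arc e 1%R = pos e.2],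
      forall e w s, edge_pair e -> (0 < s < 1)%R -> arc e s <> pos w
    & forall e f r s, edge_pair e -> edge_pair f -> e <> f ->
        (0 < r < 1)%R -> (0 < s < 1)%R -> arc e r <> arc f s].

Definition drawing
    (pos : 'I_n -> plane) (arc : 'I_n * 'I_n -> R -> plane) : set plane :=
  range pos `|` \bigcup_(e in edge_pair) (arc e @` `[0%R, 1%R]).

Definition region (D U : set plane) : Prop :=
  exists2 x, ~ D x & U = connected_component (~` D) x.

Definition boundary (U : set plane) : set plane := closure U `\` U°.

Definition outerplanar : Prop :=
  exists pos arc, plane_embedding pos arc /\
    exists U, [/\ region (drawing pos arc) U, ~ bounded_set U
                & forall v, boundary U (pos v)].

End Outerplanar.

(* Random access machine of Cook and Reckhow, over the naturals with truncated
   subtraction. [X i] below stands for the contents of memory cell i. *)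
Inductive instr :=
  | Const of nat & nat        (* Const i a    : X i := a *)
  | Add of nat & nat & nat    (* Add i j k    : X i := X j + X k *)
  | Sub of nat & nat & nat    (* Sub i j k    : X i := X j - X k *)
  | LoadInd of nat & nat      (* LoadInd i j  : X i := X (X j) *)
  | StoreInd of nat & nat     (* StoreInd i j : X (X i) := X j *)
  | Jump of nat & nat         (* Jump l i     : go to instruction l if X i > 0 *)
  | Read of nat               (* Read i       : X i := next input, 0 at the end *)
  | Print of nat              (* Print i      : append X i to the output *)
  | Halt.

Definition program := seq instr.

Record config := Config {
  pc : nat;
  mem : nat -> nat;
  inp : seq nat;
  out : seq nat }.

Definition init (w : seq nat) : config := Config 0 (fun=> 0) w [::].

(* Words have bounded size: an instruction that would write a value larger
   than B cannot be executed. *)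
Definition write (B : nat) (s : config) (rest : seq nat) (i x : nat) :
    option config :=
  if x <= B then
    Some (Config (pc s).+1 (fun j => if j == i then x else mem s j) rest (out s))
  else None.

Definition fetch (P : program) (s : config) : instr := nth Halt P (pc s).

Definition step (P : program) (B : nat) (s : config) : option config :=
  let X := mem s in
  match fetch P s with
  | Const i a => write B s (inp s) i a
  | Add i j k => write B s (inp s) i (X j + X k)
  | Sub i j k => write B s (inp s) i (X j - X k)
  | LoadInd i j => write B s (inp s) i (X (X j))
  | StoreInd i j => write B s (inp s) (X i) (X j)
  | Jump l i => Some (Config (if 0 < X i then l else (pc s).+1)
                             X (inp s) (out s))
  | Read i => write B s (behead (inp s)) i (head 0 (inp s))
  | Print i => Some (Config (pc s).+1 X (inp s) (rcons (out s) (X i)))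
  | Halt => None
  end.

(* [runs P B s T o]: started in s, with words bounded by B, the program P
   halts after executing exactly T instructions, with output o. *)
Inductive runs (P : program) (B : nat) : config -> nat -> seq nat -> Prop :=
  | runs_halt s : fetch P s = Halt -> runs P B s 1 (out s)
  | runs_step s s' T o :
      step P B s = Some s' -> runs P B s' T o -> runs P B s T.+1 o.

(* es lists every edge exactly once, in any order and with any orientation. *)
Definition edge_list (n : nat) (H : graph n) (es : seq ('I_n * 'I_n)) : Prop :=
  let both := es ++ [seq (e.2, e.1) | e <- es] in
  uniq both /\ forall u v, H u v = ((u, v) \in both).

Definition flat (n : nat) (es : seq ('I_n * 'I_n)) : seq nat :=
  flatten [seq [:: val e.1; val e.2] | e <- es].

Definition input_word (n t : nat) (es : seq ('I_n * 'I_n)) : seq nat :=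
  [:: n, t, size es & flat es].

(* The answer is 1 followed by the edges of a tree t-spanner, or 0. *)
Definition correct_answer (n : nat) (G : graph n) (t : nat) (o : seq nat) : Prop :=
  (exists (T : graph n) (ts : seq ('I_n * 'I_n)),
     [/\ tree_spanner t G T, edge_list T ts & o = 1 :: flat ts])
  \/ (o = [:: 0] /\ ~ exists T : graph n, tree_spanner t G T).

(* Main.v *)
From HB Require Import structures.
From mathcomp Require Import all_boot boolp zify.
Require Import Defs.

(** The vertices of an outerplanar drawing all touch the unbounded region, so a
    K4 minor would give, together with that region as a fifth branch set, five
    connected sets in the plane, any two of which can be joined by polygonal
    lines such that lines with disjoint ends do not meet; counting crossings
    modulo 2 excludes this.  Hence an outerplanar graph has no K4 minor, has at
    most 2n edges, and can be dismantled by removing vertices of degree at most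
    2, where the two neighbours of a removed vertex are joined by an edge.
    An edge of the current graph carries two numbers that describe the part of
    the graph that it replaces: the distance of its ends in the best tree on
    that part, and the shortest detour that is left when that part does not
    connect them.  These numbers are updated in constant time, and undoing the
    removals builds a tree t-spanner.  The at most two neighbours of a vertex
    are recovered from the sum of the neighbours and the sum of their squares,
    which avoids adjacency lists. *)

Set Implicit Arguments.
Unset Strict Implicit.
Unset Printing Implicit Defensive.

(** * Graphs without K4 minor *)

(** A part that meets the rest of the graph in two vertices [u], [v] acts on it only through the
    question whether the tree inside the part connects [u] and [v]. If it does, a smaller distance
    is never worse; if it does not, the outer tree must join them closely enough for every edge of
    the part still waiting for a detour. So two numbers suffice, and the better option can be fixed
    greedily. No detour can use a distance above [t], so larger ones are merged into [t.+1], and all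
    weights stay bounded.

    The machine has no multiplication or division, so squares, square roots and halves are tabulated
    once. An edge is found through a cell computed from the unordered pair of its ends. These
    addresses are quadratic in [n], but memory is zero at the start and only linearly many cells are
    written, so linear time is kept while words of polynomial size are needed.

    In the plane, arcs are arbitrary curves, and replacing connected sets by polygonal lines could
    create new crossings. Each line is therefore drawn in the complement of a closed set that
    contains the earlier lines it has to miss. *)

Definition class_rel (V : finType) (H : rel V) (P : pred V) : rel V :=
  [rel x y | [&& H x y, P x & P y]].

(* The four branch sets are the classes [f = 0], ..., [f = 3]. *)
Definition K4_minor (V : finType) (H : rel V) : Prop :=
  exists f : V -> nat,
    (forall x y, f x = f y -> f x < 4 ->
       connect (class_rel H (fun z => f z == f x)) x y) /\
    (forall i j, i < j < 4 -> exists x y, [/\ f x = i, f y = j & H x y]).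

(** For [0 < i < m], position [k] on a path gets class 0 before [i.-1], 1 at [i.-1], 2 at [i], 3
    strictly between [i] and [m], and 4, outside the minor, from [m] on. A sum of thresholds is
    monotone in [k], so each class is a segment of the path. *)
Definition segment_class (i m k : nat) : nat :=
  (i.-1 <= k) + (i <= k) + (i < k) + (m <= k).

Lemma segment_class_mono i m k l : k <= l -> segment_class i m k <= segment_class i m l.
Proof.
move=> kl; have mono j : (j <= k) <= (j <= l).
  by case: (leqP j k) => // jk; rewrite (leq_trans jk kl).
by rewrite /segment_class !leq_add.
Qed.

Lemma segment_class_lt4 i m k : i < m -> segment_class i m k < 4 -> k < m.
Proof.
move=> im; rewrite ltnNge /segment_class; case: (leqP m k) => // mk.
have ik := leq_trans im mk; rewrite ik (ltnW ik).
by rewrite (leq_trans (leq_pred i) (ltnW ik)).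
Qed.

(** * Minimum degree three yields a K4 minor *)

Section MinimumDegree.
Variables (V : finType) (H : rel V).
Hypotheses (Hsym : symmetric H) (Hirr : irreflexive H).
Implicit Types (s : seq V) (x y z : V).

Lemma third_element (A : pred V) a b : 2 < #|A| -> exists y, [/\ A y, y != a & y != b].
Proof.
rewrite cardE => A2; apply: contrapT => nA.
have /uniq_leq_size : {subset enum A <= [:: a; b]}.
  move=> y; rewrite mem_enum !inE => Ay; apply/negPn/negP; rewrite negb_or.
  by case/andP=> ya yb; apply: nA; exists y.
by move/(_ (enum_uniq A))/(leq_trans A2).
Qed.

Lemma class_rel_sym (P : pred V) : connect_sym (class_rel H P).
Proof.
by apply: sym_connect_sym => x y; rewrite /class_rel /= Hsym; case: (H y x); rewrite //= andbC.
Qed.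

Definition simple_path s := (if s is x :: p then path H x p else true) && uniq s.

Lemma simple_path_nth x0 s i : simple_path s -> i.+1 < size s ->
  H (nth x0 s i) (nth x0 s i.+1).
Proof.
case: s => //= x p /andP[pp _]; rewrite ltnS => ip.
by move/(pathP x0): pp => /(_ i ip).
Qed.

Lemma segment_connect x0 s (P : pred V) a b : simple_path s -> a <= b -> b < size s ->
  (forall k, a <= k <= b -> P (nth x0 s k)) ->
  connect (class_rel H P) (nth x0 s a) (nth x0 s b).
Proof.
move=> sp; elim: b => [|b IH] ab bs Pk.
  by move: ab; rewrite leqn0 => /eqP->.
have [->|ab'] := eqVneq a b.+1; first exact: connect0.
have {}ab : a <= b by lia.
apply: connect_trans (IH _ _ _) _ => //; first lia.
  by move=> k kab; apply: Pk; lia.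
by apply/connect1/and3P; split; [exact: simple_path_nth|apply: Pk; lia|apply: Pk; lia].
Qed.

Definition longest s := simple_path s /\ forall s', simple_path s' -> size s' <= size s.

Lemma exists_longest x : exists y s, longest (y :: s).
Proof.
suff: forall k s, 0 < size s -> simple_path s -> #|V| <= size s + k ->
    exists y s, longest (y :: s).
  by move=> /(_ #|V| [:: x]); apply => //=; lia.
elim=> [|k IH] s s0 sp sk; have [[s' [sp' ss']]|ns] := EM (exists s', simple_path s' /\ size s < size s').
- have /andP[_ /card_uniqP U] := sp'; have : #|s'| <= #|V| by exact: max_card.
  by rewrite U; lia.
- case: s s0 sp sk ns => // y s _ sp sk ns; exists y, s; split=> // s' sp'.
  by rewrite leqNgt; apply/negP => ss'; apply: ns; exists s'.
- by apply: (IH s') => //; lia.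
- case: s s0 sp sk ns => // y s _ sp sk ns; exists y, s; split=> // s' sp'.
  by rewrite leqNgt; apply/negP => ss'; apply: ns; exists s'.
Qed.

Lemma longest_nbr x s y : longest (x :: s) -> H x y -> y \in x :: s.
Proof.
move=> [/andP[sp U] mx] xy; apply/negPn/negP => ys.
have /mx /= : simple_path (y :: x :: s).
  by rewrite /simple_path cons_uniq ys U /= Hsym xy sp.
by rewrite ltnn.
Qed.

Hypothesis Hdeg : forall x y, H x y -> 2 < #|H x|.

(** All neighbours of the first vertex of a longest path lie on the path. If the chord to [i] is as
    short as possible among all longest paths, then the first vertex and, after a rotation, vertex
    [i.-1] both have a neighbour beyond [i]. Cutting the path around [i.-1] and [i] then gives the
    four branch sets. *)
Lemma longest_chord_K4 x0 s i : longest s -> 1 < i < size s ->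
  H (nth x0 s 0) (nth x0 s i) -> K4_minor H.
Proof.
elim/ltn_ind: i s => i IH s Ls /andP[i1 isz] H0i.
have [sp mx] := Ls; have /andP[_ Us] := sp.
have nbr s' y : longest s' -> 0 < size s' -> H (nth x0 s' 0) y ->
    exists2 j, j < size s' & y = nth x0 s' j.
  case: s' => // x s' Ls' _ xy; exists (index y (x :: s')).
    by rewrite index_mem (longest_nbr Ls').
  by rewrite nth_index // (longest_nbr Ls').
have [|y [H0y y1 yi]] := @third_element (H (nth x0 s 0)) (nth x0 s 1) (nth x0 s i).
  exact: Hdeg H0i.
have [|j jsz yj] := nbr s y Ls _ H0y; first lia.
have j0 : j != 0 by apply: contraTneq H0y => j0; rewrite yj j0 Hirr.
have j1 : j != 1 by apply: contra_neq y1 => j1; rewrite yj j1.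
have ji : j != i by apply: contra_neq yi => ji; rewrite yj ji.
have [lji|lij] := ltnP j i.
  by apply: (IH j lji s Ls); [lia|rewrite -yj].
have {ji lij}ij : i < j by lia.
(* Rotation: start at vertex [i.-1], run back to vertex 0 and take the chord to vertex [i]. The
   result is again a longest path, and a chord of it that ends below [i] falls under the induction
   hypothesis. *)
pose s' := rev (take i s) ++ drop i s.
have szt : size (take i s) = i by rewrite size_take isz.
have s'E k : k < i -> nth x0 s' k = nth x0 s (i - k.+1).
  by move=> ki; rewrite nth_cat size_rev szt ki nth_rev szt // nth_take //; lia.
have s'E2 k : i <= k -> nth x0 s' k = nth x0 s k.
  move=> ki; rewrite nth_cat size_rev szt ltnNge ki /= nth_drop; congr nth; lia.
have szs' : size s' = size s by rewrite size_cat size_rev -size_cat cat_take_drop.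
have sp' : simple_path s'.
  have Us' : uniq s'.
    rewrite (@perm_uniq _ _ s) // -[X in perm_eq _ X](cat_take_drop i s).
    by rewrite perm_cat2r perm_rev.
  rewrite /simple_path Us' andbT.
  have step k : k.+1 < size s' -> H (nth x0 s' k) (nth x0 s' k.+1).
    rewrite szs' => ks; have [ki|ki] := ltnP k.+1 i.
      rewrite !s'E // ?(ltn_trans _ ki) // Hsym.
      have -> : i - k.+1 = (i - k.+2).+1 by lia.
      by apply: simple_path_nth => //; lia.
    have [ki'|ki'] := eqVneq k.+1 i.
      by rewrite s'E ?s'E2 -?ki' // subnn ki'.
    by rewrite !s'E2; [apply: simple_path_nth|lia|lia].
  case: (s') step => // z p step; apply/(pathP x0) => k kp; exact: step.
have Ls' : longest s' by split=> // u /mx; rewrite szs'.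
have s'0 : nth x0 s' 0 = nth x0 s i.-1 by rewrite s'E ?subn1 //; lia.
have [|z [H0z z2 zi]] := @third_element (H (nth x0 s i.-1)) (nth x0 s i.-2) (nth x0 s i).
  apply: (Hdeg (y := nth x0 s i)).
  by rewrite -{2}(prednK (ltnW i1)); apply: simple_path_nth => //; lia.
have [||m msz zm] := nbr s' z Ls'; rewrite ?s'0 //; first lia.
rewrite szs' in msz.
have m0 : m != 0 by apply: contraTneq H0z => m0; rewrite zm m0 s'0 Hirr.
have m1 : m != 1.
  apply: contra_neq z2 => m1; rewrite zm m1 s'E //; congr nth; lia.
have mi : m != i by apply: contra_neq zi => mi; rewrite zm mi s'E2.
have [lmi|lim] := ltnP m i.
  apply: (IH m lmi s' Ls'); last by rewrite s'0 -zm.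
  by rewrite szs' msz andbT ltn_neqAle eq_sym m1 lt0n.
rewrite s'E2 // in zm; have {lim}im : i < m by rewrite ltn_neqAle eq_sym mi.
(* The classes are the vertices before [i.-1], vertex [i.-1], vertex [i], and the rest. The chords
   to [i], [j] and [m] supply the adjacencies that the path itself does not. *)
pose c := segment_class i (size s).
pose f v := c (index v s).
have fE k : k < size s -> f (nth x0 s k) = c k by move=> ks; rewrite /f index_uniq.
exists f; split.
  have sub a b : a <= b -> b < size s -> f (nth x0 s a) = f (nth x0 s b) ->
      connect (class_rel H (fun v => f v == f (nth x0 s a))) (nth x0 s a) (nth x0 s b).
    move=> ab bs fab; apply: segment_connect => // k /andP[ak kb].
    move: fab; rewrite !fE ?(leq_ltn_trans _ bs) // => fab.
    by rewrite eqn_leq {1}fab !segment_class_mono.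
  move=> v w fvw fv; have in_s u : f u < 4 -> exists2 k, k < size s & u = nth x0 s k.
    move=> fu; have us : u \in s by rewrite -index_mem; exact: segment_class_lt4 isz fu.
    by exists (index u s); rewrite ?index_mem ?nth_index.
  have [a aS av] := in_s v fv; have [|b bS bw] := in_s w; first by rewrite -fvw.
  have [ab|/ltnW ba] := leqP a b; first by rewrite av bw; apply: sub => //; rewrite -av -bw.
  by rewrite fvw class_rel_sym av bw; apply: sub => //; rewrite -av -bw.
have next k : k.+1 < size s -> H (nth x0 s k) (nth x0 s k.+1) by exact: simple_path_nth.
have i0 : 0 < i by exact: ltnW.
have i10 : 0 < i.-1 by rewrite -ltnS prednK.
have i1s : i.-1 < size s by exact: leq_ltn_trans (leq_pred i) isz.
have e01 : H (nth x0 s i.-2) (nth x0 s i.-1).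
  by have := next i.-2; rewrite prednK //; apply.
have e12 : H (nth x0 s i.-1) (nth x0 s i).
  by have := next i.-1; rewrite prednK //; apply.
have e23 : H (nth x0 s i) (nth x0 s i.+1) by apply/next/(leq_ltn_trans ij jsz).
have leF a b : b < a -> (a <= b) = false by move=> ab; rewrite leqNgt ab.
have f0 k : k < i.-1 -> f (nth x0 s k) = 0.
  move=> ki; have kn : k < i by exact: leq_trans ki (leq_pred i).
  have ks := ltn_trans kn isz.
  by rewrite fE // /c /segment_class (leF _ _ ki) (leF _ _ kn) (leF _ _ (leqW kn)) leF.
have f1 : f (nth x0 s i.-1) = 1.
  have kn : i.-1 < i by rewrite prednK.
  by rewrite fE // /c /segment_class leqnn (leF _ _ kn) (leF _ _ (leqW kn)) leF.
have f2 : f (nth x0 s i) = 2.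
  by rewrite fE // /c /segment_class leq_pred leqnn ltnn leF.
have f3 k : i < k < size s -> f (nth x0 s k) = 3.
  move=> /andP[ik ks]; rewrite fE // /c /segment_class ik (ltnW ik) (leF _ _ ks).
  by rewrite (leq_trans (leq_pred i) (ltnW ik)).
move=> k l /andP[]; case: l => [|[|[|[|l]]]] //; case: k => [|[|[|k]]] // _ _.
- by exists (nth x0 s i.-2), (nth x0 s i.-1); rewrite f0 ?f1 // [i.-2.+1]prednK.
- by exists (nth x0 s 0), (nth x0 s i); rewrite f0 ?f2.
- by exists (nth x0 s i.-1), (nth x0 s i); rewrite f1 f2.
- by exists (nth x0 s 0), (nth x0 s j); rewrite f0 ?f3 -?yj ?ij ?jsz.
- by exists (nth x0 s i.-1), (nth x0 s m); rewrite f1 f3 -?zm ?im ?msz.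
- by exists (nth x0 s i), (nth x0 s i.+1); rewrite f2 f3 // ltnSn (leq_ltn_trans ij).
Qed.

Lemma min_degree_K4 x y : H x y -> K4_minor H.
Proof.
move=> xy; have [z [s Ls]] := exists_longest x.
have [sp mx] := Ls.
have := mx [:: x; y]; rewrite /simple_path /= xy !inE /= andbT.
rewrite (contraTneq _ xy) => [/(_ isT)|->]; last by rewrite Hirr.
case: s Ls sp mx => //= u s Ls sp _ _.
have zu : H z u by case/andP: sp => /andP[].
have [v [zv vu _]] := third_element u u (Hdeg zu).
have vs := longest_nbr Ls zv.
apply: (@longest_chord_K4 z (z :: u :: s) (index v (z :: u :: s)) Ls).
  rewrite index_mem vs andbT /= (negbTE (contraTneq _ zv)); last by move=> ->; rewrite Hirr.
  by rewrite eq_sym (negbTE vu).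
by rewrite nth_index.
Qed.

End MinimumDegree.

Lemma sub_K4_minor (V : finType) (H H' : rel V) : subrel H' H -> K4_minor H' -> K4_minor H.
Proof.
move=> sub [f [fc fa]]; exists f; split.
  move=> x y fxy f4; apply: connect_sub (fc x y fxy f4) => u v /and3P[uv fu fv].
  by apply/connect1/and3P; split=> //; exact: sub.
by move=> i j /fa[x [y [fx fy /sub]]]; exists x, y.
Qed.

(** * Elimination of a vertex of degree at most two *)

Definition eliminate (V : finType) (H : rel V) (w : V) : rel V :=
  [rel x y | [&& x != w, y != w & H x y || [&& x != y, H w x & H w y]]].

Section Eliminate.
Variables (V : finType) (H : rel V) (w : V).
Hypotheses (Hsym : symmetric H) (Hirr : irreflexive H).

Lemma eliminate_sym : symmetric (eliminate H w).
Proof.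
by move=> x y; rewrite /eliminate /= andbCA Hsym (eq_sym x y) [H w x && _]andbC.
Qed.

Lemma eliminate_irr : irreflexive (eliminate H w).
Proof. by move=> x; rewrite /eliminate /= Hirr eqxx !andbF. Qed.

(** With at most two neighbours, [w] gives rise to at most one new edge. Putting [w] into the class
    of one of its neighbours makes up for that edge: inside a class it becomes a path through [w],
    and between two classes [w] is adjacent to the other one. Class 4, outside the minor, is the
    default for an isolated [w]. *)
Lemma eliminate_K4_minor : #|H w| <= 2 -> K4_minor (eliminate H w) -> K4_minor H.
Proof.
move=> degw [f [fc fa]].
pose lbl := if [pick a | H w a] is Some a then f a else 4.
pose g v := if v == w then lbl else f v.
have gE v : v != w -> g v = f v by rewrite /g => /negbTE->.
have gw : g w = lbl by rewrite /g eqxx.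
have wlbl a b : a != b -> H w a -> H w b -> lbl = f a \/ lbl = f b.
  move=> ab wa wb; rewrite /lbl; case: pickP => [c wc|/(_ a)]; last by rewrite wa.
  have [->|ca] := eqVneq c a; first by left.
  have [->|cb] := eqVneq c b; first by right.
  suff : 2 < #|H w| by rewrite ltnNge degw.
  by apply/card_gt2P; exists a, b, c; rewrite ab (eq_sym b) cb ca.
have conn x y : x != w -> y != w -> f x = f y -> f x < 4 ->
    connect (class_rel H (fun z => g z == f x)) x y.
  move=> xw yw fxy f4; apply: connect_sub (fc x y fxy f4) => u v.
  move=> /and3P[/and3P[uw vw /orP[uv|/and3P[nuv wu wv]]] /eqP fu /eqP fv].
    by apply/connect1/and3P; split; rewrite //= gE ?fu ?fv.
  have gwx : g w = f x by rewrite gw; case: (wlbl u v nuv wu wv) => ->.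
  apply: (@connect_trans _ _ w); apply/connect1/and3P.
    by split; rewrite /= ?(gE _ uw) ?gwx ?fu // Hsym.
  by split; rewrite /= ?(gE _ vw) ?gwx ?fv.
exists g; split=> [x y|i j ij].
  have wconn a : H w a -> f a = lbl -> f a < 4 ->
      forall y, y != w -> f y = lbl -> connect (class_rel H (fun z => g z == lbl)) w y.
    move=> wa fal fa4 z zw fz.
    have aw : a != w by apply: contraTneq wa => ->; rewrite Hirr.
    apply: connect_trans (_ : connect _ a z); last by rewrite -fal; apply: conn; rewrite // fal.
    by apply/connect1/and3P; split; rewrite //= ?gw // gE // fal.
  have [->|xw] := eqVneq x w; have [->|yw] := eqVneq y w; rewrite ?gw //.
  - rewrite gE // => fy l4; move: l4 (erefl lbl); rewrite {1 3}/lbl.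
    case: pickP => // a wa fa4 la; apply: (wconn a) => //.
  - rewrite gE // => fx f4; rewrite class_rel_sym // fx.
    move: f4 (erefl lbl); rewrite fx {1 3}/lbl; case: pickP => // a wa fa4 la.
    by apply: (wconn a).
  - by rewrite !gE // => fxy f4; apply: conn.
have [x [y [fx fy /and3P[xw yw /orP[xy|/and3P[nxy wx wy]]]]]] := fa i j ij.
  by exists x, y; rewrite !gE.
have [l|l] := wlbl x y nxy wx wy.
  by exists w, y; rewrite gw gE // l.
by exists x, w; rewrite gw gE // l Hsym.
Qed.

End Eliminate.

(** Eliminated vertices stay in the type as isolated vertices, so a vertex of low degree is sought
    only inside [L], which carries all edges. *)
Lemma K4_minor_free_low_degree (V : finType) (H : rel V) (L : pred V) x :
  symmetric H -> irreflexive H -> (forall u v, H u v -> L u) -> ~ K4_minor H -> L x ->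
  exists2 w, L w & #|H w| <= 2.
Proof.
move=> Hsym Hirr HL nK Lx; apply: contrapT => nw.
have deg u : L u -> 2 < #|H u|.
  by move=> Lu; rewrite ltnNge; apply/negP => du; apply: nw; exists u.
apply: nK; have /(leq_trans (isT : 0 < 3)) /card_gt0P[y xy] := deg x Lx.
by apply: (@min_degree_K4 V H Hsym Hirr _ x y) => // u v /HL; exact: deg.
Qed.

(** Edges are counted as ordered pairs, so this means at most [2 * #|V|] edges. Deleting a vertex of
    degree at most 2 removes at most four pairs and leaves a subgraph, which again has no K4
    minor. *)
Lemma K4_minor_free_card (V : finType) (H : rel V) :
  symmetric H -> irreflexive H -> ~ K4_minor H ->
  #|[pred e : V * V | H e.1 e.2]| <= 4 * #|V|.
Proof.
move=> Hsym Hirr nK.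
suff S k (L : pred V) : #|L| <= k ->
    #|[pred e : V * V | class_rel H L e.1 e.2]| <= 4 * k.
  apply: leq_trans (S #|V| predT (max_card _)).
  by apply/subset_leq_card/subsetP => e; rewrite !inE /class_rel /= !andbT.
elim: k L => [|k IH] L Lk.
  rewrite muln0 leqn0; apply/eqP/eq_card0 => e; rewrite !inE.
  move: Lk; rewrite leqn0 => /eqP/card0_eq L0; apply/negP => /and3P[_ L1 _].
  by have := L0 e.1; rewrite [e.1 \in L]L1.
have [L0|[x Lx]] : L =1 pred0 \/ exists x, L x.
  have [[x Lx]|nL] := EM (exists x, L x); first by right; exists x.
  by left=> x; apply/negP => Lx; apply: nL; exists x.
  rewrite (leq_trans _ (leq0n _)) // leqn0; apply/eqP/eq_card0 => e; rewrite !inE.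
  by rewrite /class_rel /= L0 /= andbF.
have sub : subrel (class_rel H L) H by move=> u v /and3P[].
have [|||w Lw dw] := @K4_minor_free_low_degree V (class_rel H L) L x _ _ _ (fun K => nK (sub_K4_minor sub K)) Lx.
- by move=> u v; rewrite /class_rel /= Hsym; case: (H v u); rewrite //= andbC.
- by move=> u; rewrite /class_rel /= Hirr.
- by move=> u v /and3P[].
pose L' := [predD1 L & w].
have cL' : #|L'| <= k by move: Lk; rewrite (cardD1 w) [w \in L]Lw add1n ltnS.
have := IH _ cL'.
set E' := [pred e | _]; set E := [pred e | _] => E'k.
pose N := class_rel H L w.
have : #|E| <= #|[predU E' & [predU [pred e : V * V | (e.1 == w) && N e.2] & [pred e : V * V | (e.2 == w) && N e.1]]]|.
  apply/subset_leq_card/subsetP => e; rewrite !inE /N /class_rel /= => /and3P[He L1 L2].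
  rewrite He L1 L2 Lw /= !andbT.
  case: (eqVneq e.1 w) => [<-|n1]; first by rewrite He ?orbT.
  case: (eqVneq e.2 w) => [e2|n2] /=; last by rewrite [e.1 \in L]L1 [e.2 \in L]L2.
  by rewrite -e2 Hsym He orbT.
have c1 : #|[pred e : V * V | (e.1 == w) && N e.2]| <= 2.
  apply: leq_trans dw; rewrite -(card_imset N (f := pair w)); last by move=> ? ? [].
  apply/subset_leq_card/subsetP => -[a b]; rewrite !inE /= => /andP[/eqP-> Nb].
  by apply/imsetP; exists b.
have c2 : #|[pred e : V * V | (e.2 == w) && N e.1]| <= 2.
  apply: leq_trans dw; rewrite -(card_imset N (f := fun a => (a, w))); last by move=> ? ? [].
  apply/subset_leq_card/subsetP => -[a b]; rewrite !inE /= => /andP[/eqP-> Nb].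
  by apply/imsetP; exists a.
have cU (A B : pred (V * V)) : #|[predU A & B]| <= #|A| + #|B|.
  by rewrite -cardUI leq_addr.
move=> /leq_trans; apply; apply: leq_trans (cU _ _) _.
rewrite mulnS addnC leq_add //; apply: leq_trans (cU _ _) _.
exact: (leq_add c1 c2).
Qed.

(** * Weighted trees *)

Section WeightedTrees.
Variable V : finType.
Implicit Types (F H : rel V) (p q : V -> V -> nat) (L S : pred V) (a b u v w x y z : V).

Inductive walk F p : V -> V -> nat -> Prop :=
  | walk_nil x : walk F p x x 0
  | walk_cons x y z k : F x y -> walk F p y z k -> walk F p x z (p x y + k).

Lemma walk1 F p x y : F x y -> walk F p x y (p x y).
Proof. by move=> xy; rewrite -[p x y]addn0; apply: walk_cons xy _; exact: walk_nil. Qed.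

Lemma walk_cat F p x y z k l : walk F p x y k -> walk F p y z l -> walk F p x z (k + l).
Proof.
by elim=> // {}x u {}y {}k xu _ IH /IH yz; rewrite -addnA; exact: walk_cons.
Qed.

Lemma walk_inv F p x z k : walk F p x z k -> x != z ->
  exists y l, [/\ F x y, walk F p y z l & k = p x y + l].
Proof. by case=> [u|u v s l uv vs _]; rewrite ?eqxx //; exists v, l. Qed.

Lemma walk_map F p F' p' B x y k : walk F p x y k -> k <= B ->
  (forall u v, F u v -> p u v <= B -> exists2 l, l <= p u v & walk F' p' u v l) ->
  exists2 l, l <= k & walk F' p' x y l.
Proof.
move=> + + E; elim=> [u _|{}x u {}y {}k xu _ IH kB].
  by exists 0 => //; exact: walk_nil.
have [|l1 l1k w1] := IH; first lia.
have [|l2 l2k w2] := E _ _ xu; first lia.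
by exists (l2 + l1); [lia|exact: walk_cat w2 w1].
Qed.

Lemma walk_connect F p F' p' x y k : walk F p x y k ->
  (forall u v, F u v -> exists l, walk F' p' u v l) -> exists l, walk F' p' x y l.
Proof.
move=> + E; elim=> [u|{}x u {}y {}k xu _ [l1 w1]]; first by exists 0; exact: walk_nil.
by have [l2 w2] := E _ _ xu; exists (l2 + l1); exact: walk_cat w2 w1.
Qed.

Definition cut F u v S :=
  [/\ S u, ~~ S v & forall x y, F x y -> S x -> ~~ S y -> x = u /\ y = v].

Lemma walk_cut F p u v S x y k : cut F u v S -> walk F p x y k -> S x -> ~~ S y ->
  p u v <= k.
Proof.
move=> [Su Sv SE]; elim=> [z ->//|{}x z {}y {}k xz _ IH Sx Sy].
have [Sz|Sz] := boolP (S z); first by rewrite (leq_trans (IH Sz Sy)) // leq_addl.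
by have [-> ->] := SE _ _ xz Sx Sz; rewrite leq_addr.
Qed.

Definition spans L F p := forall x y, L x -> L y -> exists k, walk F p x y k.
(** A forest is described by a cut for each edge. Unlike the absence of cycles, this is easily
    carried through attaching a leaf, subdividing an edge and contracting a path. *)
Definition bridges F := forall u v, F u v -> exists S, cut F u v S.

(** A passage [u], [w], [v] is replaced by the new edge [uv], or dropped if [u] equals [v]. The
    second half of the claim [S] concerns a walk that starts at [w]: it is charged with the edge by
    which [w] was entered. *)
Lemma eliminate_walk F p p' w x y k : symmetric F ->
  (forall u v, F u v -> u != w -> v != w -> p' u v <= p u v) ->
  (forall u v, u != v -> F w u -> F w v -> p' u v <= p u w + p w v) ->
  irreflexive F ->
  walk F p x y k -> x != w -> y != w ->
  exists2 l, l <= k & walk (eliminate F w) p' x y l.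
Proof.
move=> Fsym E1 E2 Firr.
suff S : walk F p x y k -> y != w ->
    (x != w -> exists2 l, l <= k & walk (eliminate F w) p' x y l) /\
    (x = w -> forall a, F w a -> exists2 l, l <= p a w + k & walk (eliminate F w) p' a y l).
  by move=> xy xw yw; case: (S xy yw) => /(_ xw).
elim=> [u uw|{}x z {}y {}k xz _ IH yw].
  by split=> [_|uE]; [exists 0 => //; exact: walk_nil|rewrite uE eqxx in uw].
have {IH}[IH1 IH2] := IH yw; split=> [xw|xE a wa].
  have [zE|zw] := eqVneq z w.
    by rewrite zE; apply: IH2 => //; rewrite Fsym -zE.
  have [l lk wl] := IH1 zw; exists (p' x z + l); first by rewrite leq_add // E1.
  by apply: walk_cons wl; rewrite /eliminate /= xw zw xz.
subst x; have nw u : F w u -> u != w by apply: contraTneq => ->; rewrite Firr.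
have [l lk wl] := IH1 (nw _ xz).
have [<-|za] := eqVneq z a; first by exists l => //; lia.
exists (p' a z + l).
  by rewrite addnA leq_add // E2 // eq_sym.
by apply: walk_cons wl; rewrite /eliminate /= !nw // wa xz (eq_sym a) za orbT.
Qed.

(** A new edge that crosses the cut of an old edge would come from an edge at [w] that crosses it.
    For the new edge [uv], the cut of [uw] serves, since [w] has no third edge that could become a
    crossing. *)
Lemma eliminate_bridges F w : symmetric F -> irreflexive F -> #|F w| <= 2 ->
  bridges F -> bridges (eliminate F w).
Proof.
move=> Fsym Firr dw br u v /and3P[uw vw /orP[uv|/and3P[nuv wu wv]]].
  have [S [Su Sv SE]] := br u v uv; exists S; split=> // x y.
  move=> /and3P[xw yw /orP[xy|/and3P[nxy wx wy]]] Sx Sy; first exact: SE.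
  have [Sw|Sw] := boolP (S w).
    by have [Ew _] := SE _ _ wy Sw Sy; rewrite Ew eqxx in uw.
  by rewrite Fsym in wx; have [_ Ew] := SE _ _ wx Sx Sw; rewrite Ew eqxx in vw.
rewrite Fsym in wu; have [S [Su Sw SE]] := br u w wu; exists S.
have only z : F w z -> S z -> z = u.
  by move=> wz Sz; rewrite Fsym in wz; case: (SE _ _ wz Sz Sw).
have Sv : ~~ S v by apply/negP => Sv; rewrite (only v) ?eqxx // in nuv.
split=> // x y /and3P[xw yw /orP[xy|/and3P[nxy wx wy]]] Sx Sy.
  by have [_ yE] := SE _ _ xy Sx Sy; rewrite yE eqxx in yw.
have xu := only x wx Sx; split=> //; apply/eqP; apply/negPn/negP => yv.
suff : 2 < #|F w| by rewrite ltnNge dw.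
apply/card_gt2P; exists u, v, y; split; first by split=> //; rewrite [_ \in _]Fsym.
by split=> //; [rewrite eq_sym|rewrite eq_sym -xu].
Qed.

Definition add_edge F a b : rel V :=
  [rel x y | [|| F x y, (x == a) && (y == b) | (x == b) && (y == a)]].
Definition del_edge F a b : rel V :=
  [rel x y | [&& F x y, ~~ ((x == a) && (y == b)) & ~~ ((x == b) && (y == a))]].

Lemma add_edge_sym F a b : symmetric F -> symmetric (add_edge F a b).
Proof.
by move=> Fs x y; rewrite /add_edge /= Fs; congr (_ || _); rewrite orbC !(andbC (y == _)).
Qed.

Lemma del_edge_sym F a b : symmetric F -> symmetric (del_edge F a b).
Proof.
move=> Fs x y; rewrite /del_edge /= Fs; congr (_ && _).
by rewrite andbC !(andbC (y == _)).
Qed.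

Lemma add_leaf_bridges F w a : (forall x y, F x y -> x != w /\ y != w) -> a != w ->
  bridges F -> bridges (add_edge F w a).
Proof.
move=> Fw aw br u v /or3P[uv|/andP[/eqP-> /eqP->]|/andP[/eqP-> /eqP->]].
- have [S [Su Sv SE]] := br u v uv; have [uw vw] := Fw _ _ uv.
  exists (fun x => if x == w then S a else S x).
  split; rewrite ?(negbTE uw) ?(negbTE vw) // => x y.
  case/or3P=> [xy|/andP[/eqP-> /eqP->]|/andP[/eqP-> /eqP->]].
  + by have [/negbTE-> /negbTE->] := Fw _ _ xy; exact: SE.
  + by rewrite eqxx (negbTE aw) => ->.
  + by rewrite eqxx (negbTE aw) => ->.
- exists (pred1 w); split; rewrite /= ?eqxx // => x y /or3P[xy||].
  + by have [/negbTE-> _] := Fw _ _ xy.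
  + by case/andP=> /eqP-> /eqP->.
  + by case/andP=> /eqP-> /eqP-> /eqP aE; rewrite aE eqxx in aw.
- exists (predC1 w); split; rewrite /= ?eqxx // => x y /or3P[xy||].
  + by have [_ ->] := Fw _ _ xy.
  + by case/andP=> /eqP-> /eqP->; rewrite eqxx.
  + by case/andP=> /eqP-> /eqP->.
Qed.

(** Taking [w] out of, or into, a cut of [ab] gives cuts for the two halves. A cut of any other edge
    has [a] and [b] on one side, and [w] joins that side. *)
Lemma subdivide_bridges F w a b : symmetric F -> (forall x y, F x y -> x != w /\ y != w) ->
  F a b -> a != b -> bridges F ->
  bridges (add_edge (add_edge (del_edge F a b) w a) w b).
Proof.
move=> Fsym Fw ab nab br.
have [aw bw] := Fw _ _ ab.
have ba : F b a by rewrite Fsym.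
pose F1 := add_edge (add_edge (del_edge F a b) w a) w b.
have F1E x y : F1 x y -> [\/ del_edge F a b x y, x = w /\ (y = a \/ y = b)
                          | y = w /\ (x = a \/ x = b)].
  by case/or3P=> [/or3P[xy||]||]; [constructor 1| | | |]=> //;
    case/andP=> /eqP-> /eqP->; [constructor 2|constructor 3|constructor 2|constructor 3];
    split=> //; [left|left|right|right].
have F1E' a' b' : (a' = a /\ b' = b) \/ (a' = b /\ b' = a) -> forall x y, F1 x y ->
    [\/ F x y /\ ~ (x = a' /\ y = b'), x = w /\ (y = a' \/ y = b')
      | y = w /\ (x = a' \/ x = b')].
  move=> E x y /F1E[/and3P[xy n1 n2]|[xw yab]|[yw xab]].
  - constructor 1; split=> // -[Ex Ey]; move: n1 n2; rewrite Ex Ey.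
    by case: E => -[-> ->]; rewrite !eqxx.
  - by constructor 2; split=> //; case: E => -[-> ->] //; case: yab; [right|left].
  - by constructor 3; split=> //; case: E => -[-> ->] //; case: xab; [right|left].
have side a' b' S : F a' b' -> (a' = a /\ b' = b) \/ (a' = b /\ b' = a) -> cut F a' b' S ->
    (exists S, cut F1 a' w S) /\ (exists S, cut F1 w b' S).
  move=> ab' /F1E' E [Sa Sb SE]; have [aw' bw'] := Fw _ _ ab'; split.
    exists (fun x => (x != w) && S x); split; rewrite ?aw' ?eqxx // => x y /E.
    case=> [[xy nxy]|[-> _]|[-> xab]]; rewrite ?eqxx //.
      by have [-> ->] := Fw _ _ xy => /= Sx Sy; case: nxy; exact: SE.
    by case: xab => [->//|->]; rewrite (negbTE Sb) andbF.
  exists (fun x => (x == w) || S x); split; rewrite ?eqxx ?(negbTE bw') //= => x y /E.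
  case=> [[xy nxy]|[-> yab]|[-> _]]; rewrite ?eqxx //.
    by have [/negbTE-> /negbTE->] := Fw _ _ xy => /= Sx Sy; case: nxy; exact: SE.
  by case: yab => [->|->//]; rewrite Sa orbT.
have [S1 c1] := br a b ab; have [S2 c2] := br b a ba.
have [aw1 wb1] := side _ _ _ ab (or_introl (conj erefl erefl)) c1.
have [bw1 wa1] := side _ _ _ ba (or_intror (conj erefl erefl)) c2.
move=> u v uv; case: (F1E _ _ uv) => [/and3P[Fuv n1 n2]|[-> [->|->]]|[-> [->|->]]] //.
have [S [Su Sv SE]] := br u v Fuv; have [uw vw] := Fw _ _ Fuv.
have Sab : S a = S b.
  apply/idP/idP => [Sa|Sb]; apply/negPn/negP => nS.
    by have [Ea Eb] := SE _ _ ab Sa nS; rewrite -Ea -Eb !eqxx in n1.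
  by have [Eb Ea] := SE _ _ ba Sb nS; rewrite -Ea -Eb !eqxx in n2.
exists (fun x => if x == w then S a else S x).
split; rewrite ?(negbTE uw) ?(negbTE vw) // => x y.
case/F1E=> [/and3P[xy _ _]|[-> yab]|[-> xab]].
- by have [/negbTE-> /negbTE->] := Fw _ _ xy; exact: SE.
- by rewrite eqxx; case: yab => ->; rewrite ?(negbTE aw) ?(negbTE bw) -?Sab => ->.
- by rewrite eqxx; case: xab => ->; rewrite ?(negbTE aw) ?(negbTE bw) -?Sab => ->.
Qed.
End WeightedTrees.

(** * Weighted graphs and their feasible trees *)

Section Feasible.
Variables (V : finType) (t : nat).
Implicit Types (F : rel V) (a b u v w x y z : V).

(* An edge [uv] stands for the part of the graph that was eliminated between [u]
   and [v]: [wp u v] is the least distance of [u] and [v] in a tree on that part,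
   with [t.+1] for any larger distance and [t.+2] if there is no such tree, and
   [wq u v] is the least detour that remains if that part does not connect them. *)
Record wgraph := WGraph {
  live : pred V;
  wadj : rel V;
  wp : V -> V -> nat;
  wq : V -> V -> nat }.

(** The clause on [wq] makes a missing edge neutral: detour costs are combined by a maximum, and 0
    asks for nothing. *)
Definition wgraph_ok (g : wgraph) : Prop :=
  [/\ symmetric (wadj g) /\ irreflexive (wadj g),
      forall u v, wadj g u v -> live g u,
      (forall u v, wp g u v = wp g v u) /\ (forall u v, wq g u v = wq g v u),
      forall u v, live g u -> live g v -> ~~ wadj g u v -> wq g u v = 0
    & spans (live g) (wadj g) (wp g)].

(** These are the trees of the current graph that can be expanded to solutions of the original one.
    A tree edge may have weight [t.+1], since its part still has a tree, although no detour can
    afford it; [t.+2] is forbidden. *)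
Definition feasible (g : wgraph) F : Prop :=
  [/\ symmetric F /\ subrel F (wadj g), spans (live g) F (wp g), bridges F,
      forall u v, F u v -> wp g u v <= t.+1
    & forall u v, wadj g u v -> ~~ F u v ->
        exists2 k, walk F (wp g) u v k & k + wq g u v <= t].

Section Step.
Variables (g : wgraph) (w : V).
Local Notation H := (wadj g).
Local Notation p := (wp g).
Local Notation q := (wq g).

(** [series_p] is the length of the path [x], [w], [y], capped at [t.+1], except that [t.+2] on one
    half is preserved. [series_q] is the cost if [w] hangs at one end only: the edge to the other
    end needs a detour through the first, and the cheaper end is taken. *)
Definition series_p x y := minn (p w x + p w y) (maxn t.+1 (maxn (p w x) (p w y))).
Definition series_q x y := minn t.+1 (minn (p w x + q w y) (p w y + q w x)).
Definition nbr_pair x y := [&& x != y, H w x & H w y].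

(** If both the edge [xy] and the path through [w] are present, a tree can connect [x] and [y] by
    only one of them, and the other one must then afford its detour along the first. *)
Definition keep_old x y := if p x y + series_q x y <= t then p x y else t.+2.
Definition use_series x y := if series_p x y + q x y <= t then series_p x y else t.+2.

Definition new_p x y :=
  if nbr_pair x y then
    if H x y then minn (keep_old x y) (use_series x y) else series_p x y
  else p x y.
(** If neither connection is in the tree, the same outer path has to serve both detours, hence the
    maximum. *)
Definition new_q x y :=
  if nbr_pair x y then maxn (q x y) (series_q x y) else q x y.

Definition eliminate_vertex : wgraph :=
  WGraph (fun x => (x != w) && live g x) (eliminate H w) new_p new_q.

Hypothesis gok : wgraph_ok g.
Hypothesis Lw : live g w.
Hypothesis degw : #|H w| <= 2.

Lemma nbr_pairC x y : nbr_pair x y = nbr_pair y x.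
Proof. by rewrite /nbr_pair eq_sym [H w x && _]andbC. Qed.

Lemma series_pC x y : series_p x y = series_p y x.
Proof. by rewrite /series_p addnC (maxnC (p w x)). Qed.

Lemma series_qC x y : series_q x y = series_q y x.
Proof. by rewrite /series_q (minnC (p w x + _)). Qed.

Lemma new_pC x y : new_p x y = new_p y x.
Proof.
have [[Hs _] _ [ps qs] _ _] := gok.
by rewrite /new_p /keep_old /use_series nbr_pairC series_pC series_qC Hs ps qs.
Qed.

Lemma new_qC x y : new_q x y = new_q y x.
Proof.
have [[Hs _] _ [ps qs] _ _] := gok.
by rewrite /new_q nbr_pairC series_qC qs.
Qed.

Lemma nbr_pair_third x y z : nbr_pair x y -> H w z -> z = x \/ z = y.
Proof.
move=> /and3P[xy wx wy] wz; have [->|zx] := eqVneq z x; first by left.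
have [->|zy] := eqVneq z y; first by right.
suff : 2 < #|H w| by rewrite ltnNge degw.
by apply/card_gt2P; exists x, y, z; rewrite xy (eq_sym y) zy zx.
Qed.

Lemma wadj_neq x y : H x y -> x != y.
Proof. by have [[_ Hi] _ _ _ _] := gok; apply: contraTneq => ->; rewrite Hi. Qed.

Lemma nbr_pair_neq x y : nbr_pair x y -> x != w /\ y != w.
Proof. by move=> /and3P[_ /wadj_neq wx /wadj_neq wy]; rewrite !(eq_sym _ w). Qed.

Lemma eliminate_ok : wgraph_ok eliminate_vertex.
Proof.
have [[Hs Hi] HL [ps qs] q0 Hc] := gok; split=> /=.
- by split; [exact: eliminate_sym|exact: eliminate_irr].
- move=> u v /and3P[uw vw /orP[uv|/and3P[_ wu _]]]; rewrite uw /=.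
    exact: HL uv.
  by apply: (HL u w); rewrite Hs.
- by split=> u v; [exact: new_pC|exact: new_qC].
- move=> u v /andP[uw Lu] /andP[vw Lv]; rewrite /eliminate /= uw vw /= negb_or.
  by case/andP=> nuv npair; rewrite /new_q /nbr_pair (negbTE npair) q0.
- move=> x y /andP[xw Lx] /andP[yw Ly]; have [k wk] := Hc x y Lx Ly.
  (* Only the existence of a walk matters here; weight 0 on the pairs of neighbours satisfies both
     inequalities of [eliminate_walk]. *)
  pose p1 u v := if nbr_pair u v then 0 else p u v.
  have [||l _ wl] := @eliminate_walk V H p p1 w x y k Hs _ _ Hi wk xw yw.
  - by move=> u v _ _ _; rewrite /p1; case: ifP.
  - by move=> u v uv wu wv; rewrite /p1 /nbr_pair uv wu wv.
  by apply: (walk_connect wl) => u v uv; exists (new_p u v); exact: walk1.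
Qed.

(** * Feasible trees survive an elimination *)

Section Forward.
Variable F : rel V.
Hypothesis Ff : feasible g F.

Lemma feasible_edge_at w' : live g w' -> w != w' -> exists z, F w z.
Proof.
have [_ Fc _ _ _] := Ff => Lw' nw; have [k wk] := Fc w w' Lw Lw'.
by have [z [l [wz _ _]]] := walk_inv wk nw; exists z.
Qed.

Lemma feasible_triangle x y : F x y -> nbr_pair x y -> F w x -> ~~ F w y.
Proof.
have [[Fs FH] _ br _ _] := Ff => xy pxy wx; apply/negP => wy.
have [xw yw] := nbr_pair_neq pxy; have /and3P[nxy _ _] := pxy.
have [S [Sw Sx SE]] := br w x wx.
have [Sy|Sy] := boolP (S y); last first.
  by have [_ E] := SE _ _ wy Sw Sy; rewrite E eqxx in nxy.
rewrite Fs in xy; have [E _] := SE _ _ xy Sy Sx; by rewrite E eqxx in yw.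
Qed.

(* If only [wx] is in the tree, the detour for [wy] runs through [x]. *)
Lemma feasible_detour x y : nbr_pair x y -> F w x -> ~~ F w y ->
  exists2 k, walk F p x y k & k + series_q x y <= t.
Proof.
have [[Fs FH] _ br _ cons] := Ff => pxy wx wy.
have /and3P[nxy Hwx Hwy] := pxy.
have [k wk kt] := cons w y Hwy wy.
have [z [l [wz wl kE]]] := walk_inv wk (wadj_neq Hwy).
have [zE|zE] := nbr_pair_third pxy (FH _ _ wz); last by rewrite zE (negbTE wy) in wz.
subst z; exists l => //; rewrite /series_q; lia.
Qed.

(** The tree holds [xy] and one of the edges from [w]. The detour for the other one joins [x] and
    [y], so it crosses the bridge [xy] and is at least as long as it. *)
Lemma feasible_keep_old x y : F x y -> nbr_pair x y -> p x y + series_q x y <= t.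
Proof.
move=> xy pxy; have [[Fs FH] Fc br _ _] := Ff; have [_ HL _ _ _] := gok.
wlog wx : x y xy pxy / F w x.
  move=> W; have [z wz] : exists z, F w z.
    have [xw _] := nbr_pair_neq pxy.
    by apply: (@feasible_edge_at x); [exact: HL (FH _ _ xy)|rewrite eq_sym].
  have [zE|zE] := nbr_pair_third pxy (FH _ _ wz); subst z; first exact: W.
  have [_ _ [ps _] _ _] := gok.
  by rewrite ps series_qC; apply: W => //; [rewrite Fs|rewrite nbr_pairC].
have [k wk kt] := feasible_detour pxy wx (feasible_triangle xy pxy wx).
have [S [Sx Sy SE]] := br x y xy.
have := @walk_cut V F p x y S x y k (And3 Sx Sy SE) wk Sx Sy; lia.
Qed.

Lemma Firr : irreflexive F.
Proof.
have [[_ FH] _ _ _ _] := Ff; have [[_ Hi] _ _ _ _] := gok => x.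
by apply/negP => /FH; rewrite Hi.
Qed.

Lemma Fdeg : #|F w| <= 2.
Proof.
have [[_ FH] _ _ _ _] := Ff; apply: leq_trans degw.
by apply/subset_leq_card/subsetP => x; exact: FH.
Qed.

(** Contracted to one edge, the path through [w] is a bridge that separates [x] from [y]. The detour
    for the edge [xy], which is not in the tree, is therefore at least as long as that path. *)
Lemma feasible_series x y : x != y -> F w x -> F w y ->
  H x y -> series_p x y + q x y <= t.
Proof.
move=> nxy wx wy xy; have [[Fs FH] Fc br _ cons] := Ff.
have [_ _ [ps _] _ _] := gok.
have pxy : nbr_pair x y by rewrite /nbr_pair nxy !FH.
have [xw yw] := nbr_pair_neq pxy.
have nF : ~~ F x y.
  by apply/negP => Fxy; move: (feasible_triangle Fxy pxy wx); rewrite wy.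
have [k wk kt] := cons x y xy nF.
pose p1 u v := if F u v then p u v else p w u + p w v.
have [||l lk wl] := @eliminate_walk V F p p1 w x y k Fs _ _ Firr wk xw yw.
- by move=> u v uv _ _; rewrite /p1 uv.
- move=> u v uv wu wv; rewrite /p1; case: ifP => [Fuv|_]; last by rewrite (ps u w).
  have puv : nbr_pair u v by rewrite /nbr_pair uv !FH.
  by have := feasible_triangle Fuv puv wu; rewrite wv.
have [S cS] : exists S, cut (eliminate F w) x y S.
  apply: eliminate_bridges => //; [exact: Firr|exact: Fdeg|].
  by rewrite /eliminate /= xw yw nxy wx wy orbT.
have [Sx Sy _] := cS; have := walk_cut cS wl Sx Sy; rewrite /p1 (negbTE nF) => sl.
apply: leq_trans kt; rewrite leq_add2r; apply: leq_trans (geq_minl _ _) _.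
exact: leq_trans sl lk.
Qed.

Lemma feasible_eliminate : feasible eliminate_vertex (eliminate F w).
Proof.
have [[Fs FH] Fc br use cons] := Ff; have [[Hs Hi] HL [ps qs] q0 Hc] := gok.
have A u v : F u v -> u != w -> v != w -> new_p u v <= p u v.
  move=> uv uw vw; rewrite /new_p; case: ifP => // puv; rewrite FH //.
  by rewrite /keep_old feasible_keep_old // geq_minl.
have B u v : u != v -> F w u -> F w v -> new_p u v <= series_p u v /\ series_p u v <= t.+1.
  move=> uv wu wv; rewrite /new_p /nbr_pair uv (FH _ _ wu) (FH _ _ wv) /=; split.
    case: ifP => // Huv; rewrite /use_series feasible_series //; exact: geq_minr.
  by have := use _ _ wu; have := use _ _ wv; rewrite /series_p; lia.
have proj x y k : walk F p x y k -> x != w -> y != w ->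
    exists2 l, l <= k & walk (eliminate F w) new_p x y l.
  apply: eliminate_walk => //; last exact: Firr.
  move=> u v uv wu wv; have [/leq_trans H1 _] := B u v uv wu wv; apply: H1.
  by rewrite /series_p (ps u w) geq_minl.
split=> /=.
- split; first exact: eliminate_sym.
  move=> x y /and3P[xw yw /orP[xy|/and3P[nxy wx wy]]]; rewrite /eliminate /= xw yw /=.
    by rewrite FH.
  by rewrite nxy (FH _ _ wx) (FH _ _ wy) orbT.
- move=> x y /andP[xw Lx] /andP[yw Ly]; have [k wk] := Fc x y Lx Ly.
  by have [l _ wl] := proj _ _ _ wk xw yw; exists l.
- by apply: eliminate_bridges => //; [exact: Firr|exact: Fdeg].
- move=> x y /and3P[xw yw /orP[xy|/and3P[nxy wx wy]]].
    exact: leq_trans (A _ _ xy xw yw) (use _ _ xy).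
  by have [H1 H2] := B x y nxy wx wy; exact: leq_trans H1 H2.
move=> x y /and3P[xw yw Hxy]; rewrite /eliminate /= xw yw /= negb_or => /andP[nF nFF].
have [pxy|npxy] := boolP (nbr_pair x y); last first.
  have {}Hxy : H x y by case/orP: Hxy => // pxy; rewrite /nbr_pair pxy in npxy.
  have [k wk kt] := cons x y Hxy nF; have [l lk wl] := proj _ _ _ wk xw yw.
  exists l => //; rewrite /new_q (negbTE npxy).
  exact: leq_trans (leq_add lk (leqnn _)) kt.
(* [F] contains exactly one of the edges [wx] and [wy]: one because it spans, and not both because
   [eliminate F w] lacks [xy]. By symmetry one case suffices. *)
suff S x' y' : nbr_pair x' y' -> F w x' -> ~~ F w y' -> ~~ F x' y' ->
    exists2 k, walk (eliminate F w) new_p x' y' k & k + new_q x' y' <= t.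
  have [z wz] : exists z, F w z.
    apply: (@feasible_edge_at x); last by rewrite eq_sym.
    by have /and3P[_ wx _] := pxy; apply: (HL x w); rewrite Hs.
  have /and3P[nxy _ _] := pxy.
  have [zE|zE] := nbr_pair_third pxy (FH _ _ wz); subst z.
    by apply: S => //; move: nFF; rewrite nxy wz.
  have sym : symmetric (eliminate F w) by exact: eliminate_sym.
  have [k wk kt] : exists2 k, walk (eliminate F w) new_p y x k & k + new_q y x <= t.
    apply: S => //; [by rewrite nbr_pairC|by move: nFF; rewrite nxy wz andbT|].
    by rewrite Fs.
  exists k; last by rewrite new_qC.
  elim: wk {kt} => [u|u v z l uv _ wl]; first exact: walk_nil.
  by rewrite sym in uv; rewrite addnC; apply: walk_cat wl _; rewrite new_pC; exact: walk1.
move=> {nFF Hxy}px wx wy nFx; have [xw' yw'] := nbr_pair_neq px.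
have [k wk kt] := feasible_detour px wx wy.
have [l lk wl] := proj _ _ _ wk xw' yw'.
rewrite /new_q px.
have [Hxy|nHxy] := boolP (H x' y'); last first.
  rewrite (q0 x' y') // ?max0n; last 2 first.
  - by have /and3P[_ h _] := px; apply: (HL x' w); rewrite Hs.
  - by have /and3P[_ _ h] := px; apply: (HL y' w); rewrite Hs.
  by exists l => //; exact: leq_trans (leq_add lk (leqnn _)) kt.
(* Two walks join the ends, one from the detour of the edge at [w] and one from that of the old
   edge. The shorter one serves both, which matches the maximum in [new_q]. *)
have [k2 wk2 kt2] := cons x' y' Hxy nFx.
have [l2 lk2 wl2] := proj _ _ _ wk2 xw' yw'.
have [ll|/ltnW ll] := leqP l l2; [exists l|exists l2] => //; rewrite addn_maxr geq_max.
  rewrite (leq_trans _ kt2) ?leq_add2r ?(leq_trans ll) //=.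
  by rewrite (leq_trans _ kt) ?leq_add2r.
rewrite (leq_trans _ kt2) ?leq_add2r //=.
by rewrite (leq_trans _ kt) ?leq_add2r ?(leq_trans ll).
Qed.

End Forward.

(** * Feasible trees lift back over an elimination *)

Section Backward.
Variable F' : rel V.
Hypothesis Ff' : feasible eliminate_vertex F'.

Lemma walk_rev F x y k : symmetric F -> walk F p x y k -> walk F p y x k.
Proof.
have [_ _ [ps _] _ _] := gok => Fs; elim=> [u|u v z l uv _ wl]; first exact: walk_nil.
by rewrite addnC ps; apply: walk_cat wl _; apply: walk1; rewrite Fs.
Qed.

Lemma eliminated_notin x y : F' x y -> x != w /\ y != w.
Proof. by have [[_ FH] _ _ _ _] := Ff' => /FH/and3P[]. Qed.

Lemma eliminated_adj x y : F' x y -> ~~ nbr_pair x y -> H x y.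
Proof.
have [[_ FH] _ _ _ _] := Ff' => /FH/and3P[_ _ /orP[//|pxy]].
by rewrite /nbr_pair pxy.
Qed.

Lemma new_p_old x y : ~~ nbr_pair x y -> new_p x y = p x y.
Proof. by rewrite /new_p => /negbTE ->. Qed.

Lemma nbr_pair_eq a b x y : nbr_pair a b -> nbr_pair x y ->
  (x = a /\ y = b) \/ (x = b /\ y = a).
Proof.
move=> pab /and3P[xy wx wy].
have [xE|xE] := nbr_pair_third pab wx; have [yE|yE] := nbr_pair_third pab wy; subst x y;
  rewrite ?eqxx // in xy *; by [left|right].
Qed.

Lemma extend_spans F a : (forall u v, F' u v -> exists l, walk F p u v l) ->
  symmetric F -> F w a -> live g a -> a != w -> spans (live g) F p.
Proof.
move=> FF Fs wa La aw; have [_ Fc _ _ _] := Ff'.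
have S x : live g x -> exists k, walk F p a x k.
  move=> Lx; have [->|xw] := eqVneq x w; first by exists (p a w); apply: walk1; rewrite Fs.
  have [||k wk] := Fc a x; rewrite /= ?aw ?xw //.
  exact: (walk_connect wk FF).
move=> x y /S[k wk] /S[l wl]; exists (k + l); apply: walk_cat wl; exact: walk_rev wk.
Qed.

(** The live graph is connected, so a live vertex without neighbours is the only one. *)
Lemma isolated_feasible : (forall x, ~~ H w x) -> feasible g F'.
Proof.
move=> nH; have [[Fs FH] _ br _ _] := Ff'; have [[Hs Hi] HL _ _ Hc] := gok.
have only x : live g x -> x = w.
  move=> Lx; apply/eqP/negPn/negP; rewrite eq_sym => nx.
  have [k wk] := Hc w x Lw Lx; have [z [l [wz _ _]]] := walk_inv wk nx.
  by rewrite (negbTE (nH z)) in wz.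
have noH x y : H x y = false.
  by apply/negP => /[dup] /HL/only ->; apply/negP/nH.
have noF x y : F' x y = false.
  by apply/negP => /FH/and3P[_ _]; rewrite noH (negbTE (nH x)) andbF.
split=> //.
- by split=> // x y; rewrite noF.
- by move=> x y /only-> /only->; exists 0; exact: walk_nil.
- by move=> x y; rewrite noF.
- by move=> x y; rewrite noH.
Qed.

(** Shared by the two cases in which [w] becomes a leaf: a single neighbour, where the last
    hypothesis is vacuous, and two neighbours with [wb] left to a detour. *)
Lemma leaf_feasible a : H w a -> p w a <= t.+1 ->
  (forall x y, F' x y -> H x y) ->
  (forall x y, F' x y -> nbr_pair x y -> new_p x y <= t.+1 -> new_p x y = p x y) ->
  (forall b, H w b -> b != a -> exists2 k, walk (add_edge F' w a) p w b k & k + q w b <= t) ->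
  feasible g (add_edge F' w a).
Proof.
move=> wa pwa FsubH oldp detour.
have [[Fs FH] Fc br use cons] := Ff'; have [[Hs Hi] HL [ps qs] q0 Hc] := gok.
have aw : a != w by rewrite eq_sym wadj_neq.
have Lu u : H w u -> live g u by move=> wu; apply: (HL u w); rewrite Hs.
have newp x y : F' x y -> new_p x y = p x y.
  move=> Fxy; have [pxy|/new_p_old//] := boolP (nbr_pair x y).
  exact: oldp (use _ _ Fxy).
have As := add_edge_sym w a Fs.
have sub x y : F' x y -> add_edge F' w a x y by rewrite /add_edge /= => ->.
have lift x y k : walk F' new_p x y k -> exists2 l, l <= k & walk (add_edge F' w a) p x y l.
  move=> wk; apply: (walk_map wk (leqnn k)) => u v uv _.
  by exists (p u v); [rewrite newp|apply/walk1/sub].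
split.
- split=> // x y /or3P[/FsubH//|/andP[/eqP-> /eqP->]//|/andP[/eqP-> /eqP->]].
  by rewrite Hs.
- apply: (@extend_spans _ a) => //; last exact: Lu; last by rewrite /add_edge /= !eqxx orbT.
  by move=> u v uv; exists (p u v); apply/walk1/sub.
- by apply: add_leaf_bridges => // x y; exact: eliminated_notin.
- move=> x y /or3P[Fxy|/andP[/eqP-> /eqP->]//|/andP[/eqP-> /eqP->]].
    by rewrite -newp //; exact: use.
  by rewrite ps.
move=> x y Hxy; rewrite /add_edge /= !negb_or => /and3P[nF n1 n2].
have [xE|xw] := eqVneq x w.
  by subst x; apply: detour => //; apply: contra n1 => /eqP->; rewrite !eqxx.
have [yE|yw] := eqVneq y w.
  subst y; have [||k wk kt] := detour x; rewrite 1?Hs //.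
    by apply: contra n2 => /eqP->; rewrite !eqxx.
  by exists k; [exact: walk_rev|rewrite qs].
have [||k wk kt] := cons x y; rewrite //= /eliminate /= ?xw ?yw ?Hxy //.
have [l lk wl] := lift _ _ _ wk; exists l => //.
apply: leq_trans kt; apply: leq_add => //=.
by rewrite /new_q; case: ifP => // _; exact: leq_maxl.
Qed.

Lemma pendant_feasible a : H w a -> p w a <= t.+1 -> (forall z, H w z -> z = a) ->
  feasible g (add_edge F' w a).
Proof.
move=> wa pwa only.
have nopair x y : nbr_pair x y = false.
  by apply/negP => /and3P[xy /only xa /only ya]; rewrite xa ya eqxx in xy.
apply: leaf_feasible => //.
- by move=> x y /eliminated_adj; rewrite nopair; apply.
- by move=> x y _; rewrite nopair.
- by move=> b /only->; rewrite eqxx.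
Qed.

(** [w] hangs at [a], the end that attains the minimum in [series_q]. The tree already joins [a] to
    [b] closely enough, by the kept edge or by a detour, and prefixing [wa] gives the detour for
    [wb]. *)
Lemma detour_feasible a b : nbr_pair a b ->
  p w a + q w b <= p w b + q w a ->
  (F' a b -> H a b /\ keep_old a b <= use_series a b) ->
  feasible g (add_edge F' w a).
Proof.
move=> pab le ch; have /and3P[nab wa wb] := pab; have [aw bw] := nbr_pair_neq pab.
have [[Fs FH] Fc br use cons] := Ff'; have [[Hs Hi] HL [ps qs] q0 Hc] := gok.
have As := add_edge_sym w a Fs.
have sub x y : F' x y -> add_edge F' w a x y by rewrite /add_edge /= => ->.
have keep : F' a b -> new_p a b = p a b /\ p a b + series_q a b <= t.
  move=> Fab; have [Hab ku] := ch Fab; have := use _ _ Fab.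
  rewrite /= /new_p pab Hab (minn_idPl ku) /keep_old.
  by case: ifP => //; rewrite ltnn.
have oldp x y : F' x y -> new_p x y = p x y.
  move=> Fxy; have [pxy|/new_p_old//] := boolP (nbr_pair x y).
  have [[xE yE]|[xE yE]] := nbr_pair_eq pab pxy; subst x y; first by case: (keep Fxy).
  by rewrite new_pC ps; rewrite Fs in Fxy; case: (keep Fxy).
have [l wl lt] : exists2 l, walk (add_edge F' w a) p a b l & l + series_q a b <= t.
  have [Fab|nFab] := boolP (F' a b).
    by exists (p a b); [apply/walk1/sub|case: (keep Fab)].
  have Hab' : eliminate H w a b.
    by rewrite /eliminate /= aw bw nab wa wb orbT.
  have [k wk kt] := cons a b Hab' nFab.
  have [l lk wl] : exists2 l, l <= k & walk (add_edge F' w a) p a b l.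
    apply: (walk_map wk (leqnn k)) => u v uv _.
    by exists (p u v); [rewrite /= oldp|apply/walk1/sub].
  exists l => //; apply: leq_trans kt; apply: leq_add => //=.
  by rewrite /new_q pab leq_maxr.
(* The bound on [l] rules out the cap [t.+1], so [series_q] is its first option. *)
have sq : series_q a b = p w a + q w b.
  move: lt; rewrite /series_q (minn_idPl le); case: (leqP t.+1 (p w a + q w b)) => // _.
  by rewrite addnC ltnNge leq_addr.
rewrite sq in lt.
apply: leaf_feasible => //.
- by apply: leqW; apply: leq_trans lt; rewrite addnC -addnA leq_addr.
- move=> x y Fxy; have [pxy|npxy] := boolP (nbr_pair x y); last exact: eliminated_adj.
  have [[xE yE]|[xE yE]] := nbr_pair_eq pab pxy; subst x y; first by case: (ch Fxy).
  by rewrite Hs; rewrite Fs in Fxy; case: (ch Fxy).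
- by move=> x y Fxy _ _; exact: oldp.
move=> c wc ca; have [cE|cE] := nbr_pair_third pab wc; subst c; first by rewrite eqxx in ca.
exists (p w a + l); first by apply: walk_cons wl; rewrite /add_edge /= !eqxx orbT.
by rewrite addnAC addnC.
Qed.

Lemma series_feasible a b : nbr_pair a b -> F' a b ->
  (H a b -> use_series a b <= keep_old a b) ->
  feasible g (add_edge (add_edge (del_edge F' a b) w a) w b).
Proof.
move=> pab Fab ch; have /and3P[nab wa wb] := pab; have [aw bw] := nbr_pair_neq pab.
have [[Fs FH] Fc br use cons] := Ff'; have [[Hs Hi] HL [ps qs] q0 Hc] := gok.
set F := add_edge _ w b.
have Lu u : H w u -> live g u by move=> wu; apply: (HL u w); rewrite Hs.
have newp : new_p a b = series_p a b /\ (H a b -> series_p a b + q a b <= t).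
  have := use _ _ Fab; rewrite /= /new_p pab; case: ifP => [Hab|//].
  rewrite (minn_idPr (ch Hab)) /use_series; case: ifP => //; by rewrite ltnn.
have [newpE sqt] := newp.
have spt : series_p a b <= t.+1 by rewrite -newpE; exact: use.
have pwa : p w a <= t.+1 by move: spt; clear; rewrite /series_p; lia.
have pwb : p w b <= t.+1 by move: spt; clear; rewrite /series_p; lia.
have spE : series_p a b <= t -> series_p a b = p a w + p w b.
  by rewrite (ps a); clear; rewrite /series_p; lia.
have Fsym : symmetric F by do 2!apply: add_edge_sym; exact: del_edge_sym.
have Fwa : F w a by rewrite /F /add_edge /= !eqxx !orbT.
have Fwb : F w b by rewrite /F /add_edge /= !eqxx !orbT.
have sub x y : F' x y -> ~~ nbr_pair x y -> F x y.
  move=> Fxy npxy; rewrite /F /add_edge /del_edge /= Fxy.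
  have -> : (x == a) && (y == b) = false.
    by apply: contraNF npxy => /andP[/eqP-> /eqP->].
  have -> // : (x == b) && (y == a) = false.
  by apply: contraNF npxy => /andP[/eqP-> /eqP->]; rewrite nbr_pairC.
have awb : walk F p a b (p a w + p w b).
  by apply: walk_cons (walk1 _ Fwb); rewrite Fsym.
(* If [new_p] was capped, the real walk may be longer than the weight. This is harmless: detours
   have length at most [t], and along such walks no cap occurs. *)
have edge x y : F' x y -> exists2 l, walk F p x y l & (new_p x y <= t -> l <= new_p x y).
  move=> Fxy; have [pxy|npxy] := boolP (nbr_pair x y); last first.
    by exists (p x y); [apply/walk1/sub|rewrite new_p_old].
  have [[-> ->]|[-> ->]] := nbr_pair_eq pab pxy.
    by exists (p a w + p w b) => //; rewrite newpE => /spE->.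
  exists (p a w + p w b); first exact: walk_rev.
  by rewrite new_pC newpE => /spE->.
have lift x y k : walk F' new_p x y k -> k <= t -> exists2 l, l <= k & walk F p x y l.
  move=> wk kt; apply: (walk_map wk kt) => u v /edge[l wl ll] puv.
  by exists l => //; exact: ll.
split.
- split=> // x y /or3P[/or3P[/and3P[Fxy n1 n2]||]||]; last first.
  + by case/andP=> /eqP-> /eqP->; rewrite Hs.
  + by case/andP=> /eqP-> /eqP->.
  + by case/andP=> /eqP-> /eqP->; rewrite Hs.
  + by case/andP=> /eqP-> /eqP->.
  apply: eliminated_adj Fxy _; apply/negP => /(nbr_pair_eq pab)[[xE yE]|[xE yE]].
    by rewrite xE yE !eqxx in n1.
  by rewrite xE yE !eqxx in n2.
- apply: (@extend_spans _ a) => //; last exact: Lu.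
  by move=> u v /edge[l wl _]; exists l.
- by apply: subdivide_bridges => // x y; exact: eliminated_notin.
- move=> x y /or3P[/or3P[/and3P[Fxy n1 n2]||]||]; last first.
  + by case/andP=> /eqP-> /eqP->; rewrite ps.
  + by case/andP=> /eqP-> /eqP->.
  + by case/andP=> /eqP-> /eqP->; rewrite ps.
  + by case/andP=> /eqP-> /eqP->.
  rewrite -new_p_old; first exact: use.
  apply/negP => /(nbr_pair_eq pab)[[xE yE]|[xE yE]].
    by rewrite xE yE !eqxx in n1.
  by rewrite xE yE !eqxx in n2.
move=> x y Hxy nF.
have [pxy|npxy] := boolP (nbr_pair x y).
  have E := nbr_pair_eq pab pxy.
  have Hab : H a b by case: E Hxy => -[-> ->] //; rewrite Hs.
  have st := sqt Hab; have sE : series_p a b = p a w + p w b.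
    by apply: spE; exact: leq_trans (leq_addr _ _) st.
  case: E => -[-> ->]; exists (p a w + p w b) => //; rewrite -?sE //.
    by rewrite sE; exact: walk_rev.
  by rewrite qs.
have xw : x != w.
  apply: contraNneq nF => xw; rewrite xw in Hxy *.
  by case: (nbr_pair_third pab Hxy) => ->.
have yw : y != w.
  apply: contraNneq nF => yw; rewrite yw Hs in Hxy; rewrite Fsym yw.
  by case: (nbr_pair_third pab Hxy) => ->.
have nF' : ~~ F' x y by apply: contra nF => Fxy; exact: sub.
have Hxy' : eliminate H w x y by rewrite /eliminate /= xw yw Hxy.
have [k wk kt] := cons x y Hxy' nF'.
have kt' : k <= t by exact: leq_trans (leq_addr _ _) kt.
have [l lk wl] := lift _ _ _ wk kt'; exists l => //.
by move: kt; rewrite /= /new_q (negbTE npxy); apply: leq_trans; rewrite leq_add2r.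
Qed.

End Backward.
End Step.
End Feasible.

(** * Tree spanners as feasible trees for unit weights *)

Section Spanners.
Variables (n : nat) (G : graph n).
Local Notation V := 'I_n.
Local Notation unit_weight := (fun _ _ : V => 1).

Definition unit_wgraph : wgraph V :=
  WGraph predT G unit_weight (fun _ _ => 0).

Lemma path_walk (F : rel V) x s : path F x s -> walk F unit_weight x (last x s) (size s).
Proof.
elim: s x => [|y s IH] x /=; first by move=> _; exact: walk_nil.
by case/andP=> xy /IH; exact: (walk_cons (p := unit_weight)).
Qed.

Lemma walk_path (F : rel V) x y k : walk F unit_weight x y k ->
  exists s, [/\ path F x s, last x s = y & size s = k].
Proof.
elim=> [u|u v z l uv _ [s [ps ls ss]]]; first by exists [::].
by exists (v :: s); rewrite /= uv ps ss.
Qed.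

Lemma dist_le (H : graph n) u s : path H u s -> dist H u (last u s) <= size s.
Proof.
move=> /shortenP[s' ps' us' sub].
apply: (@leq_trans (size s')); last by apply: uniq_leq_size => //; case/andP: us'.
have sn : size s' < n.
  by have /card_uniqP E := us'; have := max_card (ssrbool.mem (u :: s')); rewrite E card_ord.
have hp : has_path H u (last u s') (size s').
  by apply/existsP; exists (in_tuple s'); rewrite ps' eqxx.
rewrite leqNgt; apply/negP => /(before_find 0).
by rewrite nth_iota // add0n hp.
Qed.

Lemma dist_path (H : graph n) u v : connect H u v ->
  exists s, [/\ path H u s, last u s = v & size s = dist H u v].
Proof.
move=> /connectP[s0 /shortenP[s ps us _] ->].
have sn : size s < n.
  by have /card_uniqP E := us; have := max_card (ssrbool.mem (u :: s)); rewrite E card_ord.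
have hp : has_path H u (last u s) (size s).
  by apply/existsP; exists (in_tuple s); rewrite ps eqxx.
have hs : has (has_path H u (last u s)) (iota 0 n).
  by apply/hasP; exists (size s); rewrite // mem_iota.
have dn : dist H u (last u s) < n by rewrite -[X in _ < X](size_iota 0) -has_find.
have := nth_find 0 hs; rewrite -/(dist H u (last u s)) nth_iota // add0n.
case/existsP=> r /and3P[pr /eqP lr _]; exists (val r); split=> //.
by rewrite size_tuple.
Qed.

Lemma unit_wgraph_ok : graph_connected G -> wgraph_ok unit_wgraph.
Proof.
move=> [_ Gc]; split=> //=; first by split; [exact: adj_sym|exact: adj_irr].
by move=> x y _ _; have /connectP[s ps ->] := Gc x y; exists (size s); exact: path_walk.
Qed.

(** The first edge of a cycle leaves its cut, and the cycle could return to the side of [x] only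
    along that same edge. *)
Lemma bridges_acyclic (T : graph n) : bridges T -> acyclic T.
Proof.
move=> br c sz us; apply/negP => cyc.
case: c sz us cyc => [|x [|y s]] // sz /= /and3P[xN yN us] /andP[xy ps].
have [S [Sx Sy SE]] := br x y xy.
have xs : x \notin s by apply: contra xN => xs; rewrite inE xs orbT.
have [] : ~~ S (last y s) /\ T (last y s) x.
  have SE' u v : T u v -> S u -> ~~ S v -> x = u by move=> uv Su Sv; case: (SE u v).
  elim: s y Sy ps xs {sz xN yN us xy SE} => [|z s IH] y Sy /=; first by rewrite andbT.
  case/andP=> yz ps; rewrite inE negb_or => /andP[xz xs].
  apply: IH => //; apply/negP => Sz; rewrite adj_sym in yz.
  by rewrite (SE' _ _ yz Sz Sy) eqxx in xz.
move=> Sl lx; rewrite adj_sym in lx; have [_ ly] := SE _ _ lx Sx Sl.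
by case: s sz ps us yN ly {xN xs Sl lx} => //= z s _ _ _ /[swap] <-; rewrite mem_last.
Qed.

(** The side of the cut is what [u] reaches without the edge [uv]; a path to [v] inside it would
    close to a cycle. *)
Lemma acyclic_bridges (T : graph n) : acyclic T -> bridges T.
Proof.
move=> ac u v uv; exists (connect (del_edge T u v) u).
have nv : ~~ connect (del_edge T u v) u v.
  apply/negP => /connectP[s0 /shortenP[s ps us _] vE].
  have pT : path T u s by apply: sub_path ps => x y /and3P[].
  have s2 : 2 < size (u :: s).
    case: s ps vE {us pT} => [_ /= vE|y [|z s]] //=.
      by rewrite vE adj_irr in uv.
    by rewrite andbT => /and3P[_ n1 _] vE; rewrite vE !eqxx in n1.
  by have := ac _ s2 us; rewrite /= rcons_path pT -vE adj_sym uv.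
split=> //.
move=> x y xy ux uy.
have [/andP[/eqP xu /eqP yv]//|n1] := boolP ((x == u) && (y == v)).
have [/andP[/eqP xv /eqP yu]|n2] := boolP ((x == v) && (y == u)).
  by rewrite xv (negbTE nv) in ux.
case/negP: uy; apply: connect_trans ux (connect1 _).
by rewrite /del_edge /= xy n1 n2.
Qed.

Variable t : nat.
Hypotheses (t_gt0 : 0 < t) (Gconn : graph_connected G).

Lemma tree_spanner_feasible (T : graph n) : tree_spanner t G T -> feasible t unit_wgraph T.
Proof.
move=> [[TG [n0 Tc] ac] sp]; split=> //=.
- by split=> //; exact: adj_sym.
- by move=> x y _ _; have /connectP[s ps ->] := Tc x y; exists (size s); exact: path_walk.
- exact: acyclic_bridges.
move=> u v uv _; have [s [ps ls ss]] := dist_path (Tc u v).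
exists (size s); first by rewrite -ls; exact: path_walk.
rewrite addn0 ss (leq_trans (sp u v)) // -[X in _ <= X]muln1 leq_mul2l.
by apply/orP; right; apply: (@dist_le _ u [:: v]); rewrite /= uv.
Qed.

(** A stretch bound on the edges of [G] is enough: along a shortest path each edge is replaced by a
    tree walk of length at most [t]. *)
Lemma feasible_tree_spanner (F : rel V) : feasible t unit_wgraph F ->
  exists2 T : graph n, tree_spanner t G T & adj T =2 F.
Proof.
move=> [[Fs FG] Fc br _ cons].
have Fi : irreflexive F by move=> x; apply/negP => /FG /=; rewrite adj_irr.
pose T := Graph Fs Fi; exists T => //; have [n0 Gc] := Gconn.
split; first split=> //.
- split=> // u v; have [k wk] := Fc u v isT isT.
  by have [s [ps ls _]] := walk_path wk; apply/connectP; exists s.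
- exact: bridges_acyclic.
move=> u v; have [s [ps ls <-]] := dist_path (Gc u v).
suff [l lk wl] : exists2 l, l <= t * size s & walk F unit_weight u v l.
  have [r [pr lr sr]] := walk_path wl; rewrite -lr (leq_trans _ lk) // -sr.
  exact: (@dist_le T).
elim: s u ps ls => [|x s IH] u /=; first by move=> _ ->; exists 0 => //; exact: walk_nil.
case/andP=> ux ps ls; have [l lk wl] := IH x ps ls.
have [l2 l2t wl2] : exists2 l, l <= t & walk F unit_weight u x l.
  have [Fux|nF] := boolP (F u x); first by exists 1; rewrite //; exact: (@walk1 _ _ unit_weight).
  by have [k wk kt] := cons u x ux nF; exists k => //; move: kt; rewrite addn0.
by exists (l2 + l); [rewrite mulnS leq_add|exact: walk_cat wl2 wl].
Qed.

End Spanners.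

(** * A structured language for the random access machine *)

(* Array 0 holds the variables; [EArr a e] is the entry of array [a] at [e]. *)
Inductive expr :=
  | ECst of nat
  | EVar of nat
  | EAdd of expr & expr
  | ESub of expr & expr
  | EArr of nat & expr.

Inductive com :=
  | CSkip
  | CSet of nat & expr
  | CStore of nat & expr & expr
  | CRead of nat
  | CPrint of expr
  | CSeq of com & com
  | CIf of expr & com & com
  | CWhile of expr & com.

Definition store := nat -> nat -> nat.

Record hconf := HConf { sto : store; hinp : seq nat; hout : seq nat }.

Definition upd (s : store) a i v : store :=
  fun b j => if (b == a) && (j == i) then v else s b j.

Definition hset (h : hconf) a i v := HConf (upd (sto h) a i v) (hinp h) (hout h).

Fixpoint eval (s : store) e : nat :=
  match e with
  | ECst c => c
  | EVar x => s 0 x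
  | EAdd e1 e2 => eval s e1 + eval s e2
  | ESub e1 e2 => eval s e1 - eval s e2
  | EArr a e => s a (eval s e)
  end.

Section Semantics.
Variable M : nat.

(** Only constants and sums can exceed the bound; differences and array entries are bounded by
    values that are already there. *)
Fixpoint fits (s : store) e : Prop :=
  match e with
  | ECst c => c <= M
  | EVar x => True
  | EAdd e1 e2 => [/\ fits s e1, fits s e2 & eval s e1 + eval s e2 <= M]
  | ESub e1 e2 => fits s e1 /\ fits s e2
  | EArr a e => fits s e
  end.

Fixpoint esize e : nat :=
  match e with
  | ECst c => 1
  | EVar x => 2
  | EAdd e1 e2 | ESub e1 e2 => esize e1 + esize e2 + 1
  | EArr a e => esize e + 7
  end.

Inductive exec : com -> hconf -> nat -> hconf -> Prop :=
  | exec_skip h : exec CSkip h 0 h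
  | exec_set x e h : fits (sto h) e ->
      exec (CSet x e) h (esize e + 2) (hset h 0 x (eval (sto h) e))
  | exec_store a e1 e2 h : fits (sto h) e1 -> fits (sto h) e2 ->
      exec (CStore a e1 e2) h (esize e1 + esize e2 + 7)
        (hset h a (eval (sto h) e1) (eval (sto h) e2))
  | exec_read x s i o : head 0 i <= M ->
      exec (CRead x) (HConf s i o) 1 (HConf (upd s 0 x (head 0 i)) (behead i) o)
  | exec_print e s i o : fits s e ->
      exec (CPrint e) (HConf s i o) (esize e + 1) (HConf s i (rcons o (eval s e)))
  | exec_seq c1 c2 h1 h2 h3 k1 k2 : exec c1 h1 k1 h2 -> exec c2 h2 k2 h3 ->
      exec (CSeq c1 c2) h1 (k1 + k2) h3
  | exec_if_true e c1 c2 h h' k : fits (sto h) e -> 0 < eval (sto h) e ->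
      exec c1 h k h' -> exec (CIf e c1 c2) h (esize e + 1 + k) h'
  | exec_if_false e c1 c2 h h' k : fits (sto h) e -> eval (sto h) e = 0 ->
      exec c2 h k h' -> exec (CIf e c1 c2) h (esize e + 1 + k + 2) h'
  | exec_while_false e c h : fits (sto h) e -> eval (sto h) e = 0 ->
      exec (CWhile e c) h (esize e + 3) h
  | exec_while_true e c h1 h2 h3 k1 k2 : fits (sto h1) e -> 0 < eval (sto h1) e ->
      exec c h1 k1 h2 -> exec (CWhile e c) h2 k2 h3 ->
      exec (CWhile e c) h1 (esize e + 1 + k1 + 2 + k2) h3.

(** Weakest precondition of loop-free code; a loop gets [False] and is left to [runs_to_loop].
    Values enter through equations, so that they can be rewritten before they are put into the
    store. *)
Fixpoint wpc (c : com) (Q : hconf -> Prop) (h : hconf) : Prop :=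
  match c with
  | CSkip => Q h
  | CSet x e => fits (sto h) e /\ forall v, v = eval (sto h) e -> Q (hset h 0 x v)
  | CStore a e1 e2 => [/\ fits (sto h) e1, fits (sto h) e2 &
      forall i v, i = eval (sto h) e1 -> v = eval (sto h) e2 -> Q (hset h a i v)]
  | CRead x => head 0 (hinp h) <= M /\
      Q (HConf (upd (sto h) 0 x (head 0 (hinp h))) (behead (hinp h)) (hout h))
  | CPrint e => fits (sto h) e /\
      Q (HConf (sto h) (hinp h) (rcons (hout h) (eval (sto h) e)))
  | CSeq c1 c2 => wpc c1 (wpc c2 Q) h
  | CIf e c1 c2 => [/\ fits (sto h) e, 0 < eval (sto h) e -> wpc c1 Q h &
      eval (sto h) e = 0 -> wpc c2 Q h]
  | CWhile _ _ => False
  end.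

(* An upper bound for the running time of loop-free code. *)
Fixpoint ccost (c : com) : nat :=
  match c with
  | CSkip => 0
  | CSet x e => esize e + 2
  | CStore a e1 e2 => esize e1 + esize e2 + 7
  | CRead x => 1
  | CPrint e => esize e + 1
  | CSeq c1 c2 => ccost c1 + ccost c2
  | CIf e c1 c2 => esize e + 3 + ccost c1 + ccost c2
  | CWhile _ _ => 0
  end.

Definition runs_to (c : com) (K : nat) (Q : hconf -> Prop) (h : hconf) : Prop :=
  exists h' k, [/\ exec c h k h', k <= K & Q h'].

Lemma wpc_mono c (Q Q' : hconf -> Prop) h : (forall h', Q h' -> Q' h') ->
  wpc c Q h -> wpc c Q' h.
Proof.
elim: c Q Q' h => [|x e|a e1 e2|x|e|c1 IH1 c2 IH2|e c1 IH1 c2 IH2|e c IH] Q Q' h QQ //=.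
- exact: QQ.
- by case=> f H; split=> // v /H; exact: QQ.
- by case=> f1 f2 H; split=> // i v iE vE; exact/QQ/H.
- by case=> f H; split=> //; exact: QQ.
- by case=> f H; split=> //; exact: QQ.
- by apply: IH1 => h'; exact: IH2.
- by case=> f H1 H2; split=> // [/H1|/H2]; [exact: IH1|exact: IH2].
Qed.

Lemma wpc_sound c Q h : wpc c Q h -> runs_to c (ccost c) Q h.
Proof.
elim: c Q h => [|x e|a e1 e2|x|e|c1 IH1 c2 IH2|e c1 IH1 c2 IH2|e c IH] Q h //=.
- by move=> Qh; exists h, 0; split=> //; exact: exec_skip.
- by case=> f H; eexists _, _; split; [exact: exec_set| |exact: H].
- by case=> f1 f2 H; eexists _, _; split; [exact: exec_store| |exact: H].
- by case: h => s i o /= [f H]; eexists _, _; split; [exact: exec_read| |].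
- by case: h => s i o /= [f H]; eexists _, _; split; [exact: exec_print| |].
- move=> /IH1[h1 [k1 [e1 k1c /IH2[h2 [k2 [e2 k2c Qh]]]]]].
  by exists h2, (k1 + k2); split=> //; [exact: exec_seq e1 e2|exact: leq_add].
- case=> f H1 H2; case: (posnP (eval (sto h) e)) => [e0|e0].
    have [h' [k [ex kc Qh]]] := IH2 _ _ (H2 e0); exists h', (esize e + 1 + k + 2).
    by split=> //; [exact: exec_if_false|lia].
  have [h' [k [ex kc Qh]]] := IH1 _ _ (H1 e0); exists h', (esize e + 1 + k).
  by split=> //; [exact: exec_if_true|lia].
Qed.

Lemma runs_to_seq c1 c2 K1 K2 Q1 Q2 h : runs_to c1 K1 Q1 h ->
  (forall h', Q1 h' -> runs_to c2 K2 Q2 h') -> runs_to (CSeq c1 c2) (K1 + K2) Q2 h.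
Proof.
move=> [h1 [k1 [e1 k1c Q1h]]] /(_ _ Q1h)[h2 [k2 [e2 k2c Q2h]]].
by exists h2, (k1 + k2); split=> //; [exact: exec_seq e1 e2|exact: leq_add].
Qed.

(** [N.+1] rather than [N] pays for the last, failing test. *)
Lemma runs_to_loop (I : nat -> hconf -> Prop) N e c h :
  (forall i h, i < N -> I i h ->
     [/\ fits (sto h) e, 0 < eval (sto h) e & wpc c (I i.+1) h]) ->
  (forall h, I N h -> fits (sto h) e /\ eval (sto h) e = 0) ->
  I 0 h -> runs_to (CWhile e c) (N.+1 * (esize e + ccost c + 3)) (I N) h.
Proof.
move=> body stop.
suff S d i h' : i + d = N -> I i h' ->
    runs_to (CWhile e c) (d.+1 * (esize e + ccost c + 3)) (I N) h'.
  by move=> I0; exact: (S N 0).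
elim: d i h' => [|d IH] i h' iN Ii.
  rewrite addn0 in iN; subst i; have [f e0] := stop h' Ii.
  by exists h', (esize e + 3); split=> //; [exact: exec_while_false|lia].
have [|f e0 /wpc_sound[h1 [k1 [e1 k1c I1]]]] := body i h' _ Ii; first lia.
have [|h2 [k2 [e2 k2c I2]]] := IH i.+1 h1 _ I1; first lia.
exists h2, (esize e + 1 + k1 + 2 + k2); split=> //; first exact: exec_while_true e1 e2.
by rewrite mulSn; lia.
Qed.

End Semantics.

(** * Compilation to machine code *)

Definition vcell x := 16 * x.
(** Memory is interleaved by residues modulo 16: 0 for variables, 1 for temporaries, 2 to 15 for
    arrays. Each of them is unbounded, and an array cell is addressed by four doublings and one
    addition. *)
Definition tcell d := 16 * d + 1.

Definition address d a : seq instr :=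
  [:: Add (tcell d) (tcell d) (tcell d); Add (tcell d) (tcell d) (tcell d);
      Add (tcell d) (tcell d) (tcell d); Add (tcell d) (tcell d) (tcell d);
      Const (tcell d.+1) a; Add (tcell d) (tcell d) (tcell d.+1)].

(** The value ends up in temporary [d], and only temporaries from [d] on are overwritten, so a left
    operand survives the evaluation of the right one. *)
Fixpoint ecode d e : seq instr :=
  match e with
  | ECst c => [:: Const (tcell d) c]
  | EVar x => [:: Const (tcell d) 0; Add (tcell d) (vcell x) (tcell d)]
  | EAdd e1 e2 => ecode d e1 ++ ecode d.+1 e2 ++
                    [:: Add (tcell d) (tcell d) (tcell d.+1)]
  | ESub e1 e2 => ecode d e1 ++ ecode d.+1 e2 ++
                    [:: Sub (tcell d) (tcell d) (tcell d.+1)]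
  | EArr a e => ecode d e ++ address d a ++ [:: LoadInd (tcell d) (tcell d)]
  end.

Lemma size_ecode d e : size (ecode d e) = esize e.
Proof.
elim: e d => //= [e1 IH1 e2 IH2|e1 IH1 e2 IH2|a e IH] d;
by rewrite !size_cat ?IH1 ?IH2 ?IH //= addnA.
Qed.

Fixpoint csize (c : com) : nat :=
  match c with
  | CSkip => 0
  | CSet x e => esize e + 2
  | CStore a e1 e2 => esize e1 + (6 + (esize e2 + 1))
  | CRead x => 1
  | CPrint e => esize e + 1
  | CSeq c1 c2 => csize c1 + csize c2
  | CIf e c1 c2 => esize e + (1 + (csize c2 + (2 + csize c1)))
  | CWhile e c => esize e + (3 + (csize c + 2))
  end.

(** Jump targets are absolute, hence the position [l] of the code. An unconditional jump is obtained
    by first setting a temporary to 1. *)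
Fixpoint code l (c : com) : seq instr :=
  match c with
  | CSkip => [::]
  | CSet x e => ecode 0 e ++ [:: Const (tcell 1) 0; Add (vcell x) (tcell 0) (tcell 1)]
  | CStore a e1 e2 => ecode 0 e1 ++ address 0 a ++ ecode 1 e2 ++
                        [:: StoreInd (tcell 0) (tcell 1)]
  | CRead x => [:: Read (vcell x)]
  | CPrint e => ecode 0 e ++ [:: Print (tcell 0)]
  | CSeq c1 c2 => code l c1 ++ code (l + csize c1) c2
  | CIf e c1 c2 =>
      let l2 := l + esize e + 1 in
      let l1 := l2 + csize c2 + 2 in
      ecode 0 e ++ [:: Jump l1 (tcell 0)] ++ code l2 c2 ++
        [:: Const (tcell 0) 1; Jump (l1 + csize c1) (tcell 0)] ++ code l1 c1
  | CWhile e c =>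
      let l1 := l + esize e + 3 in
      ecode 0 e ++ [:: Jump l1 (tcell 0); Const (tcell 0) 1;
                       Jump (l1 + csize c + 2) (tcell 0)] ++
        code l1 c ++ [:: Const (tcell 0) 1; Jump l (tcell 0)]
  end.

Lemma size_code l c : size (code l c) = csize c.
Proof.
by elim: c l => //= [x e|a e1 e2|e|c1 IH1 c2 IH2|e c1 IH1 c2 IH2|e c IH] l;
  rewrite ?size_cat /= ?size_cat /= ?size_ecode ?IH1 ?IH2 ?IH ?size_cat /= ?size_ecode ?IH.
Qed.

(** Residues 0 and 1 belong to variables and temporaries, and an array number from 16 on would run
    into the cells of another array. *)
Fixpoint legal_expr e : bool :=
  match e with
  | ECst _ | EVar _ => true
  | EAdd e1 e2 | ESub e1 e2 => legal_expr e1 && legal_expr e2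
  | EArr a e => (1 < a < 16) && legal_expr e
  end.

Fixpoint legal (c : com) : bool :=
  match c with
  | CSkip | CRead _ => true
  | CSet _ e | CPrint e => legal_expr e
  | CStore a e1 e2 => [&& 1 < a < 16, legal_expr e1 & legal_expr e2]
  | CSeq c1 c2 => legal c1 && legal c2
  | CIf e c1 c2 => [&& legal_expr e, legal c1 & legal c2]
  | CWhile e c => legal_expr e && legal c
  end.

Section Compiler.
Variables (P : program) (B M : nat).
(** Addresses are computed in words as well, and [16 * M + 15] is the largest one for an index up to
    [M]. *)
Hypothesis MB : 16 * M + 15 <= B.

(** [runs] describes complete runs only, so a partial run is expressed by what it adds to every
    complete run that continues it. *)
Definition reach c k c' := forall T o, runs P B c' T o -> runs P B c (k + T) o.

Lemma reach_refl c : reach c 0 c.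
Proof. by move=> T o. Qed.

Lemma reach_trans c1 c2 c3 k l : reach c1 k c2 -> reach c2 l c3 -> reach c1 (k + l) c3.
Proof. by move=> R1 R2 T o /R2/R1; rewrite addnA. Qed.

Lemma reach_step c c' : step P B c = Some c' -> reach c 1 c'.
Proof. by move=> S T o R; exact: runs_step S R. Qed.

Definition code_at l (cs : seq instr) :=
  forall i, i < size cs -> nth Halt P (l + i) = nth Halt cs i.

Lemma code_at_cat l c1 c2 : code_at l (c1 ++ c2) -> code_at l c1 /\ code_at (l + size c1) c2.
Proof.
move=> C; split=> i ic.
  by rewrite C ?nth_cat ?ic // size_cat ltn_addr.
by rewrite -addnA C ?nth_cat ?size_cat ?ltn_add2l // ltnNge leq_addr /= addKn.
Qed.

Lemma code_at_cons l i cs : code_at l (i :: cs) -> nth Halt P l = i /\ code_at l.+1 cs.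
Proof.
move=> C; split; first by have := C 0 isT; rewrite addn0.
by move=> j jc; rewrite addSnnS C.
Qed.

Definition wr (m : nat -> nat) i x := fun j => if j == i then x else m j.

Section Instructions.
Variables (l : nat) (m : nat -> nat) (ip o : seq nat).
Local Notation at_l i := (nth Halt P l = i).

Lemma reach_const i a : at_l (Const i a) -> a <= B ->
  reach (Config l m ip o) 1 (Config l.+1 (wr m i a) ip o).
Proof. by move=> E H; apply: reach_step; rewrite /step /fetch /= E /write /= H. Qed.

Lemma reach_add i j k : at_l (Add i j k) -> m j + m k <= B ->
  reach (Config l m ip o) 1 (Config l.+1 (wr m i (m j + m k)) ip o).
Proof. by move=> E H; apply: reach_step; rewrite /step /fetch /= E /write /= H. Qed.

Lemma reach_sub i j k : at_l (Sub i j k) -> m j - m k <= B ->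
  reach (Config l m ip o) 1 (Config l.+1 (wr m i (m j - m k)) ip o).
Proof. by move=> E H; apply: reach_step; rewrite /step /fetch /= E /write /= H. Qed.

Lemma reach_load i j : at_l (LoadInd i j) -> m (m j) <= B ->
  reach (Config l m ip o) 1 (Config l.+1 (wr m i (m (m j))) ip o).
Proof. by move=> E H; apply: reach_step; rewrite /step /fetch /= E /write /= H. Qed.

Lemma reach_store i j : at_l (StoreInd i j) -> m j <= B ->
  reach (Config l m ip o) 1 (Config l.+1 (wr m (m i) (m j)) ip o).
Proof. by move=> E H; apply: reach_step; rewrite /step /fetch /= E /write /= H. Qed.

Lemma reach_read i : at_l (Read i) -> head 0 ip <= B ->
  reach (Config l m ip o) 1 (Config l.+1 (wr m i (head 0 ip)) (behead ip) o).
Proof. by move=> E H; apply: reach_step; rewrite /step /fetch /= E /write /= H. Qed.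

Lemma reach_print i : at_l (Print i) ->
  reach (Config l m ip o) 1 (Config l.+1 m ip (rcons o (m i))).
Proof. by move=> E; apply: reach_step; rewrite /step /fetch /= E. Qed.

Lemma reach_jump l' i : at_l (Jump l' i) -> 0 < m i ->
  reach (Config l m ip o) 1 (Config l' m ip o).
Proof. by move=> E H; apply: reach_step; rewrite /step /fetch /= E H. Qed.

Lemma reach_nojump l' i : at_l (Jump l' i) -> m i = 0 ->
  reach (Config l m ip o) 1 (Config l.+1 m ip o).
Proof. by move=> E H; apply: reach_step; rewrite /step /fetch /= E H. Qed.
End Instructions.

Definition represents (m : nat -> nat) (s : store) :=
  forall a i, a < 16 -> a != 1 -> m (16 * i + a) = s a i.
Definition bounded_store (s : store) := forall a i, s a i <= M.
Definition same_below d (m m' : nat -> nat) :=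
  forall j, (forall d', d <= d' -> j <> tcell d') -> m' j = m j.

Lemma same_below_trans d m1 m2 m3 :
  same_below d m1 m2 -> same_below d m2 m3 -> same_below d m1 m3.
Proof. by move=> S1 S2 j H; rewrite S2 // S1. Qed.

Lemma same_belowS d m1 m2 : same_below d.+1 m1 m2 -> same_below d m1 m2.
Proof. by move=> S j H; apply: S => d' dd'; apply: H; exact: ltnW. Qed.

Lemma same_below_wr d d' m x : d <= d' -> same_below d m (wr m (tcell d') x).
Proof. by move=> dd' j H; rewrite /wr; case: eqP => // jE; case: (H d'). Qed.

Lemma same_below_represents d m m' s : same_below d m m' -> represents m s -> represents m' s.
Proof.
move=> S R a i a16 a1; rewrite S ?R // => d' _; rewrite /tcell; move/eqP: a1; lia.
Qed.

Lemma tcell_inj d d' : (tcell d == tcell d') = (d == d').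
Proof. by rewrite /tcell; apply/eqP/eqP; lia. Qed.

Lemma same_below_tcell d d' m m' : same_below d m m' -> d' < d -> m' (tcell d') = m (tcell d').
Proof. by move=> S dd'; apply: S => d'' dd''; apply/eqP; rewrite tcell_inj; lia. Qed.

Lemma fits_eval s e : bounded_store s -> fits M s e -> eval s e <= M.
Proof.
move=> bs; elim: e => //= [e1 _ e2 _ []//|e1 IH1 e2 _ [/IH1 H _]].
exact: leq_trans (leq_subr _ _) H.
Qed.

Lemma address_correct l d a m ip o v : code_at l (address d a) -> a < 16 ->
  m (tcell d) = v -> v <= M ->
  exists m', [/\ reach (Config l m ip o) 6 (Config (l + 6) m' ip o),
    same_below d m m' & m' (tcell d) = 16 * v + a].
Proof.
move=> C a16 mv vM.
have [c1 /code_at_cons[c2 /code_at_cons[c3 /code_at_cons[c4 /code_at_cons[c5 /code_at_cons[c6 _]]]]]] :=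
  code_at_cons C.
pose m1 := wr m (tcell d) (v + v).
pose m2 := wr m1 (tcell d) (v + v + (v + v)).
pose m3 := wr m2 (tcell d) (v + v + (v + v) + (v + v + (v + v))).
pose m4 := wr m3 (tcell d) (16 * v).
pose m5 := wr m4 (tcell d.+1) a.
pose m6 := wr m5 (tcell d) (16 * v + a).
have wE m0 i x : wr m0 i x i = x by rewrite /wr eqxx.
have dS : (tcell d == tcell d.+1) = false by rewrite tcell_inj ltn_eqF.
have E1 : m1 (tcell d) = v + v by exact: wE.
have E2 : m2 (tcell d) = v + v + (v + v) by exact: wE.
have E3 : m3 (tcell d) = v + v + (v + v) + (v + v + (v + v)) by exact: wE.
have E5 : m5 (tcell d) = 16 * v by rewrite /m5 {1}/wr dS; exact: wE.
have E5' : m5 (tcell d.+1) = a by exact: wE.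
exists m6; split; last exact: wE.
- have r1 : reach (Config l m ip o) 1 (Config l.+1 m1 ip o).
    by have := @reach_add _ m ip o _ _ _ c1; rewrite mv; apply; lia.
  have r2 : reach (Config l.+1 m1 ip o) 1 (Config l.+2 m2 ip o).
    by have := @reach_add _ m1 ip o _ _ _ c2; rewrite E1; apply; lia.
  have r3 : reach (Config l.+2 m2 ip o) 1 (Config l.+3 m3 ip o).
    by have := @reach_add _ m2 ip o _ _ _ c3; rewrite E2; apply; lia.
  have r4 : reach (Config l.+3 m3 ip o) 1 (Config l.+4 m4 ip o).
    have := @reach_add _ m3 ip o _ _ _ c4; rewrite E3.
    by rewrite (_ : _ + _ = 16 * v); [apply; lia|lia].
  have r5 : reach (Config l.+4 m4 ip o) 1 (Config l.+4.+1 m5 ip o).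
    by apply: reach_const c5 _; lia.
  have r6 : reach (Config l.+4.+1 m5 ip o) 1 (Config l.+4.+2 m6 ip o).
    have := @reach_add _ m5 ip o _ _ _ c6.
    by rewrite E5 E5'; apply; lia.
  have -> : l + 6 = l.+4.+2 by rewrite addnC.
  exact: (reach_trans r1 (reach_trans r2 (reach_trans r3 (reach_trans r4 (reach_trans r5 r6))))).
- by do 6?[apply: same_below_trans (same_below_wr _ _ _); last done].
Qed.

Lemma ecode_correct e l d m ip o s : code_at l (ecode d e) -> legal_expr e ->
  represents m s -> bounded_store s -> fits M s e ->
  exists m', [/\ reach (Config l m ip o) (esize e) (Config (l + esize e) m' ip o),
    same_below d m m' & m' (tcell d) = eval s e].
Proof.
have wE m0 i x : wr m0 i x i = x by rewrite /wr eqxx.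
move=> + + + bs; elim: e l d m => [c|x|e1 IH1 e2 IH2|e1 IH1 e2 IH2|a e IH] l d m C /=.
- move=> _ R cM; have [c1 _] := code_at_cons C.
  exists (wr m (tcell d) c); split=> //; last exact: same_below_wr.
  by rewrite addn1; apply: reach_const c1 _; lia.
- move=> _ R _; have [c1 /code_at_cons[c2 _]] := code_at_cons C.
  pose m1 := wr m (tcell d) 0.
  have E : m1 (vcell x) + m1 (tcell d) = s 0 x.
    rewrite /m1 wE addn0 /wr; have -> : (vcell x == tcell d) = false.
      by apply/eqP; rewrite /vcell /tcell; lia.
    by rewrite -R // addn0.
  exists (wr m1 (tcell d) (s 0 x)); split; rewrite ?wE //.
    rewrite addn2; apply: (reach_trans (k := 1)); first by apply: reach_const c1 _.
    by rewrite -E; apply: reach_add c2 _; rewrite E; have := bs 0 x; lia.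
  by do 2?[apply: same_below_trans (same_below_wr _ _ _); last done].
- move=> /andP[ok1 ok2] R [f1 f2 sM].
  have [C1 /code_at_cat[C2 C3]] := code_at_cat C; rewrite !size_ecode in C2 C3.
  have [m1 [r1 s1 v1]] := IH1 _ _ m C1 ok1 R f1.
  have R1 := same_below_represents s1 R.
  have [m2 [r2 s2 v2]] := IH2 _ _ m1 C2 ok2 R1 f2.
  have v1' : m2 (tcell d) = eval s e1 by rewrite (same_below_tcell s2).
  have [c3 _] := code_at_cons C3.
  exists (wr m2 (tcell d) (eval s e1 + eval s e2)); rewrite wE; split=> //.
    rewrite !addnA; apply: reach_trans (reach_trans r1 r2) _.
    by rewrite addn1 -v1' -v2; apply: reach_add c3 _; rewrite v1' v2; lia.
  apply: same_below_trans (same_below_wr _ _ _) => //.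
  exact: same_below_trans s1 (same_belowS s2).
- move=> /andP[ok1 ok2] R [f1 f2].
  have [C1 /code_at_cat[C2 C3]] := code_at_cat C; rewrite !size_ecode in C2 C3.
  have [m1 [r1 s1 v1]] := IH1 _ _ m C1 ok1 R f1.
  have R1 := same_below_represents s1 R.
  have [m2 [r2 s2 v2]] := IH2 _ _ m1 C2 ok2 R1 f2.
  have v1' : m2 (tcell d) = eval s e1 by rewrite (same_below_tcell s2).
  have [c3 _] := code_at_cons C3; have b1 := fits_eval bs f1.
  exists (wr m2 (tcell d) (eval s e1 - eval s e2)); rewrite wE; split=> //.
    rewrite !addnA; apply: reach_trans (reach_trans r1 r2) _.
    by rewrite addn1 -v1' -v2; apply: reach_sub c3 _; rewrite v1' v2; lia.
  apply: same_below_trans (same_below_wr _ _ _) => //.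
  exact: same_below_trans s1 (same_belowS s2).
move=> /andP[/andP[a1 a16] ok] R f.
have [C1 /code_at_cat[C2 C3]] := code_at_cat C; rewrite !size_ecode in C2 C3.
have [m1 [r1 s1 v1]] := IH _ _ m C1 ok R f.
have [m2 [r2 s2 v2]] := address_correct ip o C2 a16 v1 (fits_eval bs f).
have [c3 _] := code_at_cons C3.
have R2 := same_below_represents s2 (same_below_represents s1 R).
have E : m2 (m2 (tcell d)) = s a (eval s e).
  by rewrite v2 R2 // gtn_eqF.
exists (wr m2 (tcell d) (s a (eval s e))); rewrite wE; split=> //.
  rewrite -[7]/(6 + 1) !addnA; apply: reach_trans (reach_trans r1 r2) _.
  by rewrite addn1 -E; apply: reach_load c3 _; rewrite E; have := bs a (eval s e); lia.
apply: same_below_trans (same_below_wr _ _ _) => //.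
exact: same_below_trans s1 s2.
Qed.

Lemma wr_represents m s a i v : represents m s -> a < 16 -> a != 1 ->
  represents (wr m (16 * i + a) v) (upd s a i v).
Proof.
move=> R a16 a1 b j b16 b1; rewrite /wr /upd R //.
have -> // : (16 * j + b == 16 * i + a) = (b == a) && (j == i).
by apply/eqP/andP => [E|[/eqP-> /eqP->]//]; split; apply/eqP; lia.
Qed.

Lemma upd_bounded s a i v : bounded_store s -> v <= M -> bounded_store (upd s a i v).
Proof. by move=> bs vM b j; rewrite /upd; case: ifP. Qed.

Theorem code_correct c h k h' : exec M c h k h' -> forall l m, legal c -> code_at l (code l c) ->
  represents m (sto h) -> bounded_store (sto h) ->
  exists m', [/\ reach (Config l m (hinp h) (hout h)) k
                      (Config (l + csize c) m' (hinp h') (hout h')),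
    represents m' (sto h') & bounded_store (sto h')].
Proof.
have wE m0 i x : wr m0 i x i = x by rewrite /wr eqxx.
elim=> {c h k h'}.
- by move=> h l m _ _ R bs; exists m; rewrite addn0; split=> //; exact: reach_refl.
- move=> x e h f l m /= ok /code_at_cat[C1 C2] R bs; rewrite size_ecode in C2.
  have [c1 /code_at_cons[c2 _]] := code_at_cons C2.
  have [m1 [r1 s1 v1]] := ecode_correct (hinp h) (hout h) C1 ok R bs f.
  have R1 := same_below_represents s1 R; have b1 := fits_eval bs f.
  pose m2 := wr m1 (tcell 1) 0.
  have E : m2 (tcell 0) + m2 (tcell 1) = eval (sto h) e by rewrite /m2 wE /wr tcell_inj v1 addn0.
  have s2 : same_below 0 m1 m2 by exact: same_below_wr.
  exists (wr m2 (vcell x) (eval (sto h) e)); split.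
  + rewrite -[2]/(1 + 1) !addnA; apply: reach_trans; first apply: reach_trans r1 _.
      exact: reach_const c1 _.
    by rewrite addn1 addn1 -E; apply: reach_add c2 _; rewrite E; lia.
  + rewrite -[vcell x]addn0; apply: wr_represents => //.
    exact: same_below_represents s2 R1.
  + exact: upd_bounded.
- move=> a e1 e2 h f1 f2 l m /= /and3P[/andP[a1 a16] ok1 ok2].
  move=> C R bs; have [C1 /code_at_cat[C2 /code_at_cat[C3 C4]]] :=
    @code_at_cat l _ (address 0 a ++ ecode 1 e2 ++ [:: StoreInd (tcell 0) (tcell 1)]) C.
  rewrite !size_ecode in C2 C3 C4; have [c4 _] := code_at_cons C4.
  have [m1 [r1 s1 v1]] := ecode_correct (hinp h) (hout h) C1 ok1 R bs f1.
  have b1 := fits_eval bs f1; have b2 := fits_eval bs f2.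
  have [m2 [r2 s2 v2]] := address_correct (hinp h) (hout h) C2 a16 v1 b1.
  have R2 := same_below_represents s2 (same_below_represents s1 R).
  have [m3 [r3 s3 v3]] := ecode_correct (hinp h) (hout h) C3 ok2 R2 bs f2.
  have v2' : m3 (tcell 0) = 16 * eval (sto h) e1 + a by rewrite (same_below_tcell s3).
  have R3 := same_below_represents s3 R2.
  exists (wr m3 (16 * eval (sto h) e1 + a) (eval (sto h) e2)); split.
  + rewrite (_ : esize e1 + esize e2 + 7 = esize e1 + 6 + esize e2 + 1); last lia.
    rewrite (_ : l + _ = (l + esize e1 + 6 + esize e2).+1); last lia.
    apply: reach_trans (reach_trans (reach_trans r1 r2) r3) _.
    by rewrite -v2' -v3; apply: reach_store c4 _; rewrite v3; lia.
  + by apply: wr_represents => //; rewrite gtn_eqF.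
  + exact: upd_bounded.
- move=> x s i o hM l m /= _ C R bs; have [c1 _] := code_at_cons C.
  exists (wr m (vcell x) (head 0 i)); split.
  + by rewrite addn1; apply: reach_read c1 _; lia.
  + by rewrite -[vcell x]addn0; exact: wr_represents.
  + exact: upd_bounded.
- move=> e s i o f l m /= ok /code_at_cat[C1 C2] R bs; rewrite size_ecode in C2.
  have [c1 _] := code_at_cons C2.
  have [m1 [r1 s1 v1]] := ecode_correct i o C1 ok R bs f.
  exists m1; split=> //; last exact: same_below_represents s1 R.
  rewrite addnA; apply: reach_trans r1 _; rewrite addn1 -v1; exact: reach_print c1.
- move=> c1 c2 h1 h2 h3 k1 k2 _ IH1 _ IH2 l m /= /andP[ok1 ok2] /code_at_cat[C1 C2] R bs.
  rewrite size_code in C2.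
  have [m1 [r1 R1 b1]] := IH1 _ _ ok1 C1 R bs.
  have [m2 [r2 R2 b2]] := IH2 _ _ ok2 C2 R1 b1.
  by exists m2; split=> //; rewrite addnA; exact: reach_trans r1 r2.
- move=> e c1 c2 h h' k f e0 _ IH l m /= /and3P[ok ok1 ok2].
  move=> /code_at_cat[C1 /code_at_cons[c3 /code_at_cat[_ /code_at_cons[_ /code_at_cons[_ C5]]]]] R bs.
  have [m1 [r1 s1 v1]] := ecode_correct (hinp h) (hout h) C1 ok R bs f.
  have R1 := same_below_represents s1 R.
  rewrite size_ecode size_code in C5; rewrite size_ecode in c3.
  have LE : (l + esize e).+1 + csize c2 = l + esize e + 1 + csize c2 by lia.
  rewrite LE -addn2 in C5.
  have [m2 [r2 R2 b2]] := IH _ _ ok1 C5 R1 bs.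
  exists m2; split=> //; rewrite !addnA; apply: reach_trans r2.
  by apply: reach_trans r1 _; apply: reach_jump c3 _; rewrite v1.
- move=> e c1 c2 h h' k f e0 _ IH l m /= /and3P[ok ok1 ok2].
  move=> /code_at_cat[C1 /code_at_cons[c3 /code_at_cat[C4 /code_at_cons[c5 /code_at_cons[c6 _]]]]] R bs.
  have [m1 [r1 s1 v1]] := ecode_correct (hinp h) (hout h) C1 ok R bs f.
  have R1 := same_below_represents s1 R.
  rewrite size_ecode in c3; rewrite size_ecode size_code -addn1 in c5 c6; rewrite size_ecode -addn1 in C4.
  have [m2 [r2 R2 b2]] := IH _ _ ok2 C4 R1 bs.
  have s3 : same_below 0 m2 (wr m2 (tcell 0) 1) by exact: same_below_wr.
  exists (wr m2 (tcell 0) 1); split=> //; last exact: same_below_represents s3 R2.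
  rewrite (_ : l + _ = l + esize e + 1 + csize c2 + 2 + csize c1); last lia.
  rewrite (_ : esize e + 1 + k + 2 = esize e + 1 + k + 1 + 1); last lia.
  apply: reach_trans; last by apply: reach_jump c6 _; rewrite wE.
  apply: reach_trans; last by apply: reach_const c5 _; lia.
  apply: reach_trans r2; apply: reach_trans r1 _.
  by rewrite addn1; apply: reach_nojump c3 _; rewrite v1.
- move=> e c h f e0 l m /= /andP[ok ok1].
  move=> /code_at_cat[C1 /code_at_cons[c3 /code_at_cons[c4 /code_at_cons[c5 _]]]] R bs.
  have [m1 [r1 s1 v1]] := ecode_correct (hinp h) (hout h) C1 ok R bs f.
  have R1 := same_below_represents s1 R; rewrite size_ecode in c3 c4 c5.
  have s3 : same_below 0 m1 (wr m1 (tcell 0) 1) by exact: same_below_wr.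
  exists (wr m1 (tcell 0) 1); split=> //; last exact: same_below_represents s3 R1.
  rewrite (_ : l + _ = l + esize e + 3 + csize c + 2); last lia.
  rewrite (_ : esize e + 3 = esize e + 1 + 1 + 1); last lia.
  apply: reach_trans; last by apply: reach_jump c5 _; rewrite wE.
  apply: reach_trans; last by apply: reach_const c4 _; lia.
  by apply: reach_trans r1 _; apply: reach_nojump c3 _; rewrite v1.
move=> e c h1 h2 h3 k1 k2 f e0 _ IH1 _ IH2 l m /= /andP[ok ok1] C R bs.
have [C1 /code_at_cons[c3 /code_at_cons[c4 /code_at_cons[c5 /code_at_cat[C6 /code_at_cons[c7 /code_at_cons[c8 _]]]]]]] := code_at_cat C.
have [m1 [r1 s1 v1]] := ecode_correct (hinp h1) (hout h1) C1 ok R bs f.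
have R1 := same_below_represents s1 R.
rewrite size_ecode in c3; rewrite size_ecode -addn3 in C6; rewrite size_ecode size_code -addn3 in c7 c8.
have [m2 [r2 R2 b2]] := IH1 _ _ ok1 C6 R1 bs.
have s3 : same_below 0 m2 (wr m2 (tcell 0) 1) by exact: same_below_wr.
have [|m4 [r4 R4 b4]] := IH2 l _ _ C (same_below_represents s3 R2) b2; first by rewrite /= ok ok1.
exists m4; split=> //; apply: reach_trans r4.
rewrite (_ : esize e + 1 + k1 + 2 = esize e + 1 + k1 + 1 + 1); last lia.
apply: reach_trans; last by apply: reach_jump c8 _; rewrite wE.
apply: reach_trans; last by apply: reach_const c7 _; lia.
apply: reach_trans r2; apply: reach_trans r1 _.
by apply: reach_jump c3 _; rewrite v1.
Qed.
End Compiler.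

Lemma compile_runs M B c w h k : exec M c (HConf (fun _ _ => 0) w [::]) k h ->
  legal c -> 16 * M + 15 <= B -> runs (code 0 c) B (init w) (k + 1) (hout h).
Proof.
move=> ex ok MB.
have [|||m' [r _ _]] // := @code_correct (code 0 c) B M MB _ _ _ _ ex 0 (fun=> 0) ok.
(* Behind the end of the code, [fetch] returns the default [Halt], which costs the additional
   step. *)
by apply: r; apply: runs_halt; rewrite /fetch /= nth_default // size_code.
Qed.

(** * Eliminating vertices of low degree *)

Section Elimination.
Variables (V : finType) (t : nat) (g0 : wgraph V).
Implicit Types (g : wgraph V) (F : rel V) (w : V).

(** [es_fst] is the neighbour at which the vertex hangs if it becomes a leaf. [es_series] tells that
    a tree edge between the two neighbours stands for the path through the vertex. *)
Record elim_step := ElimStep {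
  es_vertex : V; es_fst : option V; es_snd : option V; es_series : bool }.

Definition undo_step (e : elim_step) F : rel V :=
  let w := es_vertex e in
  match es_fst e, es_snd e with
  | Some a, Some b =>
      if F a b && es_series e then add_edge (add_edge (del_edge F a b) w a) w b
      else add_edge F w a
  | Some a, None => add_edge F w a
  | None, _ => F
  end.

(** [foldr] undoes the most recent elimination first. *)
Definition undo (hist : seq elim_step) F : rel V := foldr undo_step F hist.

(* [ok] records whether every pendant vertex met so far could be attached. *)
Definition valid_step g (e : elim_step) (ok ok' : bool) : Prop :=
  let w := es_vertex e in
  match es_fst e, es_snd e with
  | None, None => (forall x, ~~ wadj g w x) /\ ok' = ok
  | Some a, None =>
      [/\ wadj g w a, forall x, wadj g w x -> x = a & ok' = ok && (wp g w a <= t.+1)]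
  | Some a, Some b =>
      [/\ nbr_pair g w a b, wp g w a + wq g w b <= wp g w b + wq g w a,
          es_series e = ~~ wadj g a b || (use_series t g w a b < keep_old t g w a b)
        & ok' = ok]
  | None, Some _ => False
  end.

(** Positivity lets the value 0 in the edge array stand for a missing edge. *)
Definition bounded_weights g :=
  forall u v, wadj g u v -> 0 < wp g u v <= t.+2 /\ wq g u v <= t.+1.

(** Forwards only the existence of a feasible tree is kept, while backwards the history yields a
    specific one. Once [ok] is false the answer is settled, and the later eliminations cannot change
    it. *)
Definition equivalent g (hist : seq elim_step) (ok : bool) : Prop :=
  if ok then
    (forall F, feasible t g0 F -> exists F', feasible t g F') /\
    (forall F, feasible t g F -> feasible t g0 (undo hist F))
  else forall F, ~ feasible t g0 F.

Definition elim_inv g hist ok : Prop :=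
  [/\ wgraph_ok g, ~ K4_minor (wadj g), bounded_weights g & equivalent g hist ok].

Lemma bounded_eliminate g w : wgraph_ok g -> bounded_weights g ->
  bounded_weights (eliminate_vertex t g w).
Proof.
move=> gok bw u v /and3P[uw vw uv] /=.
rewrite /new_p /new_q; case: ifP => [puv|npuv]; last first.
  apply: bw; case/orP: uv => // uv; rewrite /nbr_pair in npuv; by rewrite uv in npuv.
have /and3P[_ wu wv] := puv; have [pu qu] := bw _ _ wu; have [pv qv] := bw _ _ wv.
have sq : series_q t g w u v <= t.+1 by exact: geq_minl.
have sp : 0 < series_p t g w u v <= t.+2.
  by move: pu pv; clear; rewrite /series_p; lia.
case: ifP => [Huv|nHuv]; last first.
  have [_ HL _ q0 _] := gok; have [[Hs _] _ _ _ _] := gok.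
  rewrite (q0 u v) ?nHuv ?max0n //; first by apply: (HL u w); rewrite Hs.
  by apply: (HL v w); rewrite Hs.
have [puv' quv] := bw _ _ Huv; split; last by rewrite geq_max quv sq.
by rewrite /keep_old /use_series; do 2!case: ifP => _; move: puv' sp; clear; lia.
Qed.

Lemma elim_inv_step g hist ok e ok' : elim_inv g hist ok ->
  live g (es_vertex e) -> #|wadj g (es_vertex e)| <= 2 -> valid_step g e ok ok' ->
  elim_inv (eliminate_vertex t g (es_vertex e)) (rcons hist e) ok'.
Proof.
move=> [gok nK bw eqv] Lw dw vs; have [[Hs Hi] _ _ _ _] := gok.
split; first exact: eliminate_ok.
- by move=> /eliminate_K4_minor K; apply: nK; exact: K.
- exact: bounded_eliminate.
have undo_rcons F : undo (rcons hist e) F = undo hist (undo_step e F).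
  by rewrite /undo -cats1 foldr_cat.
have ok'ok : ok' -> ok.
  move: vs; rewrite /valid_step; case: (es_fst e) => [a|]; case: (es_snd e) => [b|] //.
  - by case=> _ _ _ ->.
  - by case=> _ _ -> /andP[].
  - by case=> _ ->.
case: ok' ok'ok vs => [/(_ isT) okT|_] vs; subst.
  rewrite okT in eqv vs; case: eqv => E1 E2; split.
    by move=> F /E1[F' Ff]; exists (eliminate F' (es_vertex e)); exact: feasible_eliminate.
  move=> F Ff; rewrite undo_rcons; apply: E2; move: vs; rewrite /valid_step /undo_step.
  case: (es_fst e) => [a|]; case: (es_snd e) => [b|] //.
  - case=> pab le sE _; case: ifP => [/andP[Fab ser]|nser].
      apply: (series_feasible gok dw Ff) => // Hab; apply: ltnW.
      by move: ser; rewrite sE Hab.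
    apply: (detour_feasible gok dw Ff pab le) => Fab.
    move: nser; rewrite Fab sE /= => /negbT; rewrite negb_or negbK => /andP[-> ].
    by rewrite -leqNgt.
  - by case=> wa only /esym pwa; exact: (pendant_feasible gok Ff).
  - by case=> nH _; exact: (isolated_feasible gok Lw Ff).
case: ok eqv vs => [[E1 E2]|//] vs F /E1[F' [[_ FH] Fc _ use _]]; last first.
move: vs; rewrite /valid_step; case: (es_fst e) => [a|]; case: (es_snd e) => [b|] //.
- by case.
(* The tree spans and the vertex has a single neighbour, so this edge is in the tree and its weight
   is at most [t.+1]. *)
- case=> wa only /esym/negbT/negP; apply.
  have [_ HL _ _ _] := gok; have La : live g a by apply: (HL a (es_vertex e)); rewrite Hs.
  have [k wk] := Fc _ _ Lw La.
  have [z [l [wz _ _]]] := walk_inv wk (wadj_neq gok wa).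
  by rewrite -(only z) ?use //; exact: FH.
- by case.
Qed.

(** * Recovering at most two neighbours from power sums *)

Variable code : V -> nat.
Hypothesis code_gt0 : forall u, 0 < code u.
Hypothesis code_inj : injective code.
Definition ocode (o : option V) := if o is Some u then code u else 0.

(** Codes are positive, so a missing neighbour counts as 0 and one formula decodes all three cases.
    The larger code comes first because subtraction is truncated. *)
Lemma low_degree_decode (H : rel V) w : #|H w| <= 2 -> exists oa ob,
  [/\ ocode ob <= ocode oa,
      \sum_(v | H w v) code v = ocode oa + ocode ob,
      \sum_(v | H w v) code v ^ 2 = ocode oa ^ 2 + ocode ob ^ 2 &
      match oa, ob with
      | None, None => forall x, ~~ H w x
      | Some a, None => H w a /\ forall x, H w x -> x = a
      | Some a, Some b => [&& a != b, H w a & H w b]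
      | None, Some _ => False
      end].
Proof.
move=> dw.
have [[a wa]|nwa] := EM (exists a, H w a); last first.
  have n0 x : ~~ H w x by apply/negP => wx; apply: nwa; exists x.
  by exists None, None; split=> //=; apply: big1 => v wv; rewrite (negbTE (n0 v)) in wv.
have [[b [wb ba]]|nwb] := EM (exists b, H w b /\ b != a); last first.
  have only x : H w x -> x = a.
    by move=> wx; apply/eqP/negPn/negP => xa; apply: nwb; exists x.
  exists (Some a), None; split=> //=; rewrite ?addn0.
    by rewrite (big_pred1 a) // => v; apply/idP/eqP => [/only//|->].
  by rewrite (big_pred1 a) // => v; apply/idP/eqP => [/only//|->].
have two (f : V -> nat) : \sum_(v | H w v) f v = f a + f b.
  rewrite (bigD1 a) //= (big_pred1 b) // => v; apply/andP/eqP => [[wv va]|->] //.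
  apply/eqP/negPn/negP => vb; suff : 2 < #|H w| by rewrite ltnNge dw.
  by apply/card_gt2P; exists a, b, v; rewrite va (eq_sym a) ba (eq_sym b) vb.
have [le|/ltnW le] := leqP (code b) (code a).
  by exists (Some a), (Some b); rewrite !two eq_sym ba wa wb.
by exists (Some b), (Some a); rewrite !two ba wa wb [code a + _]addnC [code a ^ 2 + _]addnC.
Qed.

(** The root of the right-hand side is [a - b], and adding it to [a + b] gives twice [a]: both
    numbers follow from their sum and the sum of their squares. *)
Lemma decode_difference (a b : nat) : b <= a ->
  (a ^ 2 + b ^ 2) + (a ^ 2 + b ^ 2) - (a + b) ^ 2 = (a - b) ^ 2.
Proof.
move=> ba; rewrite -{1 2 3}(subnK ba); move: (a - b) => d.
rewrite !sqrnD; lia.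
Qed.

Section Sums.
Variables (g : wgraph V) (w : V) (f : V -> nat).
Hypothesis gok : wgraph_ok g.
Hypothesis degw : #|wadj g w| <= 2.
Local Notation H := (wadj g).
Local Notation H' := (eliminate H w).

Lemma sum_other u : u != w -> ~~ H w u -> \sum_(v | H' u v) f v = \sum_(v | H u v) f v.
Proof.
have [[Hs _] _ _ _ _] := gok => uw wu; apply: eq_bigl => v.
rewrite /eliminate /= uw (negbTE wu) andbF orbF /=.
by have [->|//] := eqVneq v w; rewrite Hs (negbTE wu).
Qed.

Lemma sum_nbr_split a : H w a -> \sum_(v | H a v) f v = f w + \sum_(v | H a v && (v != w)) f v.
Proof. by have [[Hs _] _ _ _ _] := gok => wa; rewrite (bigD1 w) //= Hs. Qed.

Lemma sum_nbr_keep a : H w a -> (forall b, nbr_pair g w a b -> H a b) ->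
  \sum_(v | H' a v) f v = \sum_(v | H a v && (v != w)) f v.
Proof.
move=> wa keep; apply: eq_bigl => v; rewrite /eliminate /=.
have aw : a != w by rewrite eq_sym (wadj_neq gok).
rewrite aw /= [in RHS]andbC; congr (_ && _).
apply/orP/idP => [[//|/and3P[av _ wv]]|->]; last by left.
by apply: keep; rewrite /nbr_pair av wa.
Qed.

(** At [a], the neighbour [w] is exchanged for [b], so the degree does not change. *)
Lemma sum_nbr_fill a b : nbr_pair g w a b -> ~~ H a b ->
  \sum_(v | H' a v) f v = f b + \sum_(v | H a v && (v != w)) f v.
Proof.
move=> pab nab; have /and3P[ab wa wb] := pab; have [aw bw] := nbr_pair_neq gok pab.
rewrite (bigD1 b) /=; last by rewrite /eliminate /= aw bw ab wa wb orbT.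
congr (_ + _); apply: eq_bigl => v; rewrite /eliminate /= aw /=.
have [->|vb] := eqVneq v b; first by rewrite andbF (negbTE nab).
rewrite andbT [in RHS]andbC; congr (_ && _).
apply/orP/idP => [[//|/and3P[av _ wv]]|->]; last by left.
by have [va|vb'] := nbr_pair_third degw pab wv; [rewrite va eqxx in av|rewrite vb' eqxx in vb].
Qed.

End Sums.
End Elimination.

(** * The algorithm *)

Section Program.
Declare Scope com_scope.
Local Notation "x ::= e" := (CSet x e) (at level 60) : com_scope.
Local Notation "c1 ;; c2" := (CSeq c1 c2) (at level 65, right associativity) : com_scope.
Local Notation "e1 :+ e2" := (EAdd e1 e2) (at level 50, left associativity) : com_scope.
Local Notation "e1 :- e2" := (ESub e1 e2) (at level 50, left associativity) : com_scope.
Local Open Scope com_scope.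

Local Notation vN := 0.
Local Notation vT := 1.
Local Notation vM := 2.
Local Notation vI := 3.
Local Notation vX := 4.
Local Notation vU := 5.
Local Notation vV := 6.
Local Notation vK := 7.
Local Notation vW := 8.
Local Notation vA := 9.
Local Notation vB := 10.
Local Notation vF := 11.
Local Notation vP1 := 12.
Local Notation vQ1 := 13.
Local Notation vP2 := 14.
Local Notation vQ2 := 15.
Local Notation vP := 16.
Local Notation vQ := 17.
Local Notation vY := 18.
Local Notation vSQ := 19.
Local Notation vZ := 20.
Local Notation vSP := 21.
Local Notation vK1 := 22.
Local Notation vK2 := 23.
Local Notation vOK := 24.
Local Notation vS := 25.

Local Notation aSQ := 2.
Local Notation aRT := 3.
Local Notation aHF := 4.
Local Notation aEE := 5.
Local Notation aP := 6.
Local Notation aQ := 7.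
Local Notation aDG := 8.
Local Notation aS := 9.
Local Notation aR := 10.
Local Notation aOR := 11.
Local Notation aNA := 12.
Local Notation aNB := 13.
Local Notation aCH := 14.
Local Notation aD := 15.

Local Notation "$ x" := (EVar x) (at level 1, format "$ x") : com_scope.
Local Notation "# c" := (ECst c) (at level 1, format "# c") : com_scope.
Local Notation "a {[ i ]}" := (EArr a i) (at level 2, format "a {[ i ]}") : com_scope.

(* The cell of the unordered pair {u, v} in the edge arrays. *)
Definition pair_index (u v : nat) : nat := (u + v) ^ 2 + (u - (u - v)).
Definition EIdx e1 e2 := aSQ{[e1 :+ e2]} :+ (e1 :- (e1 :- e2)).

(** Squares are built up by adding [2i + 1]. The tables of roots and halves are filled only at
    squares and at even numbers, the only places where they are consulted. *)
Definition c_table :=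
  CStore aSQ ($vI) ($vX) ;; CStore aRT ($vX) ($vI) ;; CStore aHF ($vI :+ $vI) ($vI) ;;
  vX ::= $vX :+ $vI :+ $vI :+ #1 ;; vI ::= $vI :+ #1.

Definition c_link x y :=
  CStore aDG ($x) (aDG{[$x]} :+ #1) ;; CStore aS ($x) (aS{[$x]} :+ $y) ;;
  CStore aR ($x) (aR{[$x]} :+ aSQ{[$y]}).

Definition c_unlink x y :=
  CStore aDG ($x) (aDG{[$x]} :- #1) ;; CStore aS ($x) (aS{[$x]} :- $y) ;;
  CStore aR ($x) (aR{[$x]} :- aSQ{[$y]}).

(** Vertices are shifted by one, so that 0 can stand for no vertex. *)
Definition c_edge :=
  CRead vU ;; CRead vV ;; vU ::= $vU :+ #1 ;; vV ::= $vV :+ #1 ;;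
  CStore aEE ($vI) ($vU) ;; CStore aEE ($vI :+ #1) ($vV) ;;
  CStore aP (EIdx ($vU) ($vV)) (#1) ;;
  c_link vU vV ;; c_link vV vU ;; vI ::= $vI :+ #2.

Definition c_enqueue :=
  vI ::= $vI :+ #1 ;;
  CIf (aDG{[$vI]} :- #2) CSkip (CStore aOR ($vK) ($vI) ;; vK ::= $vK :+ #1).

(** The test is the distance of the degree from 2. It is made after the loss of exactly one
    neighbour, so it catches the drop from 3 to 2, and no vertex is queued twice. *)
Definition c_push x :=
  CIf ((#2 :- aDG{[$x]}) :+ (aDG{[$x]} :- #2)) CSkip
    (CStore aOR ($vK) ($x) ;; vK ::= $vK :+ #1).

(** With [s] and [r] the sum and the sum of squares of the neighbours, the larger one is half of
    [s + sqrt(2r - s^2)]. *)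
Definition c_decode :=
  vW ::= aOR{[$vI]} ;; vS ::= aS{[$vW]} ;;
  vA ::= aHF{[$vS :+ aRT{[aR{[$vW]} :+ aR{[$vW]} :- aSQ{[$vS]}]}]} ;;
  vB ::= $vS :- $vA ;; CStore aNA ($vW) ($vA) ;; CStore aNB ($vW) ($vB).

(** The final swap stores the neighbours in the order in which hanging at the first one is the
    cheaper option. *)
Definition c_weights1 :=
  vF ::= EIdx ($vA) ($vB) ;;
  vP1 ::= aP{[EIdx ($vW) ($vA)]} ;; vQ1 ::= aQ{[EIdx ($vW) ($vA)]} ;;
  vP2 ::= aP{[EIdx ($vW) ($vB)]} ;; vQ2 ::= aQ{[EIdx ($vW) ($vB)]} ;;
  vP ::= aP{[$vF]} ;; vQ ::= aQ{[$vF]} ;;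
  vX ::= $vP1 :+ $vQ2 ;; vY ::= $vP2 :+ $vQ1 ;;
  CIf ($vX :- $vY) (CStore aNA ($vW) ($vB) ;; CStore aNB ($vW) ($vA)) CSkip.
(** With truncated subtraction, [x - (x - y)] is a minimum and [x + (y - x)] a maximum. *)
Definition c_weights2 :=
  vSQ ::= $vX :- ($vX :- $vY) ;;
  vSQ ::= ($vT :+ #1) :- (($vT :+ #1) :- $vSQ) ;;
  vZ ::= $vP1 :+ ($vP2 :- $vP1) ;;
  vZ ::= ($vT :+ #1) :+ ($vZ :- ($vT :+ #1)) ;;
  vSP ::= ($vP1 :+ $vP2) :- (($vP1 :+ $vP2) :- $vZ).

Definition c_weights := c_weights1 ;; c_weights2.

Definition c_merge :=
  CIf (($vT :+ #1) :- ($vP :+ $vSQ)) (vK1 ::= $vP) (vK1 ::= $vT :+ #2) ;;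
  CIf (($vT :+ #1) :- ($vSP :+ $vQ)) (vK2 ::= $vSP) (vK2 ::= $vT :+ #2) ;;
  CIf ($vK1 :- $vK2) (CStore aCH ($vW) (#1) ;; vZ ::= $vK2) (vZ ::= $vK1).

(** [vP] is 0 if the neighbours are not adjacent. They then become adjacent, and a tree edge between
    them always stands for the path through the eliminated vertex, hence the mark in [aCH]. *)
Definition c_pair :=
  c_weights ;; c_unlink vA vW ;; c_unlink vB vW ;;
  CIf ($vP) (c_push vA ;; c_push vB ;; c_merge)
    (c_link vA vB ;; c_link vB vA ;; CStore aCH ($vW) (#1) ;; vZ ::= $vSP) ;;
  CStore aP ($vF) ($vZ) ;; CStore aQ ($vF) ($vQ :+ ($vSQ :- $vQ)).

Definition c_pendant :=
  c_unlink vA vW ;; c_push vA ;;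
  CIf (aP{[EIdx ($vW) ($vA)]} :- ($vT :+ #1)) (vOK ::= #0) CSkip.

Definition c_eliminate :=
  c_decode ;; CIf ($vA) (CIf ($vB) c_pair c_pendant) CSkip ;; vI ::= $vI :+ #1.

(** [aD] holds the tree. Hanging [w] at [a] and expanding [ab] both insert [wa]; an expansion also
    trades [ab] for [wb]. *)
Definition c_undo :=
  vI ::= $vI :- #1 ;; vW ::= aOR{[$vI]} ;; vA ::= aNA{[$vW]} ;; vB ::= aNB{[$vW]} ;;
  CIf ($vA)
    (CIf ($vB)
       (vF ::= EIdx ($vA) ($vB) ;;
        CIf (aD{[$vF]})
          (CIf (aCH{[$vW]})
             (CStore aD ($vF) (#0) ;; CStore aD (EIdx ($vW) ($vB)) (#1)) CSkip)
          CSkip)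
       CSkip ;;
     CStore aD (EIdx ($vW) ($vA)) (#1))
    CSkip.

Definition c_output :=
  CIf (aD{[EIdx (aEE{[$vI]}) (aEE{[$vI :+ #1]})]})
    (CPrint (aEE{[$vI]} :- #1) ;; CPrint (aEE{[$vI :+ #1]} :- #1)) CSkip ;;
  vI ::= $vI :+ #2.

(** [vM] is doubled because each edge takes two cells of [aEE]. *)
Definition c_start := CRead vN ;; CRead vT ;; CRead vM ;; vM ::= $vM :+ $vM.
(** The elimination loop leaves [vI] at [n], where the backward loop starts. Without a solution [vM]
    is cleared, so that nothing follows the 0 in the output. *)
Definition c_main :=
  c_start ;;
  CWhile ($vN :+ $vN :+ #1 :- $vI) c_table ;; vI ::= #0 ;;
  CWhile ($vM :- $vI) c_edge ;; vI ::= #0 ;;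
  CWhile ($vN :- $vI) c_enqueue ;; vI ::= #0 ;; vOK ::= #1 ;;
  CWhile ($vN :- $vI) c_eliminate ;;
  CWhile ($vI) c_undo ;;
  CPrint ($vOK) ;; CIf ($vOK) CSkip (vM ::= #0) ;;
  CWhile ($vM :- $vI) c_output.

(** A loop makes at most [2n + 1] rounds, and with the failing test [2n + 2 <= 4n]. *)
Definition loop_cost e c := 4 * (esize e + ccost c + 3).
Definition main_cost :=
  ccost c_start + (loop_cost ($vN :+ $vN :+ #1 :- $vI) c_table + (ccost (vI ::= #0) +
  (loop_cost ($vM :- $vI) c_edge + (ccost (vI ::= #0) +
  (loop_cost ($vN :- $vI) c_enqueue + (ccost (vI ::= #0) + (ccost (vOK ::= #1) +
  (loop_cost ($vN :- $vI) c_eliminate + (loop_cost ($vI) c_undo +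
  (ccost (CPrint ($vOK)) + (ccost (CIf ($vOK) CSkip (vM ::= #0)) +
   loop_cost ($vM :- $vI) c_output))))))))))).

Lemma legal_main : legal c_main. Proof. by []. Qed.

Lemma pair_indexC u v : pair_index u v = pair_index v u.
Proof. by rewrite /pair_index (addnC u v); congr (_ + _); lia. Qed.

(** The second summand is the minimum of [u] and [v], which is smaller than the gap between
    [(u + v)^2] and the next square. So the sum can be read off, and then the minimum. *)
Lemma pair_index_inj u v x y : pair_index u v = pair_index x y ->
  (u = x /\ v = y) \/ (u = y /\ v = x).
Proof.
rewrite /pair_index -!mulnn => E.
have s : u + v = x + y.
  have [l|l|//] := ltngtP (u + v) (x + y); exfalso; have := leq_mul l l; move: E; clear; nia.
rewrite s in E; lia.
Qed.

(** * Loop invariants of the program *)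

Section Correctness.
Variables (n t : nat) (G : graph n) (es : seq ('I_n * 'I_n)).
Hypotheses (Gconn : graph_connected G) (GK4 : ~ K4_minor G).
Hypotheses (t_gt0 : 0 < t) (Ges : edge_list G es).
Variables (X : nat).
(** The cube bounds a sum of squares of up to [n] codes, the square governs the addresses of edges,
    and [t + 2] is the largest weight. The factor 16 in the bound on words absorbs the constants. *)
Hypothesis X_n3 : n ^ 3 + n ^ 2 + n + t + 2 <= X.
Local Notation M := (16 * X).
Local Notation V := 'I_n.
Local Notation m := (size es).

Definition vcode (u : V) : nat := u.+1.
Definition edge_index (x y : V) := pair_index (vcode x) (vcode y).

Lemma edge_index_eq x y u v : (edge_index x y == edge_index u v) =
  ((x == u) && (y == v)) || ((x == v) && (y == u)).
Proof.
apply/eqP/orP => [/pair_index_inj[] [/succn_inj/val_inj-> /succn_inj/val_inj->]|].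
- by left; rewrite !eqxx.
- by right; rewrite !eqxx.
- by case=> /andP[/eqP-> /eqP->] //; rewrite /edge_index pair_indexC.
Qed.

Definition tables_upto (s : store) k :=
  forall j, j < k -> [/\ s aSQ j = j ^ 2, s aRT (j ^ 2) = j & s aHF (j + j) = j].

Definition base (s : store) :=
  [/\ s 0 vN = n, s 0 vT = t, s 0 vM = m + m & tables_upto s (n + n + 1)].

(** Arrays are numbered in the order in which the phases start to use them, so one threshold says
    what is still blank. *)
Definition zero_from (s : store) k := forall a j, k <= a -> s a j = 0.

Lemma small_sq j : j <= n + n -> j ^ 2 <= 4 * X.
Proof.
by move=> jn; have := leq_mul jn jn; move: X_n3; rewrite -!mulnn; clear; nia.
Qed.

Definition inv_table k (h : hconf) : Prop :=
  [/\ [/\ sto h 0 vN = n, sto h 0 vT = t, sto h 0 vM = m + m, sto h 0 vI = k & sto h 0 vX = k ^ 2],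
      tables_upto (sto h) k, zero_from (sto h) 5, hinp h = flat es & hout h = [::] /\ sto h 0 vK = 0].

Lemma run_table h : inv_table 0 h ->
  runs_to M (CWhile ($vN :+ $vN :+ #1 :- $vI) c_table)
    ((n + n + 1).+1 * (esize ($vN :+ $vN :+ #1 :- $vI) + ccost c_table + 3))
    (inv_table (n + n + 1)) h.
Proof.
apply: runs_to_loop => [k {}h kn [[eN eT eM eI eX] tb z hi ho]|{}h [[eN eT eM eI eX] tb z hi ho]];
  last by rewrite /= eN eI; split; [do !split; lia|lia].
have kk := @small_sq k; have k2 : (k + 1) ^ 2 = k ^ 2 + k + k + 1.
  by rewrite sqrnD; clear; lia.
rewrite /= eN eI eX; split; [do !split; lia|lia|].
split=> // i1 v1 -> ->; split=> //= i2 v2 -> ->; split=> //=.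
  by rewrite /upd /= eI; do !split; lia.
move=> i3 v3 -> ->; rewrite /= /upd /= ?eI ?eX; split; first by do !split; lia.
move=> v4 ->; split; first by do !split; lia.
move=> v5 ->; split=> //=; rewrite /upd /=.
- by split=> //; [rewrite addn1|rewrite -k2 addn1].
- move=> j; rewrite ltnS leq_eqVlt => /orP[/eqP->|jk]; rewrite /= ?eqxx //.
  have jj : (j + j == k + k) = false by apply/eqP; clear -jk; lia.
  by rewrite eqn_sqr jj (ltn_eqF jk); exact: tb.
- by move=> b j b5; rewrite !(gtn_eqF (leq_trans _ b5)) //=; exact: z.
Qed.

Lemma n_gt0 : 0 < n. Proof. by case: Gconn. Qed.
Definition u0 : V := Ordinal n_gt0.

Definition edges_rel (l : seq (V * V)) : rel V :=
  [rel x y | ((x, y) \in l) || ((y, x) \in l)].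

Lemma edges_relE x y : G x y = edges_rel es x y.
Proof.
have [_ ->] := Ges; rewrite mem_cat /edges_rel /=; congr (_ || _).
apply/mapP/idP => [[[a b] ab [-> ->]] //|yx]; by exists (y, x).
Qed.

Lemma edges_rel_rcons l a b x y :
  edges_rel (rcons l (a, b)) x y = add_edge (edges_rel l) a b x y.
Proof.
rewrite /edges_rel /add_edge /= !mem_rcons !inE !xpair_eqE.
by rewrite (andbC (y == a)); do 2!case: (_ \in l); do 2!case: (_ && _).
Qed.

Lemma edges_rel_sym l : symmetric (edges_rel l).
Proof. by move=> x y; rewrite /edges_rel /= orbC. Qed.

Lemma new_edge k : k < m -> let e := nth (u0, u0) es k in
  ~~ edges_rel (take k es) e.1 e.2 /\ e.1 != e.2.
Proof.
move=> km e; have ein : e \in es by exact: mem_nth.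
have [U _] := Ges; have Ues : uniq es by move: U; rewrite cat_uniq => /and3P[].
split; last first.
  have : G e.1 e.2 by rewrite edges_relE /edges_rel /= -surjective_pairing ein.
  by apply: contraTneq => ->; rewrite adj_irr.
have nin : e \notin take k es.
  by apply/negP => /(nthP (u0, u0))[j]; rewrite size_take km => jk /eqP;
  rewrite nth_take // nth_uniq ?(ltn_trans jk) // (ltn_eqF jk).
rewrite /edges_rel /= negb_or -surjective_pairing nin /=.
apply/negP => /mem_take eb; move: U; rewrite cat_uniq => /and3P[_ /negP nh _].
by apply: nh; apply/hasP; exists e => //; apply/mapP; exists (e.2, e.1) => //=; case: (e).
Qed.

Lemma sum_add_edge (E : rel V) a b (f : V -> nat) u : symmetric E -> ~~ E a b -> a != b ->
  \sum_(v | add_edge E a b u v) f v =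
  \sum_(v | E u v) f v + (if u == a then f b else if u == b then f a else 0).
Proof.
move=> Es nE ab; rewrite /add_edge /=.
have [->|ua] := eqVneq u a; last have [->|ub] := eqVneq u b.
- rewrite (bigD1 b) ?eqxx ?orbT //= addnC; congr (_ + _); apply: eq_bigl => v.
  rewrite (negbTE ab) orbF; case: (eqVneq v b) => [->|]; rewrite ?andbT ?andbF ?orbF //.
  by rewrite (negbTE nE).
- rewrite (bigD1 a) ?eqxx ?orbT //= addnC; congr (_ + _); apply: eq_bigl => v.
  case: (eqVneq v a) => [->|]; rewrite ?andbT ?andbF ?orbF //=.
  by rewrite Es (negbTE nE).
- by rewrite addn0; apply: eq_bigl => v; rewrite /= orbF.
Qed.

Lemma size_edges : m <= 2 * n.
Proof.
have := K4_minor_free_card (@adj_sym n G) (@adj_irr n G) GK4.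
have [U E] := Ges; rewrite card_ord => c.
have := card_uniqP U; rewrite size_cat size_map => cE.
have : #|es ++ [seq (e.2, e.1) | e <- es]| <= #|[pred e : V * V | G e.1 e.2]|.
  by apply/subset_leq_card/subsetP => -[x y] xy; rewrite inE /= E.
rewrite cE => c2; have c3 : m + m <= 4 * n by exact: leq_trans c2 c.
by clear -c3; lia.
Qed.

Definition degree_sums (s : store) (E : rel V) :=
  forall u, [/\ s aDG (vcode u) = \sum_(v | E u v) 1,
                s aS (vcode u) = \sum_(v | E u v) vcode v &
                s aR (vcode u) = \sum_(v | E u v) vcode v ^ 2].

Definition edge_table (s : store) k :=
  forall j, j < k -> s aEE (j + j) = vcode (nth (u0, u0) es j).1 /\
                     s aEE (j + j + 1) = vcode (nth (u0, u0) es j).2.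

Lemma sum_bound (E : rel V) u : [/\ \sum_(v | E u v) 1 <= X,
  \sum_(v | E u v) vcode v <= X & \sum_(v | E u v) vcode v ^ 2 <= X].
Proof.
have S c (f : V -> nat) : (forall v, f v <= c) -> \sum_(v | E u v) f v <= n * c.
  move=> fc; apply: leq_trans (leq_sum _ (fun v _ => fc v)) _.
  by rewrite sum_nat_const leq_mul2r; apply/orP; right; rewrite -[X in _ <= X]card_ord max_card.
have := S n vcode (fun v => ltn_ord v); have := S 1 (fun=> 1) (fun=> isT).
have := S (n ^ 2) (fun v => vcode v ^ 2) (fun v => _).
move=> /(_ (fun v => leq_trans (eq_leq erefl) _)) H3 H1 H2.
have {}H3 : \sum_(v | E u v) vcode v ^ 2 <= n * n ^ 2.
  by apply: S => v; rewrite leq_sqr ltn_ord.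
by split; move: X_n3 H1 H2 H3; rewrite -?mulnn ?expnS ?expn0 ?muln1; clear; nia.
Qed.

Definition inv_edge k (h : hconf) : Prop :=
  [/\ base (sto h), sto h 0 vI = k + k /\ sto h 0 vK = 0,
      hinp h = flat (drop k es) /\ hout h = [::], edge_table (sto h) k
    & [/\ forall x y, sto h aP (edge_index x y) = edges_rel (take k es) x y,
          degree_sums (sto h) (edges_rel (take k es)),
          forall j, sto h aQ j = 0 & zero_from (sto h) 11]].

Lemma pair_index_small u v : u <= n -> v <= n -> pair_index u v <= 5 * X.
Proof.
move=> un vn; have := @small_sq (u + v) (leq_add un vn).
by rewrite /pair_index; move: X_n3; clear -un; lia.
Qed.

Lemma tables_sq s j : tables_upto s (n + n + 1) -> j <= n + n -> s aSQ j = j ^ 2.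
Proof. by move=> tb jn; have [|->//] := tb j; rewrite addn1 ltnS. Qed.

Lemma run_edge h : inv_edge 0 h ->
  runs_to M (CWhile ($vM :- $vI) c_edge)
    (m.+1 * (esize ($vM :- $vI) + ccost c_edge + 3)) (inv_edge m) h.
Proof.
apply: runs_to_loop => [k {}h km|{}h]; last first.
  by case=> [[eN eT eM tb] [eI _] _ _ _]; rewrite /= eM eI; split; [|lia].
case=> [[eN eT eM tb] [eI eK] [hi ho] et [PE ds q0 z]].
have [nE ab] := new_edge km; set e := nth _ es k in nE ab.
have hiE : hinp h = [:: val e.1, val e.2 & flat (drop k.+1 es)].
  by rewrite hi (drop_nth (u0, u0) km).
have e1n := ltn_ord e.1; have e2n := ltn_ord e.2.
have [nX tX] : n <= X /\ t + 2 <= X by move: X_n3; clear; lia.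
have mn := size_edges.
rewrite /= eM eI hiE /=; split; [by []|lia|].
rewrite /upd /= !addn1 -/(vcode e.1) -/(vcode e.2).
have ia : pair_index (vcode e.1) (vcode e.2) <= 5 * X by exact: pair_index_small.
have sE : sto h aSQ (vcode e.1 + vcode e.2) = (vcode e.1 + vcode e.2) ^ 2.
  by apply: tables_sq => //; exact: leq_add.
have sq1 : sto h aSQ (vcode e.1) = vcode e.1 ^ 2 by apply: tables_sq => //; rewrite ltn_addr.
have sq2 : sto h aSQ (vcode e.2) = vcode e.2 ^ 2 by apply: tables_sq => //; rewrite ltn_addr.
have [d1 s1 r1] := ds e.1; have [d2 s2 r2] := ds e.2.
have [bd1 bs1 br1] := sum_bound (edges_rel (take k es)) e.1.
have [bd2 bs2 br2] := sum_bound (edges_rel (take k es)) e.2.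
have b1 := small_sq (ltnW (ltn_addr n e1n)); have b2 := small_sq (ltnW (ltn_addr n e2n)).
have bb1 : vcode e.1 ^ 2 <= 4 * X by apply: small_sq; rewrite ltn_addr.
have bb2 : vcode e.2 ^ 2 <= 4 * X by apply: small_sq; rewrite ltn_addr.
have vc1 : vcode e.1 <= n by []. 
have vc2 : vcode e.2 <= n by [].
have vne u v : (vcode u == vcode v) = (u == v) by [].
do 2![split; first lia].
split; first by split=> //; lia.
move=> ? ->; split; first by split=> //; lia.
move=> ? ->; split=> //.
have eab : (vcode e.2 == vcode e.1) = false by rewrite vne eq_sym (negbTE ab).
move=> ? ? -> ->; rewrite /= /upd /= eI; split=> //; first by split=> //; lia.
move=> ? ? -> ->; rewrite /= /upd /= sE; split=> //.
  by rewrite /pair_index in ia; do !split=> //; lia.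
  lia.
move=> ? ? -> ->; rewrite -/(pair_index _ _) /= /upd /= ?eqxx /= d1; split=> //.
  by split=> //; lia.
move=> ? ? -> ->; rewrite /= /upd /= ?eqxx /= s1; split=> //.
  by split=> //; lia.
move=> ? ? -> ->; rewrite /= /upd /= ?eqxx /= r1 sq2; split=> //.
  by split=> //; lia.
move=> ? ? -> ->; rewrite /= /upd /= ?eab /= d2; split=> //.
  by split=> //; lia.
move=> ? ? -> ->; rewrite /= /upd /= ?eab /= s2; split=> //.
  by split=> //; lia.
move=> ? ? -> ->; rewrite /= /upd /= ?eab /= r2 sq1; split=> //.
  by split=> //; lia.
move=> ? ? -> ->; rewrite /= /upd /=; split=> //.
  by split=> //; lia.
move=> ? ->; rewrite /inv_edge /= /upd /=.
have tk : take k.+1 es = rcons (take k es) (e.1, e.2).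
  by rewrite (take_nth (u0, u0)) // -surjective_pairing.
have Es := edges_rel_sym (take k es).
split=> //; first by split=> //; lia.
- move=> j; rewrite ltnS leq_eqVlt ?addn1 => /orP[/eqP->|jk] /=.
    by rewrite !eqxx (ltn_eqF (ltnSn (k + k))).
  have := et j jk; rewrite addn1 eqSS.
  rewrite (_ : (j + j == (k + k).+1) = false); last by apply/eqP; lia.
  rewrite (_ : (j + j == k + k) = false); last by apply/eqP; lia.
  by rewrite (_ : ((j + j).+1 == k + k) = false) //; apply/eqP; lia.
split=> //.
- move=> x y; rewrite tk edges_rel_rcons -/(edge_index e.1 e.2) edge_index_eq /add_edge /= PE.
  by case: ifP => _; rewrite ?orbT ?orbF.
- move=> u /=; have [du su ru] := ds u; rewrite !vne.
  rewrite !(eq_bigl _ _ (fun v => congr1 (fun l => edges_rel l u v) tk)).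
  rewrite !(eq_bigl _ _ (edges_rel_rcons (take k es) e.1 e.2 u)) !sum_add_edge //.
  have [->|u2] := eqVneq u e.2.
    by rewrite (_ : (e.2 == e.1) = false) // eq_sym (negbTE ab).
  by have [->|u1] := eqVneq u e.1; rewrite ?addn0.
- by move=> b j b11; rewrite !(gtn_eqF (leq_trans _ b11)) //=; exact: z.
Qed.

Definition low_degree (E : rel V) u := #|E u| <= 2.

Definition queue (s : store) (ord : seq V) :=
  s 0 vK = size ord /\ forall j, j < size ord -> s aOR j = vcode (nth u0 ord j).

Definition inv_enqueue k (h : hconf) : Prop :=
  [/\ base (sto h), sto h 0 vI = k, hout h = [::], edge_table (sto h) m
    & [/\ forall x y, sto h aP (edge_index x y) = G x y,
          degree_sums (sto h) G, forall j, sto h aQ j = 0, zero_from (sto h) 12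
        & queue (sto h) [seq u <- take k (enum 'I_n) | low_degree G u]]].

Lemma run_enqueue h : inv_enqueue 0 h ->
  runs_to M (CWhile ($vN :- $vI) c_enqueue)
    (n.+1 * (esize ($vN :- $vI) + ccost c_enqueue + 3)) (inv_enqueue n) h.
Proof.
apply: runs_to_loop => [k {}h kn|{}h]; last first.
  by case=> [[eN eT eM tb] eI _ _ _]; rewrite /= eN eI; split; [|lia].
case=> [[eN eT eM tb] eI ho et [PE ds q0 z [eK qs]]].
have [nX tX] : n <= X /\ t + 2 <= X by move: X_n3; clear; lia.
pose u := Ordinal kn.
have tk : take (vcode u) (enum 'I_n) = rcons (take k (enum 'I_n)) u.
  rewrite /vcode (take_nth u) ?size_enum_ord //; congr rcons; apply: val_inj.
  by rewrite /= nth_enum_ord.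
have [du _ _] := ds u; rewrite sum1_card in du.
set ord := [seq _ <- _ | _] in eK qs.
have so : size ord <= n.
  by rewrite size_filter (leq_trans (count_size _ _)) // size_take size_enum_ord kn ltnW.
rewrite /= eN eI; split; [by []|lia|].
split; first by split=> //; lia.
move=> ? ->; rewrite /= /upd /= addn1 -/(vcode u) du; split; first by split=> //; lia.
  move=> d2; split=> //; split=> //.
    by move=> b j b12; rewrite /= /upd (gtn_eqF (leq_trans _ b12)) //=; exact: z.
  rewrite tk filter_rcons /low_degree.
  by rewrite (_ : _ <= 2 = false) //; apply/negbTE; rewrite -ltnNge -subn_gt0.
move=> d2; split=> // ? ? -> ->; rewrite /= /upd /= eK; split; first by split=> //; lia.
move=> ? ->; rewrite /hset /= /upd /=; split=> //; split=> //.
- by move=> b j b12; rewrite /= !(gtn_eqF (leq_trans _ b12)) //=; exact: z.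
- rewrite tk filter_rcons /low_degree (_ : _ <= 2 = true); last first.
    by move/eqP: d2; rewrite subn_eq0.
  split; rewrite /= ?size_rcons ?addn1 // => j; rewrite ltnS leq_eqVlt nth_rcons.
  case/orP=> [/eqP->|jo]; first by rewrite ltnn ?eqxx.
  by rewrite jo (ltn_eqF jo) qs.
Qed.

Definition dec (k : nat) : option V := if k is k'.+1 then insub k' else None.

Definition step_of (s : store) (u : V) : elim_step V :=
  ElimStep u (dec (s aNA (vcode u))) (dec (s aNB (vcode u))) (0 < s aCH (vcode u)).

Definition rel_table (s : store) (F : rel V) :=
  forall x y, (0 < s aD (edge_index x y)) = F x y.

(** The history is read off arrays that this loop leaves alone. The empty relation is the tree after
    all eliminations, and each round takes back one of them. *)
Definition inv_undo (ord : seq V) (hs : seq (elim_step V)) (ok : bool) k (h : hconf) : Prop :=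
  [/\ base (sto h), sto h 0 vI = n - k /\ sto h 0 vOK = ok, hout h = [::], edge_table (sto h) m
    & [/\ forall j, j < n -> sto h aOR j = vcode (nth u0 ord j),
          forall u, sto h aNA (vcode u) <= n /\ sto h aNB (vcode u) <= n,
          hs = [seq step_of (sto h) u | u <- ord]
        & rel_table (sto h) (undo (drop (n - k) hs) (fun _ _ => false))]].

Lemma run_undo ord hs ok h : size ord = n -> inv_undo ord hs ok 0 h ->
  runs_to M (CWhile ($vI) c_undo)
    (n.+1 * (esize ($vI) + ccost c_undo + 3)) (inv_undo ord hs ok n) h.
Proof.
move=> so; apply: runs_to_loop => [k {}h kn|{}h]; last first.
  by case=> [_ [eI _] _ _ _]; rewrite /= eI subnn.
case=> [[eN eT eM tb] [eI eok] ho et [eor nab hsE rt]].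
have [nX tX] : n <= X /\ t + 2 <= X by move: X_n3; clear; lia.
set i := n - k.+1; have iE : n - k = i.+1 by rewrite /i; lia.
have i_n : i < n by rewrite /i; lia.
set w := nth u0 ord i.
have hsi : drop i hs = step_of (sto h) w :: drop i.+1 hs.
  rewrite (drop_nth (step_of (sto h) u0)) hsE ?size_map ?so //.
  by rewrite (nth_map u0) ?so.
rewrite iE in rt; set F := undo _ _ in rt.
have [naw nbw] := nab w.
rewrite /= eI iE; split=> //; split; first by split=> //; lia.
move=> ? ->; rewrite /= /upd /= subn1 /= eor // -/w; split=> //.
move=> ? ->; rewrite /= /upd /=; split=> //.
move=> ? ->; rewrite /= /upd /=; split=> //.
move=> ? ->; rewrite /= /upd /=.
have sqE u v : u <= n -> v <= n -> sto h aSQ (u + v) = (u + v) ^ 2.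
  by move=> un vn; apply: tables_sq => //; exact: leq_add.
have wn : vcode w <= n by exact: (ltn_ord w).
have idx u v := @pair_index_small u v; rewrite /pair_index in idx.
have deca : forall (a : V) k', k' = vcode a -> dec k' = Some a by move=> a _ ->; rewrite /= valK.
have code_of k' : 0 < k' -> k' <= n -> exists a : V, k' = vcode a.
  by case: k' => // k' _ kn'; exists (Ordinal kn').
have undoE : undo (drop i hs) (fun _ _ => false) = undo_step (step_of (sto h) w) F by rewrite hsi.
split=> //.
  move=> a0; have [a aE] := code_of _ a0 naw.
  have da := deca a _ aE; split=> //.
    move=> b0; have [b bE] := code_of _ b0 nbw; have db := deca b _ bE.
    rewrite aE bE in naw nbw *; rewrite !sqE //.
    split; first by do !split=> //; have := idx _ _ naw nbw; lia.
    move=> ? ->; rewrite /= /upd /= -/(pair_index _ _) -/(edge_index a b).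
    split=> // D1; last first.
      rewrite /= /upd /= ?sqE //; split; [by do !split=> //; have := idx _ _ wn naw; lia|lia|].
      move=> ? ? -> ->; rewrite -/(pair_index _ _) -/(edge_index w a).
      split=> //=; split=> //= x y; rewrite undoE /undo_step /= da db.
      rewrite /upd /= -rt D1 ltnn /= /add_edge /= edge_index_eq.
      by case: ifP => _; rewrite ?orbT ?orbF ?rt.
    split=> // C1; last first.
      rewrite /= /upd /= ?sqE //; split; [by do !split=> //; have := idx _ _ wn naw; lia|lia|].
      move=> ? ? -> ->; rewrite -/(pair_index _ _) -/(edge_index w a).
      split=> //=; split=> //= x y; rewrite undoE /undo_step /= da db.
      rewrite /upd /= -rt D1 C1 ltnn /= /add_edge /= edge_index_eq.
      by case: ifP => _; rewrite ?orbT ?orbF ?rt.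
    split=> // ? ? -> ->; rewrite /= /upd /= ?sqE //.
    split; [by do !split=> //; have := idx _ _ wn nbw; lia|lia|].
    move=> ? ? -> ->; rewrite /= /upd /= -/(pair_index _ _) -/(edge_index w b) ?sqE //.
    split; [by do !split=> //; have := idx _ _ wn naw; have := pair_index_small wn naw; lia|lia|].
    move=> ? ? -> ->; rewrite -/(pair_index _ _) -/(edge_index w a).
    split=> //=; split=> //= x y; rewrite undoE /undo_step /= da db.
    rewrite /upd /= -rt D1 C1 /= /add_edge /del_edge /= !edge_index_eq.
    case: ifP => _; first by rewrite ?orbT.
    case: ifP => _; first by rewrite ?orbT.
    rewrite !orbF; case: ifP => [/orP[]->|/negbT/norP[/negbTE-> /negbTE->]]; rewrite ?andbF //=.
    by rewrite andbT -rt.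
  move=> b0; rewrite aE in naw *; rewrite ?sqE //.
  split; [by do !split=> //; have := idx _ _ wn naw; lia|lia|].
  move=> ? ? -> ->; rewrite -/(pair_index _ _) -/(edge_index w a).
  split=> //=; split=> //= x y; rewrite undoE /undo_step /= da b0 /=.
  rewrite /upd /= /add_edge /= edge_index_eq.
  by case: ifP => _; rewrite ?orbT ?orbF ?rt.
move=> a0; split=> //=; split=> //= x y.
by rewrite undoE /undo_step /= a0 /= /upd /= rt.
Qed.

Lemma flat_rcons (l : seq (V * V)) e :
  flat (rcons l e) = rcons (rcons (flat l) (val e.1)) (val e.2).
Proof. by rewrite /flat map_rcons flatten_rcons -!cats1 -catA. Qed.

Definition inv_output (F : rel V) k (h : hconf) : Prop :=
  [/\ base (sto h), sto h 0 vI = k + k, edge_table (sto h) m, rel_table (sto h) F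
    & hout h = 1 :: flat [seq e <- take k es | F e.1 e.2]].

Lemma run_output F h : inv_output F 0 h ->
  runs_to M (CWhile ($vM :- $vI) c_output)
    (m.+1 * (esize ($vM :- $vI) + ccost c_output + 3)) (inv_output F m) h.
Proof.
apply: runs_to_loop => [k {}h km|{}h]; last first.
  by case=> [[eN eT eM tb] eI _ _ _]; rewrite /= eM eI; split; [|lia].
case=> [[eN eT eM tb] eI et rt ho].
have [nX tX] : n <= X /\ t + 2 <= X by move: X_n3; clear; lia.
have mn := size_edges.
have [e1 e2] := et k km; set e := nth _ es k in e1 e2.
have vc1 : vcode e.1 <= n by exact: (ltn_ord e.1).
have vc2 : vcode e.2 <= n by exact: (ltn_ord e.2).
have tk : take k.+1 es = rcons (take k es) e by rewrite (take_nth (u0, u0)).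
have sE : sto h aSQ (vcode e.1 + vcode e.2) = (vcode e.1 + vcode e.2) ^ 2.
  by apply: tables_sq => //; exact: leq_add.
have ia := pair_index_small vc1 vc2; rewrite /pair_index in ia.
rewrite /= eM eI; split; [by []|lia|].
rewrite !e1 !e2 sE -/(pair_index _ _) -/(edge_index e.1 e.2).
split; first by rewrite /edge_index /pair_index; do !split=> //; lia.
  move=> D0; have Fe : F e.1 e.2 by rewrite -rt.
  do 2![split; first by do !split=> //; lia]; rewrite /= /upd /=; split; first by do !split=> //; lia.
  move=> ? ->; split=> //=; first by rewrite /upd /=; lia.
  by rewrite tk filter_rcons Fe flat_rcons ho ?e1 ?e2 !subn1.
move=> D0; have Fe : F e.1 e.2 = false by rewrite -rt D0.
split; first by do !split=> //; lia.
move=> ? ->; split=> //=; first by rewrite /upd /=; lia.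
by rewrite tk filter_rcons Fe.
Qed.

(** * Frames and specifications of the loop-free blocks *)

Definition frame (vars arrs : seq nat) (s s' : store) :=
  (forall y, y \notin vars -> s' 0 y = s 0 y) /\
  (forall c j, c != 0 -> c \notin arrs -> s' c j = s c j).

Lemma frame_trans v1 a1 v2 a2 s1 s2 s3 : frame v1 a1 s1 s2 -> frame v2 a2 s2 s3 ->
  frame (v1 ++ v2) (a1 ++ a2) s1 s3.
Proof.
move=> [fv1 fa1] [fv2 fa2]; split=> [y|c j c0]; rewrite mem_cat => /norP[n1 n2].
  by rewrite fv2 // fv1.
by rewrite fa2 // fa1.
Qed.

Lemma wpc_seqI c1 c2 Q h : wpc M c1 (wpc M c2 Q) h -> wpc M (CSeq c1 c2) Q h.
Proof. by []. Qed.

(** The continuation gets an arbitrary store with the listed properties, which keeps nested updates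
    out of the goals that follow. *)
Lemma wpc_unlink x y u v Q h : tables_upto (sto h) (n + n + 1) ->
  sto h 0 x = vcode u -> sto h 0 y = vcode v ->
  (forall s', frame [::] [:: aDG; aS; aR] (sto h) s' ->
     (forall z, z != u -> [/\ s' aDG (vcode z) = sto h aDG (vcode z),
        s' aS (vcode z) = sto h aS (vcode z) & s' aR (vcode z) = sto h aR (vcode z)]) ->
     [/\ s' aDG (vcode u) = sto h aDG (vcode u) - 1,
         s' aS (vcode u) = sto h aS (vcode u) - vcode v &
         s' aR (vcode u) = sto h aR (vcode u) - vcode v ^ 2] ->
     Q (HConf s' (hinp h) (hout h))) ->
  wpc M (c_unlink x y) Q h.
Proof.
move=> tb ex ey HQ.
have [nX tX] : n <= X /\ t + 2 <= X by move: X_n3; clear; lia.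
have sq : sto h aSQ (vcode v) = vcode v ^ 2.
  by apply: tables_sq => //; rewrite ltn_addr // ltn_ord.
rewrite /= /upd /= ex ey sq.
split=> //; first by split=> //; clear -nX tX; lia.
move=> ? ? -> ->; split=> // ? ? -> ->; split=> // ? ? -> ->.
rewrite /hset /= /upd /=; apply: HQ => /=; rewrite ?eqxx //.
- split=> [z|c j c0]; rewrite // !inE => /norP[/negbTE n1 /norP[/negbTE n2 /negbTE n3]].
  by rewrite /= n1 n2 n3.
- by move=> z zu; rewrite /= (_ : (vcode z == vcode u) = false) //; exact: negbTE.
Qed.

Lemma wpc_link x y u v Q h : tables_upto (sto h) (n + n + 1) ->
  sto h 0 x = vcode u -> sto h 0 y = vcode v ->
  sto h aDG (vcode u) <= X -> sto h aS (vcode u) <= X -> sto h aR (vcode u) <= X ->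
  (forall s', frame [::] [:: aDG; aS; aR] (sto h) s' ->
     (forall z, z != u -> [/\ s' aDG (vcode z) = sto h aDG (vcode z),
        s' aS (vcode z) = sto h aS (vcode z) & s' aR (vcode z) = sto h aR (vcode z)]) ->
     [/\ s' aDG (vcode u) = sto h aDG (vcode u) + 1,
         s' aS (vcode u) = sto h aS (vcode u) + vcode v &
         s' aR (vcode u) = sto h aR (vcode u) + vcode v ^ 2] ->
     Q (HConf s' (hinp h) (hout h))) ->
  wpc M (c_link x y) Q h.
Proof.
move=> tb ex ey bD bS bR HQ.
have [nX tX] : n <= X /\ t + 2 <= X by move: X_n3; clear; lia.
have vn : vcode v <= n by exact: ltn_ord.
have sq : sto h aSQ (vcode v) = vcode v ^ 2 by apply: tables_sq => //; rewrite (leq_trans vn) ?leq_addr.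
have bsq : vcode v ^ 2 <= 4 * X by apply: small_sq; rewrite (leq_trans vn) ?leq_addr.
rewrite /= /upd /= ex ey sq.
split=> //; first by split=> //; clear -nX tX bD; lia.
move=> ? ? -> ->; split=> //; first by split=> //; clear -nX vn bS; lia.
move=> ? ? -> ->; split=> //; first by split=> //; clear -bsq bR; lia.
move=> ? ? -> ->.
rewrite /hset /= /upd /=; apply: HQ => /=; rewrite ?eqxx //.
- split=> [z|c j c0]; rewrite // !inE => /norP[/negbTE n1 /norP[/negbTE n2 /negbTE n3]].
  by rewrite /= n1 n2 n3.
- by move=> z zu; rewrite /= (_ : (vcode z == vcode u) = false) //; exact: negbTE.
Qed.

Lemma wpc_push x u ord Q h : queue (sto h) ord -> size ord <= n -> sto h 0 x = vcode u ->
  sto h aDG (vcode u) <= X ->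
  (forall s', queue s' (ord ++ if sto h aDG (vcode u) == 2 then [:: u] else [::]) ->
     frame [:: vK] [:: aOR] (sto h) s' -> Q (HConf s' (hinp h) (hout h))) ->
  wpc M (c_push x) Q h.
Proof.
have [nX tX] : n <= X /\ t + 2 <= X by move: X_n3; clear; lia.
move=> [eK qs] so ex dX HQ; rewrite /= ex.
split; first by do !split=> //; lia.
  move=> d; case: h eK qs ex dX HQ d => s i o /= eK qs ex dX HQ d; apply: HQ => //.
  by rewrite ifF ?cats0 //; apply/eqP => E; rewrite E in d.
move=> d; split=> // ? ? -> ->; rewrite /= /upd /= eK; split; first by do !split=> //; lia.
move=> ? ->; rewrite /hset /= /upd /=; apply: HQ.
  have -> : sto h aDG (vcode u) == 2 by apply/eqP; lia.
  rewrite cats1; split; rewrite /= size_rcons ?addn1 // => j; rewrite ltnS leq_eqVlt nth_rcons.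
  case/orP=> [/eqP->|jo]; first by rewrite ltnn ?eqxx.
  by rewrite jo (ltn_eqF jo) qs.
split=> [y|c j c0]; rewrite !inE => /negbTE E; rewrite /= ?E //.
by rewrite (negbTE c0).
Qed.

Section Elim.
Variables (g : wgraph V) (w a b : V) (h : hconf).
Hypothesis gok : wgraph_ok g.
Hypothesis pab : nbr_pair g w a b.
Local Notation s := (sto h).
Local Notation p := (wp g).
Local Notation q := (wq g).

Lemma keep_oldC : keep_old t g w b a = keep_old t g w a b.
Proof. by have [_ _ [ps _] _ _] := gok; rewrite /keep_old series_qC ps. Qed.

Lemma use_seriesC : use_series t g w b a = use_series t g w a b.
Proof. by have [_ _ [_ qs] _ _] := gok; rewrite /use_series series_pC qs. Qed.

Definition weight_vars := [:: vX; vF; vP1; vQ1; vP2; vQ2; vP; vQ; vY; vSQ; vZ; vSP].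

Lemma wpc_weights Q : base s -> s 0 vW = vcode w -> s 0 vA = vcode a -> s 0 vB = vcode b ->
  s aNA (vcode w) = vcode a -> s aNB (vcode w) = vcode b ->
  s aP (edge_index w a) = p w a -> s aQ (edge_index w a) = q w a ->
  s aP (edge_index w b) = p w b -> s aQ (edge_index w b) = q w b ->
  p w a <= t.+2 -> q w a <= t.+1 -> p w b <= t.+2 -> q w b <= t.+1 ->
  (forall s' a1 b1, (a1 = a /\ b1 = b) \/ (a1 = b /\ b1 = a) ->
     p w a1 + q w b1 <= p w b1 + q w a1 ->
     s' aNA (vcode w) = vcode a1 -> s' aNB (vcode w) = vcode b1 ->
     (forall j, j != vcode w -> s' aNA j = s aNA j /\ s' aNB j = s aNB j) ->
     frame weight_vars [:: aNA; aNB] s s' ->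
     [/\ s' 0 vF = edge_index a b, s' 0 vP = s aP (edge_index a b),
         s' 0 vQ = s aQ (edge_index a b), s' 0 vSQ = series_q t g w a b
       & s' 0 vSP = series_p t g w a b] ->
     Q (HConf s' (hinp h) (hout h))) ->
  wpc M c_weights Q h.
Proof.
have [nX tX] : n <= X /\ t + 2 <= X by move: X_n3; clear; lia.
move=> [eN eT eM tb] eW eA eB ena enb P1 Q1 P2 Q2 bp1 bq1 bp2 bq2 HQ.
have wn : vcode w <= n by exact: (ltn_ord w).
have an : vcode a <= n by exact: (ltn_ord a).
have bn : vcode b <= n by exact: (ltn_ord b).
have sqE u v : u <= n -> v <= n -> s aSQ (u + v) = (u + v) ^ 2.
  by move=> un vn; apply: tables_sq => //; exact: leq_add.
have iab := pair_index_small an bn; have iwa := pair_index_small wn an.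
have iwb := pair_index_small wn bn.
rewrite /pair_index in iab iwa iwb.
(* The two branches of the swap would duplicate everything behind them; [Mid] is what they have in
   common. *)
pose Mid h1 := exists s1 a1 b1, [/\ h1 = HConf s1 (hinp h) (hout h),
  (a1 = a /\ b1 = b) \/ (a1 = b /\ b1 = a), p w a1 + q w b1 <= p w b1 + q w a1,
  [/\ s1 aNA (vcode w) = vcode a1, s1 aNB (vcode w) = vcode b1 &
    forall j, j != vcode w -> s1 aNA j = s aNA j /\ s1 aNB j = s aNB j]
  & [/\ frame weight_vars [:: aNA; aNB] s s1,
        [/\ s1 0 vF = edge_index a b, s1 0 vP = s aP (edge_index a b) & s1 0 vQ = s aQ (edge_index a b)],
        s1 0 vX = p w a + q w b /\ s1 0 vY = p w b + q w a &
        s1 0 vP1 = p w a /\ s1 0 vP2 = p w b]].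
apply: wpc_seqI; apply: (@wpc_mono _ _ Mid) => [h1|].
  case=> s1 [a1 [b1 [-> ab1 le1 [na nb nj] [[fv fa] [f1 p1 q1] [x1 y1] [pp1 pp2]]]]].
  have t1 : s1 0 vT = t by rewrite fv.
  rewrite /= /upd /= x1 y1 t1 pp1 pp2; split=> //; move=> ? ->.
  split; first by clear -tX; do !split=> //; lia.
  move=> ? ->; split; first by clear -tX bp1 bp2; do !split=> //; lia.
  move=> ? ->; split; first by clear -tX bp1 bp2; do !split=> //; lia.
  move=> ? ->; split; first by clear -tX bp1 bp2; do !split=> //; lia.
  move=> ? ->.
  rewrite /hset /= /upd /= -!minnE -!maxnE; apply: (HQ _ a1 b1) => //=.
  - split=> [y ny|c j c0 nc]; last by rewrite /= (negbTE c0) /= fa.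
    by rewrite /=; do ?[case: ifP => [/eqP E|_]; first by move: ny; rewrite E]; exact: fv.
  - by rewrite f1 p1 q1 /series_q /series_p addn1.
rewrite /= /upd /= eA eB eW !sqE //.
rewrite -/(pair_index (vcode a) (vcode b)) -/(edge_index a b).
rewrite -/(pair_index (vcode w) (vcode a)) -/(edge_index w a).
rewrite -/(pair_index (vcode w) (vcode b)) -/(edge_index w b).
rewrite -/(pair_index (vcode a) (vcode b)) -/(edge_index a b) in iab.
rewrite -/(pair_index (vcode w) (vcode a)) -/(edge_index w a) in iwa.
rewrite -/(pair_index (vcode w) (vcode b)) -/(edge_index w b) in iwb.
rewrite P1 Q1 P2 Q2.
do 5![split; first (by clear -nX iab iwa iwb wn an bn; do !split=> //; lia); move=> ? ->].
do 2![split=> //; move=> ? ->].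
do 2![split; first (by clear -tX bp1 bp2 bq1 bq2; do !split=> //; lia); move=> ? ->].
split; first by [].
- move=> lt; split=> // ? ? -> ->; split=> // ? ? -> ->.
  rewrite /Mid; eexists _, b, a; rewrite /hset /=; split; [reflexivity|by right|by move: lt; clear; lia| |].
    by split; rewrite /upd /= ?eqxx // => j jw; rewrite /= (negbTE jw).
  split=> //; split=> [y ny|c j c0 ny]; rewrite /upd /= ?(negbTE c0) /=.
    by do ?[case: ifP => [/eqP E|_]; first by move: ny; rewrite E].
  by move: ny; rewrite !inE => /norP[/negbTE-> /negbTE->].
move=> ge; rewrite /Mid; eexists _, a, b; rewrite /hset /=; split; [reflexivity|by left|by move: ge; clear; lia| |].
  by split=> /=; rewrite ?ena ?enb.
split=> //; split=> [y ny|c j c0 ny]; rewrite /upd /= ?(negbTE c0) //=.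
by do ?[case: ifP => [/eqP E|_]; first by move: ny; rewrite E].
Qed.

Lemma wpc_merge Q : s 0 vT = t -> s 0 vW = vcode w -> s 0 vP = p a b -> s 0 vQ = q a b ->
  s 0 vSQ = series_q t g w a b -> s 0 vSP = series_p t g w a b ->
  p a b <= t.+2 -> q a b <= t.+1 -> series_p t g w a b <= t.+2 -> s aCH (vcode w) = 0 ->
  (forall s', frame [:: vK1; vK2; vZ] [:: aCH] s s' ->
     (forall j, j != vcode w -> s' aCH j = s aCH j) ->
     (0 < s' aCH (vcode w)) = (use_series t g w a b < keep_old t g w a b) ->
     s' 0 vZ = minn (keep_old t g w a b) (use_series t g w a b) ->
     Q (HConf s' (hinp h) (hout h))) ->
  wpc M c_merge Q h.
Proof.
have [nX tX] : n <= X /\ t + 2 <= X by move: X_n3; clear; lia.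
have sqt : series_q t g w a b <= t.+1 by exact: geq_minl.
move=> eT eW eP eQ eSQ eSP bp bq bsp ech HQ.
(* The last comparison is reached from four combinations of the two tests before it. *)
have last_if (s1 : store) : s1 0 vK1 = keep_old t g w a b -> s1 0 vK2 = use_series t g w a b ->
    s1 0 vW = vcode w -> s1 aCH (vcode w) = 0 -> frame [:: vK1; vK2] [::] s s1 ->
    wpc M (CIf ($vK1 :- $vK2) (CStore aCH ($vW) (#1) ;; vZ ::= $vK2) (vZ ::= $vK1)) Q
      (HConf s1 (hinp h) (hout h)).
  move=> k1 k2 w1 c1 [fv fa]; rewrite /= k1 k2 w1; split=> //.
    move=> lt; split=> //; first by lia.
    move=> ? ? -> ->; rewrite /= /upd /= k2; split=> //.
    move=> ? ->; rewrite /hset /= /upd /=; apply: HQ.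
    - split=> [y|c j c0]; rewrite !inE => ny; rewrite /=.
        by rewrite (_ : (y == vZ) = false) ?fv //; move: ny; rewrite ?inE; lia.
      by rewrite (negbTE c0) (negbTE ny) fa.
    - by move=> j jw; rewrite /= (negbTE jw) fa.
    - by rewrite /= eqxx; move: lt; clear; lia.
    - by rewrite /=; move: lt; clear; lia.
  move=> ge; split=> // ? ->; rewrite /hset /= /upd /=; apply: HQ.
  - split=> [y|c j c0]; rewrite !inE => ny; rewrite /=.
      by rewrite (_ : (y == vZ) = false) ?fv //; move: ny; rewrite ?inE; lia.
    by rewrite (negbTE c0) fa.
  - by move=> j jw; rewrite /= fa.
  - by rewrite /= c1; move: ge; clear; lia.
  - by rewrite /=; move: ge; clear; lia.
rewrite /= eT eP eSQ; split; first by do !split=> //; lia.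
  move=> k1; split=> // ? ->; rewrite /= /upd /= eT eSP eQ; split; first by do !split=> //; lia.
    move=> k2; split=> // ? ->; apply: last_if; rewrite //= /upd /= ?eP ?eSP //.
    - by rewrite /keep_old ifT //; move: k1; clear; lia.
    - by rewrite /use_series ifT //; move: k2; clear; lia.
    - by split=> [y|c j c0 _]; rewrite /= ?(negbTE c0) // !inE => /norP[/negbTE-> /negbTE->].
  move=> k2; split; first by do !split=> //; lia.
  move=> ? ->; apply: last_if; rewrite //= /upd /= ?eP //.
  - by rewrite /keep_old ifT //; move: k1; clear; lia.
  - by rewrite /use_series ifF ?eT ?addn2 //; move: k2; clear; lia.
  - by split=> [y|c j c0 _]; rewrite /= ?(negbTE c0) // !inE => /norP[/negbTE-> /negbTE->].
move=> k1; split; first by do !split=> //; lia.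
move=> ? ->; rewrite /= /upd /= eT eSP eQ; split; first by do !split=> //; lia.
  move=> k2; split=> // ? ->; apply: last_if; rewrite //= /upd /= ?eP ?eSP //.
  - by rewrite /keep_old ifF ?addn2 //; move: k1; clear; lia.
  - by rewrite /use_series ifT //; move: k2; clear; lia.
  - by split=> [y|c j c0 _]; rewrite /= ?(negbTE c0) // !inE => /norP[/negbTE-> /negbTE->].
move=> k2; split; first by do !split=> //; lia.
move=> ? ->; apply: last_if; rewrite //= /upd /= ?eP //.
- by rewrite /keep_old ifF ?addn2 //; move: k1; clear; lia.
- by rewrite /use_series ifF ?eT ?addn2 //; move: k2; clear; lia.
- by split=> [y|c j c0 _]; rewrite /= ?(negbTE c0) // !inE => /norP[/negbTE-> /negbTE->].
Qed.
End Elim.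

Definition rep (s : store) (g : wgraph V) :=
  (forall u, live g u ->
     [/\ s aDG (vcode u) = \sum_(v | wadj g u v) 1,
         s aS (vcode u) = \sum_(v | wadj g u v) vcode v &
         s aR (vcode u) = \sum_(v | wadj g u v) vcode v ^ 2]) /\
  (forall u v, live g u -> live g v ->
     s aP (edge_index u v) = (if wadj g u v then wp g u v else 0) /\
     s aQ (edge_index u v) = wq g u v).

(** The queue is the elimination order at the same time: its first [k] entries are the dead
    vertices, and every live vertex of low degree waits behind them. *)
Definition queue_inv (g : wgraph V) (ord : seq V) k :=
  [/\ uniq ord, forall u, (u \in take k ord) = ~~ live g u
    & forall u, live g u -> (u \in ord) = (#|wadj g u| <= 2)].

(** [aCH] is still 0 at live vertices, so a step only ever has to set the mark. *)
Definition elim_state k (g : wgraph V) ord (ok : bool) (h : hconf) : Prop :=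
  [/\ base (sto h), sto h 0 vI = k /\ sto h 0 vOK = ok, hout h = [::], edge_table (sto h) m
    & [/\ elim_inv t (unit_wgraph G) g [seq step_of (sto h) u | u <- take k ord] ok,
          rep (sto h) g, queue (sto h) ord, queue_inv g ord k
        & [/\ forall u, sto h aNA (vcode u) <= n /\ sto h aNB (vcode u) <= n,
              forall u, live g u -> sto h aCH (vcode u) = 0 & forall j, sto h aD j = 0]]].

Definition inv_elim k h := exists g ord ok, elim_state k g ord ok h.

(** * One elimination step of the program *)

Section Step.
Variables (k : nat) (g : wgraph V) (ord : seq V) (ok : bool) (h : hconf).
Hypothesis kn : k < n.
Hypothesis st : elim_state k g ord ok h.
Local Notation s := (sto h).
Local Notation w := (nth u0 ord k).
Local Notation g' := (eliminate_vertex t g w).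

(** If the queue were exhausted, all vertices of low degree would be dead; but without a K4 minor, a
    graph with a live vertex has a live one of degree at most 2. *)
Lemma next_vertex : [/\ k < size ord, live g w, #|wadj g w| <= 2 & w \notin take k ord].
Proof.
have [_ _ _ _ [[gok nK _ _] _ _ [U dead low] _]] := st.
have [u Lu] : exists u, live g u.
  apply: contrapT => nL; have : {subset enum 'I_n <= take k ord}.
    by move=> u _; rewrite dead; apply/negP => Lu; apply: nL; exists u.
  move/(uniq_leq_size (enum_uniq _)); rewrite size_enum_ord size_take_min.
  by move=> /leq_trans/(_ (geq_minl _ _)); rewrite leqNgt kn.
have [[Hs Hi] HL _ _ _] := gok.
have [v Lv dv] := K4_minor_free_low_degree Hs Hi HL nK Lu.
have ks : k < size ord.
  rewrite ltnNge; apply/negP => sk; have := low v Lv; rewrite dv => vo.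
  by have := dead v; rewrite take_oversize // vo Lv.
have wnt : w \notin take k ord.
  apply/negP => /(nthP u0)[j]; rewrite size_take ks => jk /eqP.
  by rewrite nth_take // nth_uniq ?(ltn_trans jk) // (ltn_eqF jk).
have Lw : live g w by move: wnt; rewrite dead negbK.
by split=> //; rewrite -low // mem_nth.
Qed.

(** Shared by the steps with no, one and two neighbours; [r] lists the vertices that have just been
    queued. *)
Lemma elim_state_step s' (ok' : bool) r ip :
  base s' -> s' 0 vI = k.+1 /\ s' 0 vOK = ok' -> edge_table s' m ->
  (forall u, u != w -> [/\ s' aNA (vcode u) = s aNA (vcode u),
     s' aNB (vcode u) = s aNB (vcode u) & s' aCH (vcode u) = s aCH (vcode u)]) ->
  s' aNA (vcode w) <= n -> s' aNB (vcode w) <= n ->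
  valid_step t g (step_of s' w) ok ok' ->
  (forall u, live g u -> u != w ->
     [/\ s' aDG (vcode u) = \sum_(v | eliminate (wadj g) w u v) 1,
         s' aS (vcode u) = \sum_(v | eliminate (wadj g) w u v) vcode v &
         s' aR (vcode u) = \sum_(v | eliminate (wadj g) w u v) vcode v ^ 2]) ->
  (forall u v, live g u -> live g v -> u != w -> v != w ->
     s' aP (edge_index u v) =
       (if nbr_pair g w u v then new_p t g w u v else s aP (edge_index u v)) /\
     s' aQ (edge_index u v) =
       (if nbr_pair g w u v then new_q t g w u v else s aQ (edge_index u v))) ->
  queue s' (ord ++ r) -> uniq r ->
  (forall u, u \in r -> [/\ live g u, u != w & u \notin ord]) ->
  (forall u, live g u -> u != w ->
     (u \in ord ++ r) = (\sum_(v | eliminate (wadj g) w u v) 1 <= 2)) ->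
  (forall j, s' aD j = 0) ->
  inv_elim k.+1 (HConf s' ip [::]).
Proof.
move=> bs [eI eok] et fr na nb vs sums pq qu Ur rP low' d0.
have [_ _ _ _ [ei [_ rp2] _ [U dead low] [nab ch0 _]]] := st.
have [ks Lw dw wnt] := next_vertex.
have tk : take k.+1 (ord ++ r) = rcons (take k ord) w.
  by rewrite takel_cat // (take_nth u0).
exists g', (ord ++ r), ok'; split=> //=; split=> //.
- rewrite tk map_rcons; have -> : [seq step_of s' u | u <- take k ord] =
      [seq step_of s u | u <- take k ord].
    apply/eq_in_map => u ut; rewrite /step_of.
    by have [|-> -> ->] := fr u => //; apply: contraNneq wnt => <-.
  exact: (@elim_inv_step _ t (unit_wgraph G) g _ ok (step_of s' w) ok' ei Lw dw vs).
- split=> /= [u /andP[uw Lu]|u v /andP[uw Lu] /andP[vw Lv]]; first exact: sums.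
  have [-> ->] := pq u v Lu Lv uw vw; have [pE qE] := rp2 u v Lu Lv.
  rewrite /eliminate /= uw vw /= -/(nbr_pair g w u v).
  case: ifP => [puv|npuv]; first by rewrite orbT.
  by rewrite orbF pE qE /new_p /new_q npuv.
- split.
  + rewrite cat_uniq U Ur andbT /=; apply/hasPn => u /rP[_ _ nu]; exact: nu.
  + move=> u; rewrite tk mem_rcons inE dead /= negb_and negbK.
    by [].
  + by move=> u /= /andP[uw Lu]; rewrite low' // sum1_card.
- split=> // u.
    by have [->|/fr[-> -> _]] := eqVneq u w; [split|exact: nab].
  by move=> /= /andP[uw Lu]; have [_ _ ->] := fr u uw; exact: ch0.
Qed.

Lemma wpc_decode Q : (forall s' oa ob, ocode vcode ob <= ocode vcode oa -> ocode vcode oa <= n ->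
     match oa, ob return Prop with
      | None, None => forall x, ~~ wadj g w x
      | Some a, None => wadj g w a /\ forall x, wadj g w x -> x = a
      | Some a, Some b => [&& a != b, wadj g w a & wadj g w b]
      | None, Some _ => False
      end ->
     s' 0 vW = vcode w -> s' 0 vA = ocode vcode oa -> s' 0 vB = ocode vcode ob ->
     s' aNA (vcode w) = ocode vcode oa -> s' aNB (vcode w) = ocode vcode ob ->
     (forall j, j != vcode w -> s' aNA j = s aNA j /\ s' aNB j = s aNB j) ->
     frame [:: vW; vS; vA; vB] [:: aNA; aNB] s s' -> Q (HConf s' (hinp h) (hout h))) ->
  wpc M c_decode Q h.
Proof.
move=> HQ; have [[eN eT eM tb] [eI eok] ho et [_ [rp1 _] [eK qs] _ _]] := st.
have [ks Lw dw wnt] := next_vertex.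
have [nX tX] : n <= X /\ t + 2 <= X by move: X_n3; clear; lia.
have [oa [ob [le sE rE cs]]] := @low_degree_decode _ vcode (wadj g) w dw.
have oan : ocode vcode oa <= n by case: (oa) => //= u; exact: (ltn_ord u).
have [_ SE RE] := rp1 w Lw; rewrite sE in SE; rewrite rE in RE.
have [_ _ bR] := sum_bound (wadj g) w; rewrite rE in bR.
set A := ocode vcode oa in le oan SE RE bR HQ *; set B := ocode vcode ob in le SE RE bR HQ *.
have sq : s aSQ (A + B) = (A + B) ^ 2 by apply: tables_sq => //; clear -le oan; lia.
have rt : s aRT ((A - B) ^ 2) = A - B.
  by have [|_ ->] := tb (A - B); first by clear -oan; lia.
have hf : s aHF (A + A) = A by have [|_ _ ->] := tb A; first by clear -oan; lia.
have sum2 : A + B + (A - B) = A + A by clear -le; lia.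
rewrite /= /upd /= eI qs //.
split=> // ? ->; rewrite SE; split=> // ? ->; rewrite RE sq decode_difference // rt sum2 hf.
split; first by (clear -nX oan le bR; do !split=> //; lia).
move=> ? ->; rewrite addKn; split=> // ? ->; split=> // ? ? -> ->; split=> // ? ? -> ->.
rewrite /hset /= /upd /=; apply: (HQ _ oa ob) => //=; rewrite ?eqxx //.
- by move=> j jw; rewrite (negbTE jw).
- split=> [y|c j c0]; rewrite !inE => ny; rewrite /= ?(negbTE c0) /=.
    by move: ny => /norP[/negbTE-> /norP[/negbTE-> /norP[/negbTE-> /negbTE->]]].
  by move: ny => /norP[/negbTE-> /negbTE->].
Qed.

Lemma finish_step s' (ok' : bool) r ip :
  base s' -> s' 0 vI = k -> s' 0 vOK = ok' -> edge_table s' m ->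
  (forall u, u != w -> [/\ s' aNA (vcode u) = s aNA (vcode u),
     s' aNB (vcode u) = s aNB (vcode u) & s' aCH (vcode u) = s aCH (vcode u)]) ->
  s' aNA (vcode w) <= n -> s' aNB (vcode w) <= n ->
  valid_step t g (step_of s' w) ok ok' ->
  (forall u, live g u -> u != w ->
     [/\ s' aDG (vcode u) = \sum_(v | eliminate (wadj g) w u v) 1,
         s' aS (vcode u) = \sum_(v | eliminate (wadj g) w u v) vcode v &
         s' aR (vcode u) = \sum_(v | eliminate (wadj g) w u v) vcode v ^ 2]) ->
  (forall u v, live g u -> live g v -> u != w -> v != w ->
     s' aP (edge_index u v) =
       (if nbr_pair g w u v then new_p t g w u v else s aP (edge_index u v)) /\
     s' aQ (edge_index u v) =
       (if nbr_pair g w u v then new_q t g w u v else s aQ (edge_index u v))) ->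
  queue s' (ord ++ r) -> uniq r ->
  (forall u, u \in r -> [/\ live g u, u != w & u \notin ord]) ->
  (forall u, live g u -> u != w ->
     (u \in ord ++ r) = (\sum_(v | eliminate (wadj g) w u v) 1 <= 2)) ->
  (forall j, s' aD j = 0) ->
  wpc M (vI ::= $vI :+ #1) (inv_elim k.+1) (HConf s' ip [::]).
Proof.
move=> bs eI eok et fr na nb vs sums pq qu Ur rP low' d0.
have [nX tX] : n <= X /\ t + 2 <= X by move: X_n3; clear; lia.
rewrite /= eI; split; first by split=> //; clear -nX tX kn; lia.
move=> ? ->; rewrite /hset /= addn1.
exact: (@elim_state_step (upd s' 0 vI k.+1) ok' r).
Qed.

(** For a vertex that has lost one neighbour: if it is low now, it was queued before or is queued at
    this moment. *)
Lemma low_after_unlink (D D' : nat) (c : bool) : c = (D <= 2) -> D = 1 + D' ->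
  c || (D' == 2) = (D' <= 2).
Proof. by move=> -> ->; clear; lia. Qed.

Lemma base_frame vs ar (s1 s2 : store) : frame vs ar s1 s2 -> base s1 ->
  [&& vN \notin vs, vT \notin vs & vM \notin vs] ->
  [&& aSQ \notin ar, aRT \notin ar & aHF \notin ar] -> base s2.
Proof.
move=> [fv fa] [eN eT eM tb] /and3P[n1 n2 n3] /and3P[m1 m2 m3].
by split; rewrite ?fv // => j jn; rewrite !fa //; exact: tb.
Qed.

Lemma run_step : wpc M c_eliminate (inv_elim k.+1) h.
Proof.
have [nX tX] : n <= X /\ t + 2 <= X by move: X_n3; clear; lia.
have [bs [eI eok] ho et [[gok nK bw _] [rp1 rp2] qu [U dead low] [nab ch0 d0]]] := st.
have [ks Lw dw wnt] := next_vertex.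
have [[Hs Hi] HL [ps qs] q0 _] := gok.
have Ln u : wadj g w u -> live g u by move=> wu; apply: (HL u w); rewrite Hs.
have lowE u : live g u -> (u \in ord) = (\sum_(v | wadj g u v) 1 <= 2).
  by move=> Lu; rewrite low // sum1_card.
have so : size ord <= n by rewrite -[X in _ <= X]card_ord -(card_uniqP U) max_card.
have vI' u v : (vcode u == vcode v) = (u == v) by [].
have bS u := sum_bound (wadj g) u.
apply: wpc_seqI; apply: (@wpc_decode) => s1 oa ob le oan cs eW eA eB na nb nj f1.
have [fv1 fa1] := f1.
have bs1 : base s1 by apply: (base_frame f1).
have et1 : edge_table s1 m by move=> j jm; rewrite !fa1 //; exact: et.
have qu1 : queue s1 ord by case: qu => eK qq; split=> [|j jo]; rewrite ?fv1 ?fa1 ?qq.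
have [_ eT1 _ tb1] := bs1.
case: oa ob cs le oan eA eB na nb => [a|] [b|] cs le oan eA eB na nb; [| |by case: cs|].
all: revgoals.
- apply: wpc_seqI; split=> [//|H|_]; first by exfalso; move: H; rewrite /= eA.
  change (wpc M (vI ::= $vI :+ #1) (inv_elim k.+1) (HConf s1 (hinp h) (hout h))).
  have npair u v : nbr_pair g w u v = false by rewrite /nbr_pair (negbTE (cs u)) andbF.
  rewrite ho; apply: (@finish_step s1 ok [::]).
  + exact: bs1.
  + by rewrite fv1.
  + by rewrite fv1.
  + exact: et1.
  + by move=> u uw; have [|-> ->] := nj (vcode u); rewrite ?vI' // fa1.
  + by rewrite na.
  + by rewrite nb.
  + by rewrite /valid_step /step_of /= na nb.
  + move=> u Lu uw; rewrite !fa1 // !sum_other //; exact: rp1.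
  + by move=> u v _ _ _ _; rewrite npair !fa1.
  + by rewrite cats0.
  + by [].
  + by [].
  + by move=> u Lu uw; rewrite cats0 sum_other // lowE.
  + by move=> j; rewrite fa1.
- have [wa only] := cs; have La := Ln a wa.
  have aw : a != w by rewrite eq_sym (wadj_neq gok wa).
  have npair u v : nbr_pair g w u v = false.
    by apply/negP => /and3P[uv /only ua /only va]; rewrite ua va eqxx in uv.
  have [d_a s_a r_a] := rp1 a La; have [bd bs_ br] := bS a.
  have [pe qe] := rp2 w a Lw La; rewrite wa in pe.
  have [/andP[p0 p1] _] := bw _ _ wa.
  apply: wpc_seqI; split=> [//|_|H]; last by exfalso; move: H; rewrite /= eA.
  split=> [//|H|_]; first by exfalso; move: H; rewrite /= eB.
  apply: wpc_seqI; apply: (@wpc_unlink _ _ a w) => // s2 f2 o2 [e21 e22 e23].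
  rewrite /= in f2 e21 e22 e23 o2.
  have f12 := frame_trans f1 f2; have [fv2 fa2] := f2; have [fv12 fa12] := f12.
  have S2 (f : V -> nat) : \sum_(v | eliminate (wadj g) w a v) f v = \sum_(v | wadj g a v) f v - f w.
    rewrite (sum_nbr_split f gok wa) addKn; apply: sum_nbr_keep => // b; by rewrite npair.
  have D2 : s2 aDG (vcode a) = \sum_(v | eliminate (wadj g) w a v) 1.
    by rewrite e21 fa1 // d_a S2.
  have qu2 : queue s2 ord by case: qu1 => eK qq; split=> [|j jo]; rewrite ?fv2 ?fa2 ?qq.
  apply: wpc_seqI; apply: (@wpc_push _ a ord) => //.
  + by rewrite /= fv2.
  + by rewrite /= e21 fa1 // d_a (leq_trans (leq_subr _ _)).
  move=> s3 qu3 f3; rewrite /= in qu3 f3; have f13 := frame_trans f12 f3; have [fv3 fa3] := f3; have [fv13 fa13] := f13.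
  have bs3 : base s3 by apply: (base_frame f13).
  have [_ eT3 _ tb3] := bs3.
  have an : vcode a <= n by exact: (ltn_ord a).
  have wn : vcode w <= n by exact: (ltn_ord w).
  have eW3 : s3 0 vW = vcode w by rewrite fv3 // fv2.
  have eA3 : s3 0 vA = vcode a by rewrite fv3 // fv2.
  have sq3 : s3 aSQ (vcode w + vcode a) = (vcode w + vcode a) ^ 2.
    by apply: tables_sq => //; exact: leq_add.
  have idx := pair_index_small wn an.
  pose ok' := ok && (wp g w a <= t.+1).
  (* The branches that clear [vOK] or leave it end in the same way. *)
  have fin s4 : frame [:: vOK] [::] s3 s4 -> s4 0 vOK = ok' ->
      wpc M (vI ::= $vI :+ #1) (inv_elim k.+1) (HConf s4 (hinp h) (hout h)).
    move=> f4 eok4; have f14 := frame_trans f13 f4; have [fv4 fa4] := f4; have [fv14 fa14] := f14.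
    rewrite ho; apply: (@finish_step s4 ok' (if s2 aDG (vcode a) == 2 then [:: a] else [::])).
    + exact: (base_frame f14).
    + by rewrite fv14.
    + exact: eok4.
    + by move=> j jm; rewrite !fa14 //; exact: et.
    + move=> u uw; have [|E1 E2] := nj (vcode u); first by rewrite vI'.
      by rewrite !fa4 // !fa3 // !fa2 // E1 E2 fa1.
    + by rewrite fa4 // fa3 // fa2 // na.
    + by rewrite fa4 // fa3 // fa2 // nb.
    + by rewrite /valid_step /step_of /= !fa4 // !fa3 // !fa2 // na nb /= valK.
    + move=> u Lu uw; rewrite !fa4 // !fa3 //.
      have [->|ua] := eqVneq u a; first by rewrite D2 e22 e23 !fa1 // s_a r_a !S2.
      have nwu : ~~ wadj g w u by apply: contra ua => /only ->.
      have [-> -> ->] := o2 u ua; rewrite !fa1 // !sum_other //; exact: rp1.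
    + by move=> u v _ _ _ _; rewrite npair !fa14.
    + by case: qu3 => eK qq; split=> [|j jo]; rewrite ?fv4 ?fa4 ?qq.
    + by case: ifP.
    + move=> u; case: ifP => // d2; rewrite inE => /eqP->; split=> //.
      rewrite lowE // (sum_nbr_split (fun=> 1) gok wa) -ltnNge.
      by move: d2; rewrite D2 S2 (sum_nbr_split (fun=> 1) gok wa) addKn => /eqP->.
    + move=> u Lu uw; rewrite mem_cat lowE //.
      have [->|ua] := eqVneq u a.
        rewrite D2 -[X in X = _]/(_ || _) (_ : (a \in _) = (\sum_(v | eliminate (wadj g) w a v) 1 == 2)); last first.
          by case: ifP; rewrite ?inE ?eqxx.
        apply: low_after_unlink => //; rewrite S2.
        by rewrite (sum_nbr_split (fun=> 1) gok wa) addKn.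
      rewrite (_ : (u \in _) = false); last by case: ifP => // _; rewrite inE (negbTE ua).
      by rewrite orbF sum_other //; apply: contra ua => /only ->.
    + by move=> j; rewrite fa14.
  have ev : eval s3 (aP{[EIdx ($vW) ($vA)]} :- ($vT :+ #1)) = wp g w a - t.+1.
    by rewrite /= eW3 eA3 sq3 -/(pair_index _ _) -/(edge_index w a) eT3 addn1 fa13 // pe.
  split.
  + rewrite /pair_index in idx; rewrite /= eW3 eA3 sq3 eT3.
    by do !split=> //; clear -nX tX idx wn an; lia.
  + move=> gt; have {}gt : 0 < wp g w a - t.+1 by rewrite -ev; exact: gt.
    split=> // v vE; apply: (fin (upd s3 0 vOK v)).
      by split=> [y|c j c0 _]; rewrite /upd ?inE /= ?(negbTE c0) // => /negbTE->.
    rewrite vE /upd /= /ok' (_ : (wp g w a <= t.+1) = false) ?andbF //.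
    by move: gt; clear; lia.
  + move=> le'; have {}le' : wp g w a - t.+1 = 0 by rewrite -ev; exact: le'.
    change (wpc M (vI ::= $vI :+ #1) (inv_elim k.+1) (HConf s3 (hinp h) (hout h))).
    apply: (fin s3); first by split.
    rewrite fv13 // eok /ok' (_ : (wp g w a <= t.+1) = true) ?andbT //.
    by move: le'; clear; lia.
have pab : nbr_pair g w a b by exact: cs.
have /and3P[nab' wa wb] := pab; have La := Ln a wa; have Lb := Ln b wb.
have [aw bw'] := nbr_pair_neq gok pab.
have pba : nbr_pair g w b a by rewrite nbr_pairC.
have [d_a s_a r_a] := rp1 a La; have [bd_a bs_a br_a] := bS a.
have [d_b s_b r_b] := rp1 b Lb; have [bd_b bs_b br_b] := bS b.
have [pea qea] := rp2 w a Lw La; rewrite wa in pea.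
have [peb qeb] := rp2 w b Lw Lb; rewrite wb in peb.
have [peab qeab] := rp2 a b La Lb.
have [/andP[pa0 pa1] qa1] := bw _ _ wa; have [/andP[pb0 pb1] qb1] := bw _ _ wb.
have bsp : 0 < series_p t g w a b <= t.+2.
  by rewrite /series_p; clear -pa0 pa1 pb0 pb1; lia.
have bsq : series_q t g w a b <= t.+1 by exact: geq_minl.
apply: wpc_seqI; split=> [//|_|H]; last by exfalso; move: H; rewrite /= eA.
split=> [//|_|H]; last by exfalso; move: H; rewrite /= eB.
apply: wpc_seqI; apply: (@wpc_weights g w a b) => //; try by rewrite /= fa1 // ?pea ?qea ?peb ?qeb.
move=> s2 a1 b1 ab1 le1 na2 nb2 nj2 f2 [eF eP eQ eSQ eSP]; rewrite /= in f2 nj2.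
rewrite /= fa1 // peab in eP; rewrite /= fa1 // qeab in eQ.
have f12 := frame_trans f1 f2; have [fv2 fa2] := f2; have [fv12 fa12] := f12.
have bs2 : base s2 by apply: (base_frame f12).
have [_ eT2 _ tb2] := bs2.
apply: wpc_seqI; apply: (@wpc_unlink _ _ a w) => //; [by rewrite /= fv2|by rewrite /= fv2|].
move=> s3 f3 o3 [e31 e32 e33]; rewrite /= in f3 e31 e32 e33 o3.
have [fv3 fa3] := f3; have [_ _ _ tb3] : base s3 by apply: (base_frame f3).
apply: wpc_seqI; apply: (@wpc_unlink _ _ b w) => //; [by rewrite /= fv3 // fv2|by rewrite /= fv3 // fv2|].
move=> s4 f4 o4 [e41 e42 e43]; rewrite /= in f4 e41 e42 e43 o4.
have f34 := frame_trans f3 f4; have [fv4 fa4] := f4; have [fv34 fa34] := f34.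
have bs4 : base s4 by apply: (base_frame f34).
have [_ eT4 _ tb4] := bs4.
have SP x (f : V -> nat) : wadj g w x -> \sum_(v | wadj g x v) f v - f w =
    \sum_(v | wadj g x v && (v != w)) f v.
  by move=> wx; rewrite (sum_nbr_split f gok wx) addKn.
have [D4a S4a R4a] : [/\ s4 aDG (vcode a) = \sum_(v | wadj g a v && (v != w)) 1,
    s4 aS (vcode a) = \sum_(v | wadj g a v && (v != w)) vcode v &
    s4 aR (vcode a) = \sum_(v | wadj g a v && (v != w)) vcode v ^ 2].
  have [-> -> ->] := o4 a nab'; rewrite e31 e32 e33 !fa2 // !fa1 // d_a s_a r_a.
  by rewrite !SP.
have [D4b S4b R4b] : [/\ s4 aDG (vcode b) = \sum_(v | wadj g b v && (v != w)) 1,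
    s4 aS (vcode b) = \sum_(v | wadj g b v && (v != w)) vcode v &
    s4 aR (vcode b) = \sum_(v | wadj g b v && (v != w)) vcode v ^ 2].
  have [|E1 E2 E3] := o3 b; first by rewrite eq_sym.
  rewrite e41 e42 e43 E1 E2 E3 !fa2 // !fa1 // d_b s_b r_b.
  by rewrite !SP.
have oth u : u != a -> u != b -> [/\ s4 aDG (vcode u) = s aDG (vcode u),
    s4 aS (vcode u) = s aS (vcode u) & s4 aR (vcode u) = s aR (vcode u)].
  move=> ua ub; have [-> -> ->] := o4 u ub; have [-> -> ->] := o3 u ua.
  by rewrite !fa2 // !fa1.
have onlyab u : wadj g w u -> u = a \/ u = b by exact: nbr_pair_third.
have notnbr u : u != a -> u != b -> ~~ wadj g w u.
  by move=> ua ub; apply/negP => /onlyab[]E; rewrite E eqxx in ua ub.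
have qu4 : queue s4 ord.
  by case: qu1 => eK qq; split=> [|j jo]; rewrite ?fv34 ?fa34 ?fv2 ?fa2 ?qq.
(* Whether or not the neighbours are adjacent, the step ends by writing the new weights; [fin] does
   this once for any store that differs from [s4] only in the permitted places. *)
have fin (s7 : store) r vs ar z (ser : bool) : frame vs ar s4 s7 ->
    all (fun y => y \in [:: vK; vK1; vK2; vZ]) vs ->
    all (fun c => c \in [:: aOR; aCH; aDG; aS; aR]) ar ->
    s7 0 vZ = z -> z = new_p t g w a b -> z <= M ->
    (forall j, j != vcode w -> s7 aCH j = s4 aCH j) ->
    (0 < s7 aCH (vcode w)) = ser ->
    ser = ~~ wadj g a b || (use_series t g w a b < keep_old t g w a b) ->
    (forall u, live g u -> u != w ->
     [/\ s7 aDG (vcode u) = \sum_(v | eliminate (wadj g) w u v) 1,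
         s7 aS (vcode u) = \sum_(v | eliminate (wadj g) w u v) vcode v &
         s7 aR (vcode u) = \sum_(v | eliminate (wadj g) w u v) vcode v ^ 2]) ->
    queue s7 (ord ++ r) -> uniq r ->
    (forall u, u \in r -> [/\ live g u, u != w & u \notin ord]) ->
    (forall u, live g u -> u != w ->
     (u \in ord ++ r) = (\sum_(v | eliminate (wadj g) w u v) 1 <= 2)) ->
    wpc M (CStore aP ($vF) ($vZ) ;; CStore aQ ($vF) ($vQ :+ ($vSQ :- $vQ)))
      (wpc M (vI ::= $vI :+ #1) (inv_elim k.+1)) (HConf s7 (hinp h) (hout h)).
  move=> f7 vsP arP ez zE zM chj chw serE sums qu7 Ur rP low7.
  have [fv7 fa7] := f7.
  have nvs y : y \notin [:: vK; vK1; vK2; vZ] -> y \notin vs.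
    by apply: contra => /(allP vsP).
  have nar c : c \notin [:: aOR; aCH; aDG; aS; aR] -> c \notin ar.
    by apply: contra => /(allP arP).
  have eF7 : s7 0 vF = edge_index a b by rewrite fv7 ?nvs // fv34.
  have eQ7 : s7 0 vQ = wq g a b by rewrite fv7 ?nvs // fv34.
  have eSQ7 : s7 0 vSQ = series_q t g w a b by rewrite fv7 ?nvs // fv34.
  have qab : wq g a b <= t.+1.
    by have [/bw[]//|/(q0 _ _ La Lb)->//] := boolP (wadj g a b).
  apply: wpc_seqI; split=> // i1 v1 iE vE; split=> //.
    by split=> //=; rewrite /upd /= eQ7 eSQ7; clear -qab bsq tX; lia.
  move=> i2 v2 iE2 vE2; rewrite /= eF7 in iE; rewrite /= ez in vE.
  rewrite /= /upd /= eF7 in iE2; rewrite /= /upd /= eQ7 eSQ7 -maxnE in vE2.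
  rewrite iE vE iE2 vE2.
  pose s8 := upd (upd s7 aP (edge_index a b) z) aQ (edge_index a b)
    (maxn (wq g a b) (series_q t g w a b)).
  have fa8 c j : c != aP -> c != aQ -> s8 c j = s7 c j.
    by move=> c1 c2; rewrite /s8 /upd (negbTE c2) /= (negbTE c1).
  have fr8 c j : c != 0 -> c \notin [:: aOR; aCH; aDG; aS; aR; aP; aQ; aNA; aNB] -> s8 c j = s c j.
    rewrite !inE !negb_or => c0 /and5P[n1 n2 n3 n4 /and5P[n5 n6 n7 n8 n9]].
    rewrite fa8 // fa7 ?nar // ?inE ?negb_or ?n1 ?n2 ?n3 ?n4 //.
    by rewrite fa34 ?inE ?negb_or ?n3 ?n4 ?n5 // fa12 // !inE !negb_or n8 n9.
  have na8 j : s8 aNA j = s2 aNA j by rewrite fa8 // fa7 ?nar // fa34.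
  have nb8 j : s8 aNB j = s2 aNB j by rewrite fa8 // fa7 ?nar // fa34.
  have fv8 y : y \notin [:: vK; vK1; vK2; vZ] -> y \notin weight_vars ->
      y \notin [:: vW; vS; vA; vB] -> s8 0 y = s 0 y.
    by move=> y1 y2 y3; rewrite fa8 // fv7 ?nvs // fv34 // fv2 // fv1.
  have a1n : vcode a1 <= n by exact: (ltn_ord a1).
  have b1n : vcode b1 <= n by exact: (ltn_ord b1).
  rewrite ho; apply: (@finish_step s8 ok r (hinp h)).
  + case: bs => eN eT eM tb; split; rewrite ?fv8 // => j jn; rewrite !fr8 //; exact: tb.
  + by rewrite fv8.
  + by rewrite fv8.
  + by move=> j jm; rewrite !fr8 //; exact: et.
  + move=> u uw; have [|E1 E2] := nj (vcode u); first by rewrite vI'.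
    have [|E3 E4] := nj2 (vcode u); first by rewrite vI'.
    by rewrite na8 nb8 E3 E4 E1 E2 fa8 // chj ?vI' // fa34 // fa2 // fa1.
  + by rewrite na8 na2.
  + by rewrite nb8 nb2.
  + rewrite /valid_step /step_of /= na8 nb8 na2 nb2 /= !valK fa8 // chw serE.
    have symE : (~~ wadj g b a || (use_series t g w b a < keep_old t g w b a)) =
        (~~ wadj g a b || (use_series t g w a b < keep_old t g w a b)).
      by rewrite (Hs b a) (@keep_oldC g w a b gok) (@use_seriesC g w a b gok).
    by case: ab1 le1 => -[-> ->] le1; split; rewrite ?symE.
  + by move=> u Lu uw; rewrite !fa8 //; exact: sums.
  + move=> u v Lu Lv uw vw; rewrite /s8 /upd /= edge_index_eq.
    rewrite (_ : _ || _ = nbr_pair g w u v); last first.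
      apply/orP/idP => [[]/andP[/eqP-> /eqP->]//|/(nbr_pair_eq dw pab)[] [-> ->]].
        by left; rewrite !eqxx.
      by right; rewrite !eqxx.
    case: ifP => puv; last by rewrite !fa7 ?nar // !fa34 // !fa12.
    have [[-> ->]|[-> ->]] := nbr_pair_eq dw pab puv; rewrite zE /new_q ?pab ?pba //.
    by rewrite new_pC // series_qC qs.
  + by case: qu7 => eK qq; split=> [|j jo]; rewrite !fa8 ?qq.
  + exact: Ur.
  + exact: rP.
  + exact: low7.
  + by move=> j; rewrite fr8.
apply: wpc_seqI; split=> [//|P0|P0]; rewrite /= fv34 // eP in P0.
(* Adjacent neighbours: each of them loses [w] without a replacement and may enter the queue. *)
- have Hab : wadj g a b by move: P0; case: ifP.
  rewrite Hab in eP; have [/andP[pab0 pab1] qab1] := bw _ _ Hab.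
  have keep x y : nbr_pair g w x y -> wadj g x y.
    by move=> /(nbr_pair_eq dw pab)[] [-> ->] //; rewrite Hs.
  have SK x (f : V -> nat) : wadj g w x -> \sum_(v | eliminate (wadj g) w x v) f v =
      \sum_(v | wadj g x v && (v != w)) f v.
    by move=> wx; apply: sum_nbr_keep => // y; exact: keep.
  apply: wpc_seqI; apply: (@wpc_push _ a ord) => //.
  + by rewrite /= fv34 // fv2.
  + by rewrite /= D4a -(SP a (fun=> 1) wa); exact: leq_trans (leq_subr _ _) bd_a.
  move=> s5 qu5 f5; rewrite /= in qu5 f5; have [fv5 fa5] := f5.
  set ra := if _ then _ else _ in qu5.
  have raP u : u \in ra -> u = a /\ \sum_(v | wadj g a v && (v != w)) 1 = 2.
    by rewrite /ra /= D4a; case: ifP => // /eqP E; rewrite inE => /eqP->.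
  have a_notin : \sum_(v | wadj g a v && (v != w)) 1 = 2 -> a \notin ord.
    by move=> E; rewrite lowE // (sum_nbr_split (fun=> 1) gok wa) E.
  have b_notin : \sum_(v | wadj g b v && (v != w)) 1 = 2 -> b \notin ord.
    by move=> E; rewrite lowE // (sum_nbr_split (fun=> 1) gok wb) E.
  have Ura : uniq (ord ++ ra).
    rewrite cat_uniq U /= /ra; case: ifP => //= /eqP E; rewrite orbF andbT.
    by apply: a_notin; rewrite -D4a.
  have sor : size (ord ++ ra) <= n.
    by rewrite -[X in _ <= X]card_ord -(card_uniqP Ura) max_card.
  apply: wpc_seqI; apply: (@wpc_push _ b (ord ++ ra)) => //.
  + by rewrite /= fv5 // fv34 // fv2.
  + by rewrite /= fa5 // D4b -(SP b (fun=> 1) wb); exact: leq_trans (leq_subr _ _) bd_b.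
  move=> s6 qu6 f6; rewrite /= in qu6 f6; have [fv6 fa6] := f6; have f46 := frame_trans f5 f6; have [fv46 fa46] := f46.
  set rb := if _ then _ else _ in qu6; rewrite -catA in qu6.
  have rbP u : u \in rb -> u = b /\ \sum_(v | wadj g b v && (v != w)) 1 = 2.
    by rewrite /rb /= fa5 // D4b; case: ifP => // /eqP E; rewrite inE => /eqP->.
  apply: (@wpc_merge g w a b) => [//| | | | | | | | | | |s7 f7 chj chw ez].
  + by rewrite /= fv46.
  + by rewrite /= fv46 // fv34 // fv2.
  + by rewrite /= fv46 // fv34.
  + by rewrite /= fv46 // fv34.
  + by rewrite /= fv46 // fv34.
  + by rewrite /= fv46 // fv34.
  + exact: pab1.
  + exact: qab1.
  + by case/andP: bsp.
  + by rewrite /= fa46 // fa34 // fa2 // fa1 // ch0.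
  rewrite /= in f7 chj; have f47 := frame_trans f46 f7; have [fv7 fa7] := f7; have [fv47 fa47] := f47.
  apply: (fin s7 (ra ++ rb) _ _ (minn (keep_old t g w a b) (use_series t g w a b))
    (use_series t g w a b < keep_old t g w a b) f47).
  + by [].
  + by [].
  + exact: ez.
  + by rewrite /new_p pab Hab.
  + by rewrite geq_min /keep_old; case: ifP => _; apply/orP; left; clear -pab1 tX; lia.
  + by move=> j jw; rewrite chj // fa46.
  + exact: chw.
  + by rewrite Hab.
  + move=> u Lu uw; rewrite !fa47 //.
    have [->|ua] := eqVneq u a; first by rewrite D4a S4a R4a !SK.
    have [->|ub] := eqVneq u b; first by rewrite D4b S4b R4b !SK.
    have [-> -> ->] := oth u ua ub; rewrite !sum_other ?notnbr //; exact: rp1.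
  + by case: qu6 => eK qq; split=> [|j jo]; rewrite ?fv7 ?fa7 ?qq.
  + by rewrite /ra /rb; do 2!case: ifP => _; rewrite //= ?inE ?(negbTE nab').
  + have ea : a != w by rewrite eq_sym (wadj_neq gok wa).
    have eb : b != w by rewrite eq_sym (wadj_neq gok wb).
    move=> u; rewrite mem_cat => /orP[/raP[-> E]|/rbP[-> E]].
      by split=> //; exact: a_notin.
    by split=> //; exact: b_notin.
  + have lowa : (a \in ra) = (\sum_(v | wadj g a v && (v != w)) 1 == 2).
      by rewrite /ra /= D4a; case: ifP; rewrite ?inE ?eqxx.
    have lowb : (b \in rb) = (\sum_(v | wadj g b v && (v != w)) 1 == 2).
      by rewrite /rb /= fa5 // D4b; case: ifP; rewrite ?inE ?eqxx.
    move=> u Lu uw; rewrite !mem_cat.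
    have [ua|ua] := eqVneq u a.
      rewrite ua SK // lowa (_ : (a \in rb) = false) ?orbF; last first.
        by apply/negP => /rbP[E _]; rewrite E eqxx in nab'.
      apply: low_after_unlink; first exact: lowE.
      exact: (sum_nbr_split (fun=> 1) gok wa).
    have [ub|ub] := eqVneq u b.
      rewrite ub SK // lowb (_ : (b \in ra) = false) ?orFb; last first.
        by apply/negP => /raP[E _]; rewrite E eqxx in nab'.
      apply: low_after_unlink; first exact: lowE.
      exact: (sum_nbr_split (fun=> 1) gok wb).
    have -> : (u \in ra) = false by apply/negP => /raP[E _]; rewrite E eqxx in ua.
    have -> : (u \in rb) = false by apply/negP => /rbP[E _]; rewrite E eqxx in ub.
    by rewrite !orbF lowE // sum_other // notnbr.
(* Neighbours that are not adjacent: each gets the other one in place of [w], so degrees and queue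
   stay as they are. *)
have nHab : ~~ wadj g a b.
  apply/negP => Hab; move: P0; rewrite Hab; have [/andP[pab0 _] _] := bw _ _ Hab.
  by move=> E; rewrite E in pab0.
have nHba : ~~ wadj g b a by rewrite Hs.
have le_sum x (f : V -> nat) (c : nat) : \sum_(v | wadj g x v) f v <= c ->
    \sum_(v | wadj g x v && (v != w)) f v <= c.
  move=> H; apply: leq_trans H; rewrite [X in _ <= X](bigID (fun v => v != w)) /=; exact: leq_addr.
apply: wpc_seqI; apply: (@wpc_link _ _ a b) => [//| | | | | |s5 f5 o5 [e51 e52 e53]].
- by rewrite /= fv34 // fv2.
- by rewrite /= fv34 // fv2.
- by rewrite /= D4a le_sum.
- by rewrite /= S4a le_sum.
- by rewrite /= R4a le_sum.
rewrite /= in f5 e51 e52 e53 o5.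
have [fv5 fa5] := f5; have [_ _ _ tb5] : base s5 by apply: (base_frame f5).
have [|E51 E52 E53] := o5 b; first by rewrite eq_sym.
rewrite /= in E51 E52 E53.
apply: wpc_seqI; apply: (@wpc_link _ _ b a) => [//| | | | | |s6 f6 o6 [e61 e62 e63]].
- by rewrite /= fv5 // fv34 // fv2.
- by rewrite /= fv5 // fv34 // fv2.
- by rewrite /= E51 D4b le_sum.
- by rewrite /= E52 S4b le_sum.
- by rewrite /= E53 R4b le_sum.
rewrite /= in f6 e61 e62 e63 o6.
have f46 := frame_trans f5 f6; have [fv6 fa6] := f6; have [fv46 fa46] := f46.
apply: wpc_seqI; split=> //; first by rewrite /=; clear -tX; lia.
move=> i1 v1 iE vE; split=> // v2 v2E; rewrite /= fv46 // fv34 // fv2 // eW in iE; rewrite /= in vE.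
rewrite /= /upd /= fv46 // fv34 // eSP in v2E; rewrite iE vE v2E.
pose s7 := upd (upd s6 aCH (vcode w) 1) 0 vZ (series_p t g w a b).
have fa7 c j : c != 0 -> c != aCH -> s7 c j = s6 c j.
  by move=> c0 c1; rewrite /s7 /upd (negbTE c0) (negbTE c1).
have f67 : frame [:: vZ] [:: aCH] s6 s7.
  split=> [y|c j c0]; rewrite inE => ny; last by rewrite fa7.
  by rewrite /s7 /upd /= (negbTE ny).
have [fv7 _] := f67; have f47 := frame_trans f46 f67.
have SF x y (f : V -> nat) : nbr_pair g w x y -> ~~ wadj g x y ->
    \sum_(v | wadj g x v && (v != w)) f v + f y = \sum_(v | eliminate (wadj g) w x v) f v.
  by move=> pxy nxy; rewrite (sum_nbr_fill f gok dw pxy nxy) addnC.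
apply: (fin s7 [::] _ _ (series_p t g w a b) true f47).
+ by [].
+ by [].
+ by [].
+ by rewrite /new_p pab (negbTE nHab).
+ by clear -bsp tX; lia.
+ by move=> j jw; rewrite /s7 /upd /= (negbTE jw) fa46.
+ by rewrite /s7 /upd /= eqxx.
+ by rewrite nHab.
+ move=> u Lu uw; rewrite !fa7 //.
  have [->|ua] := eqVneq u a.
    have [-> -> ->] := o6 a nab'; rewrite e51 e52 e53 D4a S4a R4a.
    by split; rewrite -(SF a b _ pab nHab).
  have [->|ub] := eqVneq u b.
    rewrite e61 e62 e63 E51 E52 E53 D4b S4b R4b.
    by split; rewrite -(SF b a _ pba nHba).
  have [-> -> ->] := o6 u ub; have [-> -> ->] := o5 u ua; have [-> -> ->] := oth u ua ub.
  rewrite !sum_other ?notnbr //; exact: rp1.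
+ by rewrite cats0; case: qu4 => eK qq; split=> [|j jo]; rewrite ?fv7 ?fv46 ?fa7 ?fa46 ?qq.
+ by [].
+ by [].
+ move=> u Lu uw; rewrite cats0 lowE //.
  have [->|ua] := eqVneq u a.
    by rewrite -(SF a b (fun=> 1) pab nHab) (sum_nbr_split (fun=> 1) gok wa) addnC.
  have [->|ub] := eqVneq u b.
    by rewrite -(SF b a (fun=> 1) pba nHba) (sum_nbr_split (fun=> 1) gok wb) addnC.
  by rewrite sum_other // notnbr.
Qed.
End Step.

(** * Composition of the phases *)

Lemma run_eliminate h : inv_elim 0 h ->
  runs_to M (CWhile ($vN :- $vI) c_eliminate)
    (n.+1 * (esize ($vN :- $vI) + ccost c_eliminate + 3)) (inv_elim n) h.
Proof.
apply: runs_to_loop => [k {}h kn|{}h]; last first.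
  by case=> g [ord [ok [[eN _ _ _] [eI _] _ _ _]]]; rewrite /= eN eI subnn.
case=> g [ord [ok st]]; have [[eN _ _ _] [eI _] _ _ _] := st.
by split; [by []|rewrite /= eN eI subn_gt0|exact: (run_step kn st)].
Qed.

Lemma enqueue_elim h : inv_enqueue n h ->
  inv_elim 0 (hset (hset h 0 vI 0) 0 vOK 1).
Proof.
move=> [[eN eT eM tb] eI ho et [PE ds q0 z [eK qs]]].
have gok := unit_wgraph_ok Gconn.
have z' a j : 12 <= a -> sto h a j = 0 := z a j.
set ord := [seq _ <- _ | _] in eK qs.
have ordE u : (u \in ord) = (#|G u| <= 2).
  by rewrite /ord take_oversize ?size_enum_ord // mem_filter mem_enum andbT.
exists (unit_wgraph G), ord, true; split; [by split|by split|exact: ho|exact: et|split].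
- rewrite take0; split; [exact: gok|exact: GK4| |].
  + by move=> u v _; split.
  + by split=> F Ff; [exists F|].
- split=> [u _|u v _ _]; first by have [d s r] := ds u; split.
  split; last exact: q0.
  by rewrite -[LHS]/(sto h aP (edge_index u v)) PE /=; case: (G u v).
- by split.
- split; first by rewrite /ord filter_uniq // take_uniq // enum_uniq.
  + by move=> u; rewrite take0.
  + by move=> u _; rewrite ordE.
by split=> [u|u _|j]; rewrite /= /upd /= !z'.
Qed.

Lemma edge_enqueue h : inv_edge m h -> inv_enqueue 0 (hset h 0 vI 0).
Proof.
move=> [[eN eT eM tb] [eI eK] [hi ho] et [PE ds q0 z]]; rewrite take_size in PE ds.
split; [by split|by []|exact: ho|exact: et|split].
- by move=> x y; rewrite -[LHS]/(sto h aP (edge_index x y)) PE edges_relE.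
- move=> u; have [d s r] := ds u.
  have E v : G u v = edges_rel es u v by exact: edges_relE.
  by split; rewrite (eq_bigl _ _ E).
- exact: q0.
- move=> b j b12; rewrite /= /upd (gtn_eqF (leq_trans _ b12)) //=; exact: (z b j (ltnW b12)).
- by rewrite take0; split=> // j.
Qed.

Lemma table_edge h : inv_table (n + n + 1) h -> inv_edge 0 (hset h 0 vI 0).
Proof.
move=> [[eN eT eM eI eX] tb z hi [ho eK]]; have z' a j : 5 <= a -> sto h a j = 0 := z a j.
split; [by split|by split|by rewrite drop0; split| |split].
- by move=> j.
- by move=> x y; rewrite take0 /= /upd /= z'.
- by move=> u; rewrite take0; split; rewrite big_pred0 //= /upd /= z'.
- by move=> j; rewrite /= /upd /= z'.
- move=> b j b11; rewrite /= /upd (gtn_eqF (leq_trans _ b11)) //=; apply: z'.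
  exact: leq_trans b11.
Qed.

Lemma elim_undo h : inv_elim n h -> exists ord hs ok, [/\ size ord = n,
  inv_undo ord hs ok 0 h &
  if ok then feasible t (unit_wgraph G) (undo hs (fun _ _ => false))
  else forall F, ~ feasible t (unit_wgraph G) F].
Proof.
move=> [g [ord [ok [bs [eI eok] ho et [[gok nK _ eqv] _ [eK qs] [U dead low] [nab _ d0]]]]]].
have so' : size ord <= n by rewrite -[X in _ <= X]card_ord -(card_uniqP U) max_card.
rewrite take_oversize // in eqv dead.
have [[Hs Hi] HL _ _ _] := gok.
have nolive u : ~~ live g u.
  apply/negP => Lu; have [v Lv dv] := K4_minor_free_low_degree Hs Hi HL nK Lu.
  by have := dead v; rewrite low // dv Lv.
have so : size ord = n.
  apply/eqP; rewrite eqn_leq so' /=; have : {subset enum 'I_n <= ord}.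
    by move=> u _; rewrite dead nolive.
  by move/(uniq_leq_size (enum_uniq _)); rewrite size_enum_ord.
exists ord, [seq step_of (sto h) u | u <- ord], ok; split; first exact: so.
- split; [exact: bs|by rewrite subn0|exact: ho|exact: et|].
  split; [by move=> j jn; rewrite qs ?so|exact: nab|by []|move=> x y].
  by rewrite d0 subn0 drop_oversize // size_map so.
case: ok eqv {eok} => // -[_ H]; apply: H; split=> //.
- by move=> x y Lx; have := nolive x; rewrite Lx.
- by move=> u v /HL Lu; have := nolive u; rewrite Lu.
Qed.

Lemma run_start : runs_to M c_start (ccost c_start) (inv_table 0)
  (HConf (fun _ _ => 0) (input_word t es) [::]).
Proof.
have [nX tX] : n <= X /\ t + 2 <= X by move: X_n3; clear; lia.
have mn := size_edges; apply: wpc_sound; rewrite /=.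
do 3![split; first lia]; rewrite /upd /=; split; first by do !split; lia.
move=> v ->; split=> //=.
by move=> b j b5; rewrite /upd !(gtn_eqF (leq_trans _ b5)).
Qed.

Lemma runs_to_le c K K' Q h : K <= K' -> runs_to M c K Q h -> runs_to M c K' Q h.
Proof. by move=> KK [h' [k [e kK Qh]]]; exists h', k; split=> //; exact: leq_trans KK. Qed.

Lemma runs_to_mono c K (Q Q' : hconf -> Prop) h : (forall h', Q h' -> Q' h') ->
  runs_to M c K Q h -> runs_to M c K Q' h.
Proof. by move=> QQ [h' [k [e kK Qh]]]; exists h', k; split=> //; exact: QQ. Qed.

Lemma linear_seq c1 c2 A1 A2 (Q1 Q2 : hconf -> Prop) h : runs_to M c1 (A1 * n) Q1 h ->
  (forall h', Q1 h' -> runs_to M c2 (A2 * n) Q2 h') ->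
  runs_to M (CSeq c1 c2) ((A1 + A2) * n) Q2 h.
Proof. by move=> r1 r2; rewrite mulnDl; exact: runs_to_seq r1 r2. Qed.

Lemma linear_loop c N L (Q : hconf -> Prop) h : N <= 2 * n + 1 ->
  runs_to M c (N.+1 * L) Q h -> runs_to M c (4 * L * n) Q h.
Proof.
move=> NB; apply: runs_to_le; have n1 := n_gt0.
by rewrite -mulnA (mulnC L n) mulnA leq_mul2r; apply/orP; right; clear -NB n1; lia.
Qed.

Lemma linear_single c (Q : hconf -> Prop) h : wpc M c Q h -> runs_to M c (ccost c * n) Q h.
Proof. by move/wpc_sound; apply: runs_to_le; rewrite leq_pmulr // n_gt0. Qed.

Lemma spanner_output F : feasible t (unit_wgraph G) F ->
  correct_answer G t (1 :: flat [seq e <- es | F e.1 e.2]).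
Proof.
move=> Ff; have [[Fs FG] _ _ _ _] := Ff; have [U E] := Ges.
have [T sp TF] : exists2 T : graph n, tree_spanner t G T & adj T =2 F.
  by exact: feasible_tree_spanner.
have swap : [seq e <- es | F e.1 e.2] ++ [seq (e.2, e.1) | e <- [seq e <- es | F e.1 e.2]] =
    [seq e <- es ++ [seq (e.2, e.1) | e <- es] | F e.1 e.2].
  rewrite filter_cat filter_map; congr (_ ++ map _ _).
  by apply: eq_filter => e; rewrite /= Fs.
left; exists T, [seq e <- es | F e.1 e.2]; split=> //; split=> [|u v]; rewrite swap.
  exact: filter_uniq.
rewrite TF mem_filter -E /=; apply/idP/andP => [Fuv|[]//]; split=> //; exact: (FG _ _ Fuv).
Qed.

Lemma run_main : runs_to M c_main (main_cost * n) (fun h => correct_answer G t (hout h))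
  (HConf (fun _ _ => 0) (input_word t es) [::]).
Proof.
have n1 := n_gt0; have mn := size_edges.
have n2 : n <= 2 * n + 1 by clear; lia.
have nn2 : n + n + 1 <= 2 * n + 1 by clear; lia.
have m2 : m <= 2 * n + 1 by clear -mn; lia.
have [nX tX] : n <= X /\ t + 2 <= X by move: X_n3; clear; lia.
rewrite /c_main /main_cost.
apply: (linear_seq (runs_to_le (leq_pmulr _ n1) run_start)) => h1 I1.
apply: (linear_seq (linear_loop nn2 (run_table I1))) => h2 I2.
apply: (@linear_seq _ _ _ _ (inv_edge 0)) => [|h3 I3].
  by apply: linear_single; split=> // v ->; exact: table_edge.
apply: (linear_seq (linear_loop m2 (run_edge I3))) => h4 I4.
apply: (@linear_seq _ _ _ _ (inv_enqueue 0)) => [|h5 I5].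
  by apply: linear_single; split=> // v ->; exact: edge_enqueue.
apply: (linear_seq (linear_loop n2 (run_enqueue I5))) => h6 I6.
apply: (@linear_seq _ _ _ _ (eq (hset h6 0 vI 0))) => [|h7 <-].
  by apply: linear_single; split=> // v ->.
apply: (@linear_seq _ _ _ _ (inv_elim 0)) => [|h8 I8].
  apply: linear_single; split=> [|v ->]; first by rewrite /=; clear -tX; lia.
  exact: enqueue_elim.
apply: (linear_seq (linear_loop n2 (run_eliminate I8))) => h9 /elim_undo[ord [hs [ok [so I9 fe]]]].
apply: (linear_seq (linear_loop n2 (run_undo so I9))) => h10 [bs [eI eok] ho et [_ _ _ rt]].
rewrite subnn in eI; rewrite subnn drop0 in rt.
apply: (@linear_seq _ _ _ _ (eq (HConf (sto h10) (hinp h10) [:: nat_of_bool ok]))) => [|h11 <-].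
  by apply: linear_single; split=> //; rewrite ho /= eok.
case: ok fe eok {I9} => fe eok.
- apply: (@linear_seq _ _ _ _ (inv_output (undo hs (fun _ _ => false)) 0)) => [|h12 I12].
    apply: linear_single; split=> [//|_|E]; last by exfalso; move: E; rewrite /= eok.
    by split; [exact: bs|exact: eI|exact: et|exact: rt|rewrite take0].
  apply: (runs_to_mono _ (linear_loop m2 (run_output I12))) => h13 [_ _ _ _ ->].
  by rewrite take_size; exact: spanner_output.
apply: (@linear_seq _ _ _ _ (fun h => hout h = [:: 0] /\ sto h 0 vM = 0)) => [|h12 [ho12 eM12]].
  apply: linear_single; split=> [//|E|_]; first by exfalso; move: E; rewrite /= eok.
  by split=> // v ->.
apply: (runs_to_le (leq_pmulr _ n1)); exists h12, (esize ($vM :- $vI) + 3); split=> //.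
  by apply: exec_while_false; rewrite /= ?eM12.
rewrite ho12; right; split=> // -[T sp]; apply: (fe T); exact: tree_spanner_feasible.
Qed.

End Correctness.

Lemma K4_minor_free_spanner_algorithm : exists (P : program) (c k : nat),
  forall (n t : nat) (G : graph n) (es : seq ('I_n * 'I_n)),
    graph_connected G -> ~ K4_minor G -> 0 < t -> edge_list G es ->
    exists (T : nat) (o : seq nat),
      [/\ runs P ((n + t) ^ k) (init (input_word t es)) T o,
          T <= c * n & correct_answer G t o].
Proof.
(* With [X = 4 (n + t)^3] the largest address is [256 X + 15], at most [2^11 (n + t)^3]; as
   [n + t >= 2], the exponent 11 + 3 suffices. The summand 1 in the time pays for halting. *)
exists (code 0 c_main), (main_cost + 1), 14 => n t G es Gc GK4 t0 Ges.
have n0 : 0 < n by case: Gc.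
have s2 : 2 <= n + t by lia.
have s3 : (n + t) * 4 <= (n + t) ^ 3.
  by rewrite expnS leq_mul2l (_ : 4 = 2 ^ 2) // leq_exp2r // s2 orbT.
have n3 : n ^ 3 <= (n + t) ^ 3 by rewrite leq_exp2r // leq_addr.
have n2 : n ^ 2 <= (n + t) ^ 3.
  apply: (@leq_trans ((n + t) ^ 2)); first by rewrite leq_exp2r // leq_addr.
  by rewrite leq_exp2l.
pose X := 4 * (n + t) ^ 3.
have XB : n ^ 3 + n ^ 2 + n + t + 2 <= X.
  by rewrite /X; move: n3 n2 s3 s2; move: (n ^ 3) (n ^ 2) ((n + t) ^ 3) => A B C; clear; lia.
have [h [k [ex kK ca]]] := run_main Gc GK4 t0 Ges XB.
exists (k + 1), (hout h); split; [|by rewrite mulnDl mul1n; exact: leq_add kK n0|exact: ca].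
apply: compile_runs ex legal_main _.
have e11 : 2048 <= (n + t) ^ 11.
  by apply: (@leq_trans (2 ^ 11)) => //; rewrite leq_exp2r.
apply: (@leq_trans (2048 * (n + t) ^ 3)); last by rewrite (expnD _ 11 3) leq_mul2r e11 orbT.
by rewrite /X; move: s3 s2; move: ((n + t) ^ 3) => C; clear; lia.
Qed.

End Program.

From mathcomp Require Import all_order all_algebra all_classical all_reals.
From mathcomp Require Import topology normedtype ring lra.
Import Order.TTheory GRing.Theory Num.Theory numFieldNormedType.Exports.

(** * Outerplanar graphs have no K4 minor *)

Section Topology.

(** * Crossing parity of two segments *)

Section CrossingParity.
Variable R : realFieldType.
Local Open Scope ring_scope.
Implicit Types p q x y z : R * R.

(* [A], [B], [C], [D] stand for the orientations of [xyq], [xyp], [pqy],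
   [pqx]; Cramer's rule relates them to the heights. *)
Lemma orientation_signs (hp hq hx hy A B C D : R) :
  hp < hq -> hx < hy -> hp != hx -> hp != hy -> hq != hx -> hq != hy ->
  (D * C <= 0 -> B * A <= 0 -> D != C -> False) ->
  hp * A - hq * B + hx * C - hy * D = 0 -> A - B = D - C ->
  ((hp < hx) (+) (hq < hx)) && (D < 0) (+) ((hp < hy) (+) (hq < hy)) && (C < 0)
  (+) ((hx < hp) (+) (hy < hp)) && (0 < B) (+) ((hx < hq) (+) (hy < hq)) && (0 < A)
  = false.
Proof.
move=> pq xy px py qx qy dis H1 H2.
have xorF (b c : bool) : (b -> c) -> (c -> b) -> b (+) c = false.
  by case: b c => -[]// bc cb; [case: (notF (bc _))|case: (notF (cb _))].
have hC : C = D + B - A by lra.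
rewrite hC in H1.
have pos (u v c d f g : R) : u * v = c * d + f * g -> 0 < u ->
    0 <= c -> 0 <= d -> 0 <= f -> 0 <= g -> 0 <= v.
  by move=> uv u0 c0 d0 f0 g0; rewrite -(pmulr_rge0 _ u0) uv addr_ge0 // mulr_ge0.
have dis1 : D <= 0 -> 0 <= C -> A <= 0 -> 0 <= B -> D != C -> False.
  by move=> *; apply: dis => //; [exact: mulr_le0_ge0|exact: mulr_ge0_le0].
have dis2 : 0 <= D -> C <= 0 -> 0 <= A -> B <= 0 -> D != C -> False.
  by move=> *; apply: dis => //; [exact: mulr_ge0_le0|exact: mulr_le0_ge0].
have lF (u v : R) : u <= v -> (v < u) = false by move=> uv; rewrite ltNge uv.
(* If the height ranges are disjoint, all terms vanish. In each of the four overlapping orders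
   exactly two terms survive; if they differed, the relations would fix the other signs so that the
   segments meet. *)
have [xq|xq|xq] := ltgtP hq hx; last by rewrite xq eqxx in qx.
  have px1 := lt_trans pq xq; have py1 := lt_trans px1 xy; have qy1 := lt_trans xq xy.
  by rewrite px1 py1 qy1 !(lF hp, lF hq) ?ltW.
have [yp|yp|yp] := ltgtP hy hp; last by rewrite yp eqxx in py.
  have xp1 := lt_trans xy yp; have yq1 := lt_trans yp pq.
  by rewrite xp1 yq1 !(lF hx, lF hy) ?ltW.
have [xp|xp|xp] := ltgtP hx hp; last by rewrite xp eqxx in px.
- have [yq|yq|yq] := ltgtP hy hq; last by rewrite yq eqxx in qy.
  + rewrite /= ?addbF; apply: xorF => [C0|B0]; rewrite ltNge; apply/negP => B1.
      have D0 : 0 <= D.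
        by apply: (pos (hy - hp) _ (hq - hp) (- B) (hp - hx) (- C)); rewrite ?subr_gt0 ?subr_ge0 ?oppr_ge0//; try exact: ltW; rewrite ?hC; lra.
      have A0 : 0 <= A.
        by apply: (pos (hy - hp) _ (hq - hy) (- B) (hy - hx) (- C)); rewrite ?subr_gt0 ?subr_ge0 ?oppr_ge0//; try exact: ltW; rewrite ?hC; lra.
      by apply: dis2 => //; [exact: ltW|rewrite gt_eqF //; lra].
    have D0 : 0 <= - D.
      by apply: (pos (hy - hp) _ (hq - hp) B (hp - hx) C); rewrite ?subr_gt0 ?subr_ge0 ?oppr_ge0//; try exact: ltW; rewrite ?hC; lra.
    have A0 : 0 <= - A.
      by apply: (pos (hy - hp) _ (hq - hy) B (hy - hx) C); rewrite ?subr_gt0 ?subr_ge0 ?oppr_ge0//; try exact: ltW; rewrite ?hC; lra.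
    by apply: dis1 => //; [lra|lra|exact: ltW|apply/eqP => DC; nra].
  + rewrite /= ?addbF; apply: xorF => [B0|A0]; rewrite ltNge; apply/negP => A1.
      have D0 : 0 <= - D.
        by apply: (pos (hy - hx) _ (hp - hx) (- A) (hq - hx) B); rewrite ?subr_gt0 ?subr_ge0 ?oppr_ge0//; try exact: ltW; rewrite ?hC; lra.
      have C0 : 0 <= C.
        by apply: (pos (hy - hx) _ (hy - hq) B (hy - hp) (- A)); rewrite ?subr_gt0 ?subr_ge0 ?oppr_ge0//; try exact: ltW; rewrite ?hC; lra.
      by apply: dis1 => //; [lra|exact: ltW|apply/eqP; lra].
    have D0 : 0 <= D.
      by apply: (pos (hy - hx) _ (hp - hx) A (hq - hx) (- B)); rewrite ?subr_gt0 ?subr_ge0 ?oppr_ge0//; try exact: ltW; rewrite ?hC; lra.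
    have C0 : 0 <= - C.
      by apply: (pos (hy - hx) _ (hy - hq) (- B) (hy - hp) A); rewrite ?subr_gt0 ?subr_ge0 ?oppr_ge0//; try exact: ltW; rewrite ?hC; lra.
    by apply: dis2 => //; [lra|exact: ltW|apply/eqP; lra].
- have [yq|yq|yq] := ltgtP hy hq; last by rewrite yq eqxx in qy.
  + rewrite /= ?addbF; apply: xorF => [D0|C0]; rewrite ltNge; apply/negP => C1.
      have A0 : 0 <= - A.
        by apply: (pos (hq - hp) _ (hq - hy) (- D) (hq - hx) C); rewrite ?subr_gt0 ?subr_ge0 ?oppr_ge0//; try exact: ltW; rewrite ?hC; lra.
      have B0 : 0 <= B.
        by apply: (pos (hq - hp) _ (hx - hp) C (hy - hp) (- D)); rewrite ?subr_gt0 ?subr_ge0 ?oppr_ge0//; try exact: ltW; rewrite ?hC; lra.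
      by apply: dis1 => //; [lra|lra|apply/eqP; lra].
    have A0 : 0 <= A.
      by apply: (pos (hq - hp) _ (hq - hy) D (hq - hx) (- C)); rewrite ?subr_gt0 ?subr_ge0 ?oppr_ge0//; try exact: ltW; rewrite ?hC; lra.
    have B0 : 0 <= - B.
      by apply: (pos (hq - hp) _ (hx - hp) (- C) (hy - hp) D); rewrite ?subr_gt0 ?subr_ge0 ?oppr_ge0//; try exact: ltW; rewrite ?hC; lra.
    by apply: dis2 => //; [lra|lra|apply/eqP; lra].
  + rewrite /= ?addbF; apply: xorF => [D0|A0]; rewrite ltNge; apply/negP => A1.
      have B0 : 0 <= B.
        by apply: (pos (hq - hx) _ (hx - hp) (- A) (hy - hx) (- D)); rewrite ?subr_gt0 ?subr_ge0 ?oppr_ge0//; try exact: ltW; rewrite ?hC; lra.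
      have C0 : 0 <= C.
        by apply: (pos (hq - hx) _ (hq - hp) (- A) (hy - hq) (- D)); rewrite ?subr_gt0 ?subr_ge0 ?oppr_ge0//; try exact: ltW; rewrite ?hC; lra.
      by apply: dis1 => //; [lra|apply/eqP; lra].
    have B0 : 0 <= - B.
      by apply: (pos (hq - hx) _ (hx - hp) A (hy - hx) D); rewrite ?subr_gt0 ?subr_ge0 ?oppr_ge0//; try exact: ltW; rewrite ?hC; lra.
    have C0 : 0 <= - C.
      by apply: (pos (hq - hx) _ (hq - hp) A (hy - hq) D); rewrite ?subr_gt0 ?subr_ge0 ?oppr_ge0//; try exact: ltW; rewrite ?hC; lra.
    apply: dis2 => //; [lra|exact: ltW|lra|apply/eqP; lra].
Qed.

Definition orient p q z : R :=
  (q.1 - p.1) * (z.2 - p.2) - (q.2 - p.2) * (z.1 - p.1).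

Definition on_segment p q z : Prop :=
  exists2 s : R, 0 <= s <= 1 &
    z = (p.1 + s * (q.1 - p.1), p.2 + s * (q.2 - p.2)).

Definition segments_meet p q x y : Prop :=
  exists2 z, on_segment p q z & on_segment x y z.

Lemma on_segmentC p q z : on_segment p q z -> on_segment q p z.
Proof.
case=> s /andP[s0 s1] ->; exists (1 - s); first by apply/andP; split; lra.
by congr pair; ring.
Qed.

Lemma ratio_itv (a b : R) : a * b <= 0 -> a - b != 0 -> 0 <= a / (a - b) <= 1.
Proof.
move=> ab0 nab; have [ab|ba] := ltP 0 (a - b).
  by rewrite ler_pdivlMr // ler_pdivrMr // mul0r mul1r; apply/andP; split; nra.
have {ba nab}ba : a - b < 0 by rewrite lt_neqAle nab.
by rewrite ler_ndivlMr // ler_ndivrMr // mul0r mul1r; apply/andP; split; nra.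
Qed.

Lemma orient_sum p q x y :
  orient x y q - orient x y p = orient p q x - orient p q y.
Proof. by rewrite /orient; ring. Qed.

Lemma segments_meetP p q x y :
  orient p q x * orient p q y <= 0 -> orient x y p * orient x y q <= 0 ->
  orient p q x != orient p q y -> segments_meet p q x y.
Proof.
move=> h1 h2 n1.
have n1' : orient p q x - orient p q y != 0 by rewrite subr_eq0.
have n2' : orient x y p - orient x y q != 0.
  by rewrite -oppr_eq0 opprB orient_sum.
exists (x.1 + orient p q x / (orient p q x - orient p q y) * (y.1 - x.1),
        x.2 + orient p q x / (orient p q x - orient p q y) * (y.2 - x.2)); last first.
  by exists (orient p q x / (orient p q x - orient p q y)); first exact: ratio_itv.
exists (orient x y p / (orient x y p - orient x y q)); first exact: ratio_itv.
have -> : orient x y p - orient x y q = - (orient p q x - orient p q y).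
  by rewrite /orient; ring.
by congr pair; move: n1'; rewrite /orient => n1'; field.
Qed.

Variable e : R.

(** The tilt [e] is chosen later so that finitely many given points get distinct heights. For
    [e = 0] the level lines are vertical, which explains the names [below] and [above]. *)
Definition height z : R := z.1 + e * z.2.
Local Notation h := height.

Lemma height_relation p q x y :
  h p * orient x y q - h q * orient x y p + h x * orient p q y
  - h y * orient p q x = 0.
Proof. by rewrite /height /orient; ring. Qed.

Definition between p q z := (h p < h z) (+) (h q < h z).
Definition side p q z := if h p < h q then orient p q z else orient q p z.
(** The segment passes over [z]: it crosses the upper half of the level line through [z]. *)
Definition below p q z := between p q z && (side p q z < 0).
Definition above p q z := between p q z && (0 < side p q z).

Lemma belowC p q z : (h p = h q -> p = q) -> below p q z = below q p z.
Proof.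
move=> pq; rewrite /below /between /side addbC.
by case: (ltgtP (h p) (h q)) => // /pq ->.
Qed.

Lemma aboveC p q z : (h p = h q -> p = q) -> above p q z = above q p z.
Proof.
move=> pq; rewrite /above /between /side addbC.
by case: (ltgtP (h p) (h q)) => // /pq ->.
Qed.

(** While a point runs from [x] to [y], being below [pq] can change only when it passes under [p] or
    under [q], because the segments do not meet. The terms with [above] count these passages. *)
Lemma segment_crossing_parity p q x y :
  {in [:: p; q; x; y] &, injective h} -> ~ segments_meet p q x y ->
  below p q x (+) below p q y (+) above x y p (+) above x y q = false.
Proof.
move=> injh dis.
have inj u v : u \in [:: p; q; x; y] -> v \in [:: p; q; x; y] ->
  h u = h v -> u = v by move=> hu hv; exact: injh.
wlog pq : p q injh inj dis / h p <= h q.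
  move=> W; have [le|/ltW le] := leP (h p) (h q); first exact: W.
  have Epq : h p = h q -> p = q by apply: inj; rewrite !inE eqxx ?orbT.
  have perm : [:: q; p; x; y] =i [:: p; q; x; y].
    by move=> z; rewrite !inE orbCA.
  rewrite -addbA (addbC (above _ _ _)) addbA (belowC _ Epq) (belowC y Epq).
  apply: W => // [u v|u v|[z zqp zxy]]; rewrite ?perm; [exact: injh|exact: inj|].
  by apply: dis; exists z => //; exact: on_segmentC.
wlog xy : x y injh inj dis / h x <= h y.
  move=> W; have [le|/ltW le] := leP (h x) (h y); first exact: W.
  have Exy : h x = h y -> x = y by apply: inj; rewrite !inE eqxx ?orbT.
  have perm : [:: p; q; y; x] =i [:: p; q; x; y].
    by move=> z; rewrite !inE; congr (_ || (_ || _)); rewrite orbC.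
  rewrite (addbC (below p q x)) (aboveC _ Exy) (aboveC q Exy).
  apply: W => // [u v|u v|[z zqp zxy]]; rewrite ?perm; [exact: injh|exact: inj|].
  by apply: dis; exists z => //; exact: on_segmentC.
have ne u v : u \in [:: p; q] -> v \in [:: x; y] -> h u != h v.
  move=> hu hv; apply/eqP => huv; have uv : u = v.
    by apply: inj => //; rewrite !inE in hu hv *; [case/orP: hu|case/orP: hv] => ->;
       rewrite ?orbT.
  apply: dis; exists u; last rewrite uv.
    case/or3P: hu => // /eqP ->.
      by exists 0; rewrite ?lexx ?ler01 // !mul0r !addr0; case: p {injh inj pq}.
    by exists 1; rewrite ?lexx ?ler01 // !mul1r !subrKC; case: q {injh inj pq}.
  case/or3P: hv => // /eqP ->.
    by exists 0; rewrite ?lexx ?ler01 // !mul0r !addr0; case: x {injh inj xy}.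
  by exists 1; rewrite ?lexx ?ler01 // !mul1r !subrKC; case: y {injh inj xy}.
have [pq'|npq] := eqVneq p q.
  by subst q; rewrite /below /between !addbb /=; case: above.
have [xy'|nxy] := eqVneq x y.
  by subst y; rewrite /above /between !addbb /=; case: below.
have {npq}pq : h p < h q.
  rewrite lt_neqAle pq andbT.
  by apply: contra npq => /eqP/inj ->//; rewrite !inE eqxx ?orbT.
have {nxy}xy : h x < h y.
  rewrite lt_neqAle xy andbT.
  by apply: contra nxy => /eqP/inj ->//; rewrite !inE eqxx ?orbT.
have px : h p != h x by apply: ne; rewrite !inE eqxx ?orbT.
have py : h p != h y by apply: ne; rewrite !inE eqxx ?orbT.
have qx : h q != h x by apply: ne; rewrite !inE eqxx ?orbT.
have qy : h q != h y by apply: ne; rewrite !inE eqxx ?orbT.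
have {}dis : orient p q x * orient p q y <= 0 -> orient x y p * orient x y q <= 0 ->
  orient p q x != orient p q y -> False.
  by move=> h1 h2 h3; apply: dis; exact: segments_meetP.
have := orient_sum p q x y; have := height_relation p q x y.
rewrite /below /above /side /between pq xy.
move: (orient x y q) (orient x y p) (orient p q y) (orient p q x) dis.
move: (h p) (h q) (h x) (h y) pq xy px py qx qy => hp hq hx hy.
move=> pq xy px py qx qy A B C D dis H1 H2.
exact: orientation_signs.
Qed.
End CrossingParity.

(** * Polygonal lines and the exclusion of a plane K5 *)

Section PolylineParity.
Variable R : realFieldType.
Local Open Scope ring_scope.
Implicit Types (p q x y z : R * R) (r s : seq (R * R)).

Fixpoint on_polyline p s z : Prop :=
  if s is q :: s' then on_segment p q z \/ on_polyline q s' z else z = p.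

Lemma on_segment_l p q : on_segment p q p.
Proof. by exists 0; rewrite ?lexx ?ler01 // !mul0r !addr0; case: p. Qed.

Lemma on_segment_r p q : on_segment p q q.
Proof. by apply: on_segmentC; exact: on_segment_l. Qed.

Lemma on_polyline_head p s : on_polyline p s p.
Proof. by case: s => //= q s; left; exact: on_segment_l. Qed.

Lemma on_polyline_last p s : on_polyline p s (last p s).
Proof. by elim: s p => //= q s IH p; right. Qed.

Lemma on_polyline_cat p s r z : on_polyline p (s ++ r) z <->
  on_polyline p s z \/ on_polyline (last p s) r z.
Proof.
elim: s p => [|q s IH] p /=.
  by split=> [|[->|//]]; [right|exact: on_polyline_head].
by rewrite IH; tauto.
Qed.

Section Height.
Variable e : R.
Local Notation h := (height e).
Local Notation below := (below e).
Local Notation above := (above e).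

Fixpoint polyline_below p s z : bool :=
  if s is q :: s' then below p q z (+) polyline_below q s' z else false.

Fixpoint polyline_above p s z : bool :=
  if s is q :: s' then above p q z (+) polyline_above q s' z else false.

Lemma segment_polyline_parity p q x r :
  {in [:: p, q, x & r] &, injective h} ->
  (forall z, on_segment p q z -> on_polyline x r z -> False) ->
  below p q x (+) below p q (last x r)
    (+) polyline_above x r p (+) polyline_above x r q = false.
Proof.
elim: r x => [|y r IH] x injh dis; first by rewrite /= !addbF addbb.
have H1 : below p q x (+) below p q y (+) above x y p (+) above x y q = false.
  apply: segment_crossing_parity; last by move=> [z zp zx]; apply: (dis z) => //; left.
  apply: sub_in2 injh => z; rewrite !inE.
  by case/or4P => ->; rewrite ?orbT.
have H2 : below p q y (+) below p q (last y r) (+)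
    polyline_above y r p (+) polyline_above y r q = false.
  apply: IH => [|z zp zy]; last by apply: (dis z) => //=; right.
  apply: sub_in2 injh => z; rewrite !inE.
  by case/or4P => ->; rewrite ?orbT.
move: H1 H2 => /=; do 2!case: (polyline_above _ _ _); do 2!case: (above _ _ _);
  by do 3!case: (below _ _ _).
Qed.

Lemma polyline_crossing_parity p s x r :
  {in (p :: s) ++ (x :: r) &, injective h} ->
  (forall z, on_polyline p s z -> on_polyline x r z -> False) ->
  polyline_below p s x (+) polyline_below p s (last x r)
    (+) polyline_above x r p (+) polyline_above x r (last p s) = false.
Proof.
elim: s p => [|q s IH] p injh dis /=; first by rewrite addbb.
have H1 := @segment_polyline_parity p q x r _ _.
have {}H1 : below p q x (+) below p q (last x r)
    (+) polyline_above x r p (+) polyline_above x r q = false.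
  apply: H1 => [|z zp zx]; last by apply: (dis z) => //=; left.
  apply: sub_in2 injh => z; rewrite !(inE, mem_cat).
  by case/or4P => ->; rewrite ?orbT.
have H2 := IH q.
have {}H2 : polyline_below q s x (+) polyline_below q s (last x r)
    (+) polyline_above x r q (+) polyline_above x r (last q s) = false.
  apply: IH => [|z zp zx]; last by apply: (dis z) => //=; right.
  by apply: sub_in2 injh => z; rewrite /= !inE => ->; rewrite orbT.
move: H1 H2; do 3!case: (polyline_above _ _ _); do 2!case: (polyline_below _ _ _);
  by do 2!case: (below _ _ _).
Qed.

Lemma orient0_on_segment p q z : h p < h z -> h z < h q -> orient p q z = 0 ->
  on_segment p q z.
Proof.
move=> pz zq o0; have pq := lt_trans pz zq.
have d0 : 0 < h q - h p by rewrite subr_gt0.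
exists ((h z - h p) / (h q - h p)).
  rewrite ler_pdivlMr // mul0r ler_pdivrMr // mul1r subr_ge0 (ltW pz) /=.
  by rewrite lerD2r ltW.
have n0 : h q - h p != 0 by rewrite gt_eqF.
have E1 : z.1 - p.1 = (h z - h p) / (h q - h p) * (q.1 - p.1).
  apply: (mulIf n0); rewrite mulrAC divfK //.
  by move/(congr1 ( *%R e)): o0; rewrite /orient /height mulr0; lra.
have E2 : z.2 - p.2 = (h z - h p) / (h q - h p) * (q.2 - p.2).
  apply: (mulIf n0); rewrite mulrAC divfK //.
  by move: o0; rewrite /orient /height; lra.
by rewrite -E1 -E2 !subrKC; case: (z).
Qed.

Lemma above_below p q z : {in [:: p; q; z] &, injective h} ->
  ~ on_segment p q z -> above p q z = below p q z (+) between e p q z.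
Proof.
move=> injh nz; rewrite /above /below.
have [b|//] := boolP (between e p q z).
rewrite /=; case: (ltgtP (side e p q z) 0) => // s0; exfalso.
have pz : h p != h z.
  apply/eqP => /injh E; apply: nz; rewrite -E ?inE ?eqxx ?orbT //.
  exact: on_segment_l.
have qz : h q != h z.
  apply/eqP => /injh E; apply: nz; rewrite -E ?inE ?eqxx ?orbT //.
  exact: on_segment_r.
move: b s0; rewrite /between /side.
case: (ltgtP (h p) (h z)) pz => // pz _; case: (ltgtP (h q) (h z)) qz => // qz _ _.
  rewrite (lt_trans pz qz) => o0; exact/nz/orient0_on_segment.
rewrite ltNge (ltW (lt_trans qz pz)) /= => o0.
exact/nz/on_segmentC/orient0_on_segment.
Qed.

(** Each segment whose heights enclose that of [z] passes either over or under [z], and the number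
    of enclosing segments telescopes modulo 2 to a comparison of the two ends with [z]. *)
Lemma polyline_above_below x r z : {in z :: x :: r &, injective h} ->
  ~ on_polyline x r z ->
  polyline_above x r z =
    polyline_below x r z (+) (h x < h z) (+) (h (last x r) < h z).
Proof.
elim: r x => [|y r IH] x injh nz; first by rewrite /= addbb.
rewrite /= above_below; first last.
- by move=> zxy; apply: nz; left.
- by apply: sub_in2 injh => u; rewrite !inE => /or3P[] ->; rewrite ?orbT.
rewrite IH; first last.
- by move=> zxy; apply: nz; right.
- by apply: sub_in2 injh => u; rewrite !inE => /or3P[] ->; rewrite ?orbT.
rewrite /between; case: (below _ _ _); case: (polyline_below _ _ _);
  by do 3!case: (_ < _).
Qed.

(** Counts modulo 2 how often the sides of a curved triangle pass over the opposite corners. *)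
Definition triangle_parity a b c sab sac sbc :=
  polyline_below a sab c (+) polyline_below a sac b (+) polyline_below b sbc a.

(** Expressing [above] by [below] makes the crossing relation symmetric in the two lines, at the
    price of comparisons of heights. *)
Lemma disjoint_pair_parity a sab c scd :
  {in (a :: sab) ++ (c :: scd) &, injective h} ->
  (forall z, on_polyline a sab z -> on_polyline c scd z -> False) ->
  let b := last a sab in let d := last c scd in
  polyline_below a sab c (+) polyline_below a sab d
  (+) polyline_below c scd a (+) polyline_below c scd b =
  (h c < h a) (+) (h d < h a) (+) (h c < h b) (+) (h d < h b).
Proof.
move=> injh dis b d; have := polyline_crossing_parity injh dis.
have sub (z : R * R) : z \in a :: sab -> {in z :: c :: scd &, injective h}.
  move=> za; apply: sub_in2 injh => u; rewrite inE mem_cat => /orP[/eqP->|->].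
    by rewrite za.
  by rewrite orbT.
rewrite (polyline_above_below (sub _ (mem_head _ _))); last first.
  by move=> ca; apply: (dis a) => //; exact: on_polyline_head.
rewrite (polyline_above_below (sub _ (mem_last _ _))); last first.
  by move=> ca; apply: (dis b) => //; exact: on_polyline_last.
rewrite -/b -/d; do 4!case: (polyline_below _ _ _); by do 4!case: (_ < _).
Qed.

(* In the sum over the three pairings of {a, b, c, d} every curve-point term of
   a triangle occurs once, while the comparisons leave three pairs
   [h u < h v], [h v < h u]. *)
Lemma four_point_parity (X : seq (R * R)) a b c d sab sac sad sbc sbd scd :
  {in X &, injective h} -> uniq [:: a; b; c; d] ->
  {subset a :: sab <= X} -> {subset a :: sac <= X} -> {subset a :: sad <= X} ->
  {subset b :: sbc <= X} -> {subset b :: sbd <= X} -> {subset c :: scd <= X} ->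
  last a sab = b -> last a sac = c -> last a sad = d ->
  last b sbc = c -> last b sbd = d -> last c scd = d ->
  (forall z, on_polyline a sab z -> on_polyline c scd z -> False) ->
  (forall z, on_polyline a sac z -> on_polyline b sbd z -> False) ->
  (forall z, on_polyline a sad z -> on_polyline b sbc z -> False) ->
  triangle_parity a b c sab sac sbc (+) triangle_parity a b d sab sad sbd
  (+) triangle_parity a c d sac sad scd (+) triangle_parity b c d sbc sbd scd.
Proof.
move=> injh U Xab Xac Xad Xbc Xbd Xcd ab ac ad bc bd cd D1 D2 D3.
have inj2 s r : {subset s <= X} -> {subset r <= X} -> {in s ++ r &, injective h}.
  by move=> sX rX; apply: sub_in2 injh => u; rewrite mem_cat => /orP[/sX|/rX].
have := disjoint_pair_parity (inj2 _ _ Xab Xcd) D1; rewrite ab cd /=.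
have := disjoint_pair_parity (inj2 _ _ Xac Xbd) D2; rewrite ac bd /=.
have := disjoint_pair_parity (inj2 _ _ Xad Xbc) D3; rewrite ad bc /=.
have aX : a \in X by apply/Xab/mem_head.
have bX : b \in X by apply/Xbc/mem_head.
have cX : c \in X by apply/Xcd/mem_head.
have dX : d \in X by rewrite -cd; apply/Xcd/mem_last.
have lt_flip u v : u \in X -> v \in X -> u != v -> (h u < h v) = ~~ (h v < h u).
  move=> uX vX uv; rewrite -leNgt lt_neqAle.
  by rewrite (contra _ uv) // => /eqP/injh ->.
move: U; rewrite /= !inE !negb_or => /and4P[/and3P[nab nac nad] /andP[nbc nbd] ncd _].
rewrite (lt_flip c b) ?(lt_flip d b) ?(lt_flip d c) //; try by rewrite eq_sym.
move=> H3 H2 H1; rewrite /triangle_parity.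
rewrite (AC (3*3*3*3) ((1*4*9*12)*(2*7*6*11)*(5*8*3*10)))%AC /= H1 H2 H3.
by do 3!case: (h _ < h a); do 3!case: (_ < _).
Qed.

End Height.

Lemma exists_notin (s : seq R) : exists e, e \notin s.
Proof.
exists (1 + \sum_(u <- s) `|u|); apply/negP => es.
have: `|1 + \sum_(u <- s) `|u| | <= \sum_(u <- s) `|u|.
  by rewrite [X in _ <= X](big_rem _ es) /= lerDl sumr_ge0.
rewrite ger0_norm; first by rewrite gerDr ler10.
by rewrite addr_ge0 ?sumr_ge0.
Qed.

(** Two distinct points agree in height for at most one [e], so only finitely many values have to be
    avoided. *)
Lemma exists_injective_height (X : seq (R * R)) :
  exists e, {in X &, injective (height e)}.
Proof.
have [e eN] := exists_notin [seq (q.1 - p.1) / (p.2 - q.2) | p <- X, q <- X].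
exists e => p q pX qX /eqP; rewrite /height -subr_eq0 => /eqP pq.
have [E|/negP nE] := boolP (p.2 - q.2 == 0).
  move: pq; move/eqP: E => /subr0_eq E; rewrite E.
  by case: p q E {pX qX} => p1 p2 [q1 q2] /= <- H; congr pair; lra.
case/negP: eN; apply/allpairsP; exists (p, q); split=> //=.
by move/negP: nE => nE; apply: (mulIf nE); rewrite divfK //; lra.
Qed.

(** Double counting: in each of the five quadruples the triangle parities have an odd sum, so the
    total is odd; but each of the ten triples lies in exactly two quadruples, so it is even. *)
Theorem no_plane_K5 (v : nat -> R * R) (g : nat -> nat -> seq (R * R)) :
  (forall i j, i < j < 5 -> v i <> v j)%N ->
  (forall i j, i < j < 5 -> last (v i) (g i j) = v j)%N ->
  (forall i j k l, i < j < 5 -> k < l < 5 -> uniq [:: i; j; k; l] ->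
    forall z, on_polyline (v i) (g i j) z -> on_polyline (v k) (g k l) z -> False)%N ->
  False.
Proof.
move=> vinj glast gdis.
pose X := flatten [seq v i :: g i j | i <- iota 0 5, j <- iota 0 5].
have [e injh] := exists_injective_height X.
have gX i j : (i < j < 5)%N -> {subset v i :: g i j <= X}.
  move=> /andP[ij j5] z zg; apply/flattenP; exists (v i :: g i j) => //.
  by apply: allpairs_f; rewrite mem_iota // (ltn_trans ij j5).
pose T i j k := triangle_parity e (v i) (v j) (v k) (g i j) (g i k) (g j k).
have four i j k l : (i < j)%N -> (j < k)%N -> (k < l)%N -> (l < 5)%N ->
    T i j k (+) T i j l (+) T i k l (+) T j k l.
  move=> ij jk kl l5.
  have ik := ltn_trans ij jk; have il := ltn_trans ik kl; have jl := ltn_trans jk kl.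
  have k5 := ltn_trans kl l5; have j5 := ltn_trans jk k5.
  have ne a b : (a < b)%N -> (a == b) = false by move=> ab; rewrite ltn_eqF.
  have ne' a b : (a < b)%N -> (b == a) = false by move=> ab; rewrite gtn_eqF.
  have vne a b : (a < b < 5)%N -> (v a == v b) = false.
    by move=> ab; apply/eqP/vinj.
  apply: (four_point_parity injh); do ?[apply: gX; exact/andP];
    do ?[apply: glast; exact/andP].
  - by rewrite /= !inE !vne ?ij ?ik ?il ?jk ?jl ?kl.
  - by apply: gdis; rewrite ?ij ?kl //= !inE !(ne _ _ ij, ne _ _ ik, ne _ _ il, ne _ _ jk, ne _ _ jl, ne _ _ kl).
  - by apply: gdis; rewrite ?ik ?jl //= !inE !(ne _ _ ij, ne _ _ ik, ne _ _ il, ne' _ _ jk, ne _ _ jl, ne _ _ kl).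
  - by apply: gdis; rewrite ?il ?jk //= !inE !(ne _ _ ij, ne _ _ ik, ne _ _ il, ne _ _ jk, ne' _ _ jl, ne' _ _ kl).
have E := (four 0 1 2 3, four 0 1 2 4, four 0 1 3 4, four 0 2 3 4, four 1 2 3 4)%N.
move: E => [[[[/(_ isT isT isT isT) + /(_ isT isT isT isT)] + /(_ isT isT isT isT)]
  + /(_ isT isT isT isT)] + /(_ isT isT isT isT)].
do 3!case: (T 0%N 1%N _);
  case: (T 1%N 2%N 3%N); case: (T 1%N 2%N 4%N); case: (T 1%N 3%N 4%N); case: (T 2%N 3%N 4%N);
  by do 3!case: (T 0%N _ _).
Qed.
End PolylineParity.

(** * Polygonal lines inside open sets *)

Section PlaneTopology.
Variable R : realType.
Local Open Scope classical_set_scope.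
Local Open Scope ring_scope.
Implicit Types (p q x y z : R * R) (s : seq (R * R)) (A B C O : set (R * R)).

Lemma plane_nbhsP O x : open O -> O x ->
  exists2 r : R, 0 < r &
    forall z, `|x.1 - z.1| < r -> `|x.2 - z.2| < r -> O z.
Proof.
move=> oO Ox; have /nbhs_ballP[r r0 rO] : nbhs x O by exact: open_nbhs_nbhs.
by exists r => // z z1 z2; apply: rO; split.
Qed.

Lemma closed_segment p q : closed [set z | on_segment p q z].
Proof.
have -> : [set z | on_segment p q z] =
    (fun s : R => (p.1 + s * (q.1 - p.1), p.2 + s * (q.2 - p.2))) @` `[0, 1].
  apply/seteqP; split=> z /=.
    by case=> s s01 ->; exists s; rewrite //= in_itv.
  by case=> s; rewrite /= in_itv /= => s01 <-; exists s.
apply: compact_closed; first exact: norm_hausdorff.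
apply: continuous_compact; last exact: segment_compact.
apply: continuous_subspaceT => s.
apply: (@cvg_pair _ _ _ (nbhs s) (nbhs (p.1 + s * (q.1 - p.1))) (nbhs (p.2 + s * (q.2 - p.2)))) => /=.
  by apply: cvgD; [exact: cvg_cst|apply: cvgMl; exact: cvg_id].
by apply: cvgD; [exact: cvg_cst|apply: cvgMl; exact: cvg_id].
Qed.

Lemma closed_polyline p s : closed [set z | on_polyline p s z].
Proof.
elim: s p => [|q s IH] p /=.
  have -> : [set z | z = p] = [set p] by apply/seteqP; split.
  by apply: compact_closed; [exact: norm_hausdorff|exact: compact_set1].
have -> : [set z | on_segment p q z \/ on_polyline q s z] =
  [set z | on_segment p q z] `|` [set z | on_polyline q s z] by apply/seteqP; split.
by apply: closedU => //; exact: closed_segment.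
Qed.

Definition polyline_reach O x z :=
  exists2 s, last x s = z & forall u, on_polyline x s u -> O u.

Lemma on_segment_box p q z (r : R) : `|p.1 - q.1| < r -> `|p.2 - q.2| < r ->
  on_segment p q z -> `|p.1 - z.1| < r /\ `|p.2 - z.2| < r.
Proof.
move=> r1 r2 [t /andP[t0 t1] ->] /=; rewrite !opprD !addNKr !normrN !normrM.
rewrite (ger0_norm t0) (distrC q.1) (distrC q.2).
by split; [apply: le_lt_trans r1|apply: le_lt_trans r2]; rewrite ler_piMl.
Qed.

Lemma polyline_reach_extend O x z z' : polyline_reach O x z ->
  (forall u, on_segment z z' u -> O u) -> polyline_reach O x z'.
Proof.
case=> s sz sO zO; exists (rcons s z'); first by rewrite last_rcons.
move=> u; rewrite -cats1 => /on_polyline_cat[/sO //|/=].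
by rewrite sz; case=> [/zO//|->]; apply: zO; exact: on_segment_r.
Qed.

(** Inside [O], the points reached from [x] by polygonal lines form an open set, and so do the
    points not reached, since all points of a small box are joined to its centre. The connected set
    [C] cannot meet both. *)
Lemma connected_polyline O C x y : open O -> connected C -> C `<=` O ->
  C x -> C y -> polyline_reach O x y.
Proof.
move=> oO cC CO Cx Cy.
have loc z : O z -> exists2 r : R, 0 < r & forall z', `|z.1 - z'.1| < r ->
    `|z.2 - z'.2| < r -> forall u, on_segment z z' u -> O u.
  move=> /(plane_nbhsP oO)[r r0 rO]; exists r => // z' h1 h2 u.
  by move=> /(on_segment_box h1 h2)[]; exact: rO.
have ball_nbhs z (P : set (R * R)) : (exists2 r : R, 0 < r & forall z',
    `|z.1 - z'.1| < r -> `|z.2 - z'.2| < r -> P z') -> nbhs z P.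
  by case=> r r0 rP; apply/nbhs_ballP; exists r => // z' [z1 z2]; exact: rP.
have oR : open [set z | polyline_reach O x z].
  rewrite openE => z zR; apply: ball_nbhs.
  have Oz : O z by case: zR => s <-; apply; exact: on_polyline_last.
  have [r r0 rO] := loc z Oz; exists r => // z' h1 h2.
  exact: polyline_reach_extend zR (rO _ h1 h2).
have oN : open [set z | O z /\ ~ polyline_reach O x z].
  rewrite openE => z [Oz zR]; apply: ball_nbhs.
  have [r r0 rO] := loc z Oz; exists r => // z' h1 h2; split.
    by apply: (rO z') => //; exact: on_segment_r.
  move=> z'R; apply: zR; apply: polyline_reach_extend z'R _.
  by move=> u /on_segmentC; exact: rO.
suff : C `&` [set z | polyline_reach O x z] = C by move=> CE; move: Cy; rewrite -CE => -[].
apply: cC.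
- exists x; split=> //; exists [::] => // u ->; exact: CO.
- by exists [set z | polyline_reach O x z].
- exists (~` [set z | O z /\ ~ polyline_reach O x z]); first exact: open_closedC.
  apply/seteqP; split=> z [Cz]; first by move=> zR; split=> // -[].
  by move=> zN; split=> //; apply: contrapT => zR; apply: zN; split=> //; exact: CO.
Qed.

End PlaneTopology.

(** * Drawings of induced subgraphs *)

Section EmbeddingMinor.
Variables (R : realType) (n : nat) (G : graph n).
Variables (pos : 'I_n -> R * R) (arc : 'I_n * 'I_n -> R -> R * R).
Hypothesis emb : plane_embedding G pos arc.
Local Open Scope classical_set_scope.

Definition sub_drawing (P : pred 'I_n) : set (R * R) :=
  [set z | exists2 v, P v & z = pos v] `|`
  \bigcup_(e in [set e | edge_pair G e /\ P e.1 && P e.2])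
     (arc e @` `[0%R, 1%R]).

Lemma closed_sub_drawing P : closed (sub_drawing P).
Proof.
have [posI arcP _ _] := emb.
have hR := @norm_hausdorff R (R * R)%type.
apply: closedU.
  have -> : [set z | exists2 v, P v & z = pos v] = \bigcup_(v in [set v | P v]) [set pos v].
    apply/seteqP; split=> z.
      by case=> v Pv ->; exists v.
    by case=> v Pv ->; exists v.
  apply: closed_bigcup; first exact: finite_finset.
  by move=> v _; apply: compact_closed => //; exact: compact_set1.
apply: closed_bigcup; first exact: finite_finset.
move=> e [ee _]; have [c _ _ _] := arcP e ee.
by apply: compact_closed => //; apply: continuous_compact => //; exact: segment_compact.
Qed.

Lemma sub_drawing_sub P z : sub_drawing P z -> drawing G pos arc z.
Proof.
case=> [[v _ ->]|[e [ee _] [s s01 <-]]]; first by left; exists v.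
by right; exists e => //; exists s.
Qed.

Lemma arc_cases e s : edge_pair G e -> (`[0%R, 1%R] : set R) s ->
  [\/ arc e s = pos e.1, arc e s = pos e.2 | (0 < s < 1)%R].
Proof.
have [_ arcP _ _] := emb => ee; have [_ _ a0 a1] := arcP e ee.
rewrite /= in_itv /= => /andP[s0 s1].
have [<-|n0] := eqVneq 0%R s; first by constructor 1.
have [->|n1] := eqVneq s 1%R; first by constructor 2.
by constructor 3; rewrite !lt_neqAle n0 n1 s0 s1.
Qed.

Lemma sub_drawing_disjoint (P Q : pred 'I_n) z : (forall v, P v -> Q v -> False) ->
  sub_drawing P z -> sub_drawing Q z -> False.
Proof.
move=> PQ; have [posI arcP arcpos arcarc] := emb.
have key P' v : sub_drawing P' (pos v) -> P' v.
  case=> [[w Pw /posI ->//]|[e [ee /andP[P1 P2]] [s s01]]].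
  have [->/posI<-//|->/posI<-//|s01'] := arc_cases ee s01.
  by move/(arcpos e v s ee s01').
case=> [[v Pv ->] /key|]; first exact: PQ.
case=> e [ee /andP[P1 P2]] [s s01 <-].
have [-> /key|-> /key|s01'] := arc_cases ee s01; [exact: PQ|exact: PQ|].
case=> [[w Qw /(arcpos e w s ee s01')]//|[f [ef /andP[Q1 Q2]] [r r01]]].
have [->/esym/(arcpos e _ s ee s01')//|->/esym/(arcpos e _ s ee s01')//|r01'] := arc_cases ef r01.
apply: arcarc => // fe; apply: (PQ e.1) => //; by rewrite -fe.
Qed.

Lemma connect_sub_drawing (P : pred 'I_n) x y : P x ->
  connect (class_rel G P) x y ->
  exists C, [/\ connected C, C `<=` sub_drawing P, C (pos x) & C (pos y)].
Proof.
have [_ arcP _ _] := emb.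
move=> Px /connectP[p]; elim/last_ind: p y => [|p z IH] y.
  move=> _ ->; exists [set pos x]; split=> //; first exact: connected1.
  by move=> _ ->; left; exists x.
rewrite rcons_path last_rcons => /andP[pp /and3P[Glz Pl Pz]] ->.
have [C [cC CS Cx Cl]] := IH _ pp erefl; set l := last x p in Glz Pl Cl *.
pose e := if l < z then (l, z) else (z, l).
have ee : edge_pair G e.
  rewrite /e; case: ltngtP => lz; rewrite /edge_pair /=.
  - by [].
  - by rewrite adj_sym.
  - by move/val_inj: lz Glz => ->; rewrite adj_irr.
have [ce _ e0 e1] := arcP e ee.
have Pe : P e.1 && P e.2 by rewrite /e; case: ifP; rewrite /= Pl Pz.
have in0 : (`[0%R, 1%R] : set R) 0%R by rewrite /= in_itv /= lexx ler01.
have in1 : (`[0%R, 1%R] : set R) 1%R by rewrite /= in_itv /= lexx ler01.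
have [al az] : (arc e @` `[0%R, 1%R]) (pos l) /\ (arc e @` `[0%R, 1%R]) (pos z).
  have A1 : (arc e @` `[0%R, 1%R]) (pos e.1) by exists 0%R.
  have A2 : (arc e @` `[0%R, 1%R]) (pos e.2) by exists 1%R.
  by move: A1 A2; rewrite {2 4}/e; case: ifP.
exists (C `|` arc e @` `[0%R, 1%R]); split.
- apply: connectedU => //; first by exists (pos l).
  by apply: connected_continuous_connected => //; exact: segment_connected.
- by move=> u [/CS//|ue]; right; exists e.
- by left.
- by right.
Qed.

End EmbeddingMinor.

(** Applied to the outer region and a vertex on its boundary. *)
Lemma connected_add_closure_point (T : topologicalType) (A : set T) (z : T) :
  connected A -> closure A z -> connected (A `|` [set z])%classic.
Proof.
move=> cA Az B [y By] [O oO BO] [F cF BF].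
have AOF u : A u -> O u <-> F u.
  by move=> Au; split=> H; have : B u; [rewrite BO|rewrite BF|rewrite BF|rewrite BO];
    [split=> //; left| case|split=> //; left|case].
have AO : (A `&` O = A)%classic.
  apply: cA; [|by exists O|exists F => //]; last first.
    by apply/seteqP; split=> u [Au /(AOF u Au)].
  move: (By); rewrite BO => -[[Ay|->] Oy]; first by exists y.
  by have [|u [Au Ou]] := Az O; [exact: open_nbhs_nbhs|exists u].
have AF : (A `<=` F)%classic by move=> u Au; apply/(AOF u Au); move: Au; rewrite -{1}AO => -[].
have Fz : F z by move/closure_id: cF => ->; exact: closureS Az.
rewrite BF; apply/seteqP; split=> [u [//]|u [Au|->]]; split=> //; first by left.
- exact: AF.
- by right.
Qed.

(** The ten lines are drawn in three stages: the four to a point [o] of the outer region, the other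
    three at [v 0], and the three that remain. Each approximates a connected set inside the open
    complement of what it must avoid. The earlier lines were kept off the drawings of the other
    branch sets, so this connected set does lie in that complement. *)
Theorem outerplanar_K4_minor_free (R : realType) (n : nat) (G : graph n) :
  outerplanar R G -> ~ K4_minor G.
Proof.
move=> [pos [arc [emb [U [[o Do UE] _ bU]]]]] [f [fconn fadj]].
have Uconn : connected U by rewrite UE; exact: component_connected.
have Uo : U o by rewrite UE; exact: connected_component_refl.
have UD z : U z -> ~ drawing G pos arc z.
  by rewrite UE => /connected_component_sub.
have posI : injective pos by case: emb.
have fx i : exists x, i < 4 -> f x = i.
  have [i4|i4] := boolP (i < 4); last first.
    have [x [_ _]] := fadj 0 1 isT.
    by exists x.
  have [i3|i3] := boolP (i < 3).
    by have [x [y [xi _ _]]] := fadj i 3 (introT andP (conj i3 isT)); exists x.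
  have [x [y [_ yi _]]] := fadj 0 3 isT; exists y => _; rewrite yi.
  by case: i i4 i3 => [|[|[|[|]]]].
have [x xE] := choice fx.
pose P i j : pred 'I_n := fun v => (f v == i) || (f v == j).
pose v i := if i < 4 then pos (x i) else o.
pose K i j := sub_drawing G pos arc (P i j).
have Kclosed i j : closed (K i j) by exact: closed_sub_drawing.
have Pconn i j : i < j < 4 -> connect (class_rel G (P i j)) (x i) (x j).
  move=> ij; have /andP[lij j4] := ij; have i4 := ltn_trans lij j4.
  have [y [z [yi zj Gyz]]] := fadj i j ij.
  have sub k a b : k < 4 -> (k == i) || (k == j) -> f a = k -> f b = k ->
      connect (class_rel G (P i j)) a b.
    move=> k4 kij fa fb; have fab : f a = f b by rewrite fa.
    have := fconn a b fab; rewrite fa => /(_ k4).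
    apply: connect_sub => c d /and3P[Gcd /eqP fc /eqP fd].
    by apply/connect1/and3P; rewrite /P fc fd.
  apply: connect_trans (sub i _ _ _ _ _ yi) _ => //; rewrite ?eqxx ?xE //.
  apply: connect_trans (sub j _ _ _ _ zj _); rewrite ?eqxx ?orbT ?xE //.
  by apply/connect1/and3P; rewrite /P yi zj !eqxx orbT.
have Kconn i j : i < j < 4 -> exists C,
    [/\ connected C, (C `<=` K i j)%classic, C (v i) & C (v j)].
  move=> ij; have /andP[lij j4] := ij; have i4 := ltn_trans lij j4.
  rewrite /v i4 j4; apply: connect_sub_drawing => //; last exact: Pconn.
  by rewrite /P xE ?eqxx.
have Kdisj i j k l z : uniq [:: i; j; k; l] -> K i j z -> K k l z -> False.
  move=> U4; apply: sub_drawing_disjoint => // u /orP[]/eqP E1 /orP[]/eqP E2;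
  by move: U4; rewrite /= !inE -E1 -E2 eqxx ?orbT ?andbF.
(* [Q i j] consists of the branch sets other than [i] and [j]. Lines that belong to [i] and [j] stay
   off its drawing, which leaves room for the later ones. *)
pose Q (i j : nat) : pred 'I_n := fun u => [&& f u < 4, f u != i & f u != j].
have KQ i j k l z : k < 4 -> l < 4 -> k != i -> k != j -> l != i -> l != j ->
    K k l z -> sub_drawing G pos arc (Q i j) z.
  move=> k4 l4 ki kj li lj; have PQ u : P k l u -> Q i j u.
    by move=> /orP[]/eqP; rewrite /Q /= => ->; apply/and3P.
  case=> [[u Pu ->]|[e [ee /andP[P1 P2]] ez]]; first by left; exists u => //; exact: PQ.
  by right; exists e => //; split=> //; rewrite !PQ.
have apex i : exists s, i < 4 -> last (v i) s = o /\
    forall z, on_polyline (v i) s z -> ~ sub_drawing G pos arc (Q i i) z.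
  have [i4|//] := boolP (i < 4); last by exists [::].
  have Cconn : connected (U `|` [set v i])%classic.
    apply: connected_add_closure_point => //; rewrite /v i4.
    by case: (bU (x i)).
  have [] := @connected_polyline R (~` sub_drawing G pos arc (Q i i))%classic _ (v i) o _ Cconn.
  - by apply: closed_openC; exact: closed_sub_drawing.
  - move=> z [Uz|->].
      by move=> /sub_drawing_sub; exact: UD.
    rewrite /v i4 => H; apply: (sub_drawing_disjoint emb _ _ H (P := pred1 (x i))).
      by move=> u /eqP->; rewrite /Q /= xE // eqxx andbF.
    by left; exists (x i) => //=.
  - by right.
  - by left.
  - by move=> s sl sO; exists s.
have [a aP] := choice apex.
pose Ap i j := (\bigcup_(k in [set k : 'I_4 | (k != i :> nat) && (k != j :> nat)])
  [set z | on_polyline (v k) (a k) z])%classic.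
have Apclosed i j : closed (Ap i j).
  apply: closed_bigcup; first exact: finite_finset.
  by move=> k _; exact: closed_polyline.
have KAp i j z : i < j < 4 -> K i j z -> ~ Ap i j z.
  move=> /andP[ij j4] Kz [k /= /andP[ki kj] /(proj2 (aP k (ltn_ord k)))]; apply.
  by apply: KQ Kz; rewrite // 1?eq_sym // (ltn_trans ij).
have first j : exists s, 0 < j < 4 -> last (v 0) s = v j /\
    forall z, on_polyline (v 0) s z -> ~ Ap 0 j z /\ ~ sub_drawing G pos arc (Q 0 j) z.
  have [j4|//] := boolP (0 < j < 4); last by exists [::].
  have [C [Cc CK C0 Cj]] := Kconn 0 j j4.
  have [] := @connected_polyline R (~` (Ap 0 j `|` sub_drawing G pos arc (Q 0 j)))%classic
               _ (v 0) (v j) _ Cc _ C0 Cj.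
  - by apply: closed_openC; apply: closedU => //; exact: closed_sub_drawing.
  - move=> z /CK Kz [|]; first exact: KAp.
    apply: (sub_drawing_disjoint emb) Kz => u /orP[]/eqP; rewrite /Q /= => ->;
    by rewrite eqxx ?andbF.
  - by move=> s sl sO; exists s => _; split=> // z /sO zO; split=> zA; apply: zO; [left|right].
have [b bP] := choice first.
pose Fi i j := (\bigcup_(k in [set k : 'I_4 | [&& 0 < k, k != i :> nat & k != j :> nat]])
  [set z | on_polyline (v 0) (b k) z])%classic.
have Ficlosed i j : closed (Fi i j).
  apply: closed_bigcup; first exact: finite_finset.
  by move=> k _; exact: closed_polyline.
(* Two pairs from 1, 2, 3 always share an end, so the lines of the last stage need not avoid each
   other. *)
have second i j : exists s, 0 < i < j -> j < 4 -> last (v i) s = v j /\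
    forall z, on_polyline (v i) s z -> ~ Ap i j z /\ ~ Fi i j z.
  have [j4|j4] := boolP ((0 < i < j) && (j < 4)); last first.
    by exists [::] => h1 h2; case/negP: j4; rewrite h1.
  have /andP[/andP[i0 ij] lj4] := j4.
  have ij4 : i < j < 4 by apply/andP.
  have [C [Cc CK Ci Cj]] := Kconn i j ij4.
  have [] := @connected_polyline R (~` (Ap i j `|` Fi i j))%classic
               _ (v i) (v j) _ Cc _ Ci Cj.
  - by apply: closed_openC; apply: closedU.
  - move=> z /CK Kz [|]; first exact: KAp.
    move=> [k /= /and3P[k0 ki kj]]; have k4 := ltn_ord k.
    have [|_ bk] := bP k; first by rewrite k0.
    move=> /bk[_]; apply.
    by apply: KQ Kz; lia.
  - by move=> s sl sO; exists s => _ _; split=> // z /sO zO; split=> zA; apply: zO; [left|right].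
pose c0 i := projT1 (choice (second i)); have c0P i := projT2 (choice (second i)).
pose g i j := if j == 4 then a i else if i == 0 then b j else c0 i j.
have gAp i j z : i < j < 4 -> on_polyline (v i) (g i j) z -> ~ Ap i j z.
  move=> /andP[ij j4]; rewrite /g ltn_eqF //; case: i ij => [|i] ij /=.
    by move=> zb; have [|_ /(_ z zb)[]] := bP j; first by rewrite ij.
  by move=> zc; have [||_ /(_ z zc)[]] := c0P i.+1 j.
have gap i j k z : i < j < 4 -> k < 4 -> k != i -> k != j ->
    on_polyline (v i) (g i j) z -> on_polyline (v k) (g k 4) z -> False.
  move=> ij k4 ki kj zg zk; apply: (gAp i j z) => //; exists (Ordinal k4) => //=.
  by rewrite ki kj.
have g0 j k l z : 0 < j < 4 -> 0 < k < l -> l < 4 -> j != k -> j != l ->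
    on_polyline (v 0) (g 0 j) z -> on_polyline (v k) (g k l) z -> False.
  move=> /andP[j0 j4] kl l4 jk jl; have /andP[k0 lkl] := kl.
  rewrite /g (ltn_eqF j4) (ltn_eqF l4) (gtn_eqF k0) /= => zb zc.
  have [_ /(_ z zc)[_]] := c0P k l kl l4; apply.
  by exists (Ordinal j4) => //=; apply/and3P.
apply: (@no_plane_K5 R v g).
- move=> i j /andP[ij j5]; rewrite /v; case: (ltnP i 4) => i4; last first.
    by move: (leq_ltn_trans i4 ij); rewrite ltnNge -ltnS j5.
  case: ltnP => j4; last first.
    by move=> E; apply: (UD o Uo); left; exists (x i).
  by move=> /posI/(congr1 f); rewrite !xE // => E; rewrite E ltnn in ij.
- move=> i j /andP[ij j5]; rewrite /g; have [j4|j4] := eqVneq j 4.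
    by subst j; rewrite {2}/v ltnn; case: (aP i).
  have {j4 j5}j4 : j < 4 by rewrite ltn_neqAle j4 -ltnS.
  case: i ij => [|i] ij /=; first by case: (bP j) => //; rewrite ij.
  by case: (c0P i.+1 j).
(* The condition says that the first of the two lines is from an earlier stage, or ends in [o];
   exchanging the two lines covers the other cases. *)
- have wl i j k l : i < j < 5 -> k < l < 5 -> uniq [:: i; j; k; l] -> (j == 4) || (i == 0) && (l != 4) ->
    forall z, on_polyline (v i) (g i j) z -> on_polyline (v k) (g k l) z -> False.
    move=> /andP[ij j5] /andP[kl l5] U4 cs z zi zk.
    move: U4; rewrite /= !inE !negb_or => /and4P[/and3P[nij nik nil] /andP[njk njl] nkl _].
    case/orP: cs => [/eqP j4|/andP[/eqP i0 l4]].
      have l4 : l < 4 by rewrite ltn_neqAle -ltnS l5 andbT -j4 eq_sym.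
      by apply: (gap k l i z) => //; [lia|lia|rewrite -j4].
    have {}l4 : l < 4 by rewrite ltn_neqAle -ltnS l5 l4.
    have [j4|j4] := eqVneq j 4.
      by apply: (gap k l i z) => //; [lia|lia|rewrite -j4].
    subst i; apply: (g0 j k l z) => //.
      by rewrite ij ltn_neqAle j4 -ltnS.
    by rewrite kl andbT lt0n eq_sym.
  move=> i j k l ij kl U4 z zi zk.
  have [c1|c1] := boolP ((j == 4) || (i == 0) && (l != 4)); first exact: (wl i j k l ij kl U4 c1 z zi zk).
  have U4' : uniq [:: k; l; i; j] by rewrite (_ : [:: k; l; i; j] = rot 2 [:: i; j; k; l]) // rot_uniq.
  apply: (wl k l i j kl ij U4' _ z zk zi).
  move: c1 U4; case/andP: ij => ij j5; case/andP: kl => kl l5.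
  rewrite negb_or negb_and negbK => /andP[j4 /orP[i0|->//]].
  case: (eqVneq l 4) => //= l4; rewrite !inE; lia.
Qed.

End Topology.

(* Time O(n) on a random access machine with words of O(log (n + t)) bits,
   i.e. word values at most (n + t) ^ k for a constant k. *)
Theorem theorem1 (R : realType) :
  exists (P : program) (c k : nat),
    forall (n t : nat) (G : graph n) (es : seq ('I_n * 'I_n)),
      graph_connected G -> outerplanar R G -> 0 < t -> edge_list G es ->
      exists (T : nat) (o : seq nat),
        [/\ runs P ((n + t) ^ k) (init (input_word t es)) T o,
            T <= c * n & correct_answer G t o].

Proof.
have [P [c [k H]]] := K4_minor_free_spanner_algorithm.
exists P, c, k => n t G es Gc Go; exact: H Gc (outerplanar_K4_minor_free Go).
Qed.
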